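(* Let $A\in\Omega_\Psi$ (a pseudoergodic tridiagonal operator on $\ell^2(\mathbb Z)$) and $n\in\mathbb N$. Then $\Pi^n_{\mathrm{fin}}(A)$ can be computed in finitely many arithmetic operations, given $(\alpha_{\max},\beta_{\max},\gamma_{\max}):=\mathcal B(A)$ and $(\Sigma^n_\alpha,\Sigma^n_\beta,\Sigma^n_\gamma):=\mathcal E(A,n)$. Further, $d_H(\Pi^n_{\mathrm{fin}}(A),\mathrm{Spec}\,A)\to0$ as $n\to\infty$, and also, where $$\widehat\Pi^n_{\mathrm{fin}}(A):=\Pi^n_{\mathrm{fin}}(A)+\tfrac2n\overline{\mathbb D},$$ $d_H(\widehat\Pi^n_{\mathrm{fin}}(A),\mathrm{Spec}\,A)\to0$ as $n\to\infty$, with $\mathrm{Spec}\,A\subset\widehat\Pi^n_{\mathrm{fin}}(A)\subset\mathrm{Spec}_{\varepsilon^\dagger_n+3/n}A+\frac2n\overline{\mathbb D}$ for each $n\in\mathbb N$.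
   Context: Tridiagonal operators $A$ on $\ell^2(\mathbb Z)=\ell^2(\mathbb Z,\mathbb C)$: $(Ax)_i=\alpha_{i-1}x_{i-1}+\beta_ix_i+\gamma_{i+1}x_{i+1}$ with $\alpha,\beta,\gamma\in\ell^\infty(\mathbb Z,\mathbb C)$ (matrix entries $a_{j+1,j}=\alpha_j$, $a_{j,j}=\beta_j$, $a_{j-1,j}=\gamma_j$); $A_{n,k}:=[a_{i,j}]_{i,j=k+1}^{k+n}$. $A$ is pseudoergodic with respect to non-empty compact sets $\Sigma_\alpha,\Sigma_\beta,\Sigma_\gamma\subset\mathbb C$ if $\alpha_j\in\Sigma_\alpha$, $\beta_j\in\Sigma_\beta$, $\gamma_j\in\Sigma_\gamma$ for all $j$, and for all $\varepsilon>0$, $n\in\mathbb N$ and all tridiagonal $B_n\in\mathbb C^{n\times n}$ with subdiagonal entries in $\Sigma_\alpha$, diagonal entries in $\Sigma_\beta$, superdiagonal entries in $\Sigma_\gamma$, there is $k\in\mathbb Z$ with $\|A_{n,k}-B_n\|<\varepsilon$. $\Omega_\Psi$ is the set of tridiagonal $A$ pseudoergodic with respect to some such sets; for $A\in\Omega_\Psi$ put $\Sigma_\alpha:=\overline{\{\alpha_j:j\in\mathbb Z\}}$, and similarly $\Sigma_\beta,\Sigma_\gamma$ (then $A$ is pseudoergodic with respect to these). Input maps (any fixed maps with these properties): (1) $\mathcal B:\Omega_\Psi\to\mathbb R^3$, $A\mapsto(\alpha_{\max},\beta_{\max},\gamma_{\max})$ with $\alpha_{\max}\ge\|\alpha\|_\infty$,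 $\beta_{\max}\ge\|\beta\|_\infty$, $\gamma_{\max}\ge\|\gamma\|_\infty$; (2) $\mathcal E:\Omega_\Psi\times\mathbb N\to(P(\mathbb C))^3$, $(A,n)\mapsto(\Sigma^n_\alpha,\Sigma^n_\beta,\Sigma^n_\gamma)$, finite sets with $\Sigma^n_G\subset\Sigma_G$ and $d_H(\Sigma_G,\Sigma^n_G)\le\frac1{3n}$ for $G\in\{\alpha,\beta,\gamma\}$. Fix $t\in\mathbb C$ with $|t|=1$. $M_n(\Sigma^n_\alpha,\Sigma^n_\beta,\Sigma^n_\gamma)$ is the set of $n\times n$ tridiagonal matrices with subdiagonal entries in $\Sigma^n_\alpha$, diagonal entries in $\Sigma^n_\beta$, superdiagonal entries in $\Sigma^n_\gamma$; $B^t_n(\Sigma^n_\alpha,\Sigma^n_\gamma)$ is the set of $n\times n$ matrices with entries $b_{i,j}=\delta_{i,1}\delta_{j,n}t\widehat\alpha+\delta_{i,n}\delta_{j,1}\bar t\widehat\gamma$, for some $\widehat\alpha\in\Sigma^n_\alpha$, $\widehat\gamma\in\Sigma^n_\gamma$. Let $S^{(\pi)}_n:=M_n(\Sigma^n_\alpha,\Sigma^n_\beta,\Sigma^n_\gamma)+B^t_n(\Sigma^n_\alpha,\Sigma^n_\gamma)$ (all sums of an element of each), and $$\Delta^{n,\mathrm{fin},\pi}_\varepsilon(A):=\Big\{\lambda\in\mathbb C:\min_{B\in S^{(\pi)}_n}\nu(B-\lambda I_n)\le\varepsilon\Big\},\quad\varepsilon\ge0,$$ where $\nu(C):=\inf_{\|x\|=1}\|Cx\|$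 (Euclidean norm). With $\mathrm{Grid}(n,r):=\frac1n(\mathbb Z+\mathrm i\mathbb Z)\cap r\mathbb D$, $\mathbb D$ the open unit disc, $r\mathbb D=\{rz:z\in\mathbb D\}$, put $R:=\alpha_{\max}+\beta_{\max}+\gamma_{\max}$, $\varepsilon^\dagger_n:=(\alpha_{\max}+\gamma_{\max})\frac{22}{7n}$, and $$\Pi^n_{\mathrm{fin}}(A):=\Delta^{n,\mathrm{fin},\pi}_{\varepsilon^\dagger_n+3/n}(A)\cap\mathrm{Grid}(n,R).$$ $\mathrm{Spec}_\varepsilon B:=\{\lambda:1/\|(B-\lambda I)^{-1}\|\le\varepsilon\}$ for $\varepsilon>0$ (with $\|C^{-1}\|:=\infty$ for non-invertible $C$, $1/\infty:=0$). $d_H(S,T):=\max(\sup_{s\in S}\mathrm{dist}(s,T),\sup_{t\in T}\mathrm{dist}(t,S))$ for bounded non-empty $S,T\subset\mathbb C$. ''Arithmetic operations'' means real arithmetic operations and comparisons. *)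

(* Defs.v *)
(* MathComp world (MathComp-Analysis and real-closed): the complex numbers are
   R[i] for an arbitrary R : realType, and [Normc.normc z : R] is the modulus
   of z as a real number. *)
From HB Require Import structures.
From mathcomp Require Import all_boot all_order all_algebra.
From mathcomp Require Export complex.
From mathcomp Require Import all_classical all_reals all_analysis.

Set Implicit Arguments.
Unset Strict Implicit.
Unset Printing Implicit Defensive.

Import Order.TTheory GRing.Theory Num.Theory.
Import numFieldNormedType.Exports.

Local Open Scope classical_set_scope.
Local Open Scope complex_scope.
Local Open Scope ring_scope.

Section SubsetsOfC.
Variable R : realType.
Implicit Types S T : set R[i].

Definition mink S T : set R[i] := [set s + t | s in S & t in T].

(* [r D] and [r \overline{D}], as images of the unit discs: both are [{0}]
   when [r = 0]. *)
Definition open_disc (r : R) : set R[i] :=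
  [set r%:C * z | z in [set z : R[i] | Normc.normc z < 1]].
Definition closed_disc (r : R) : set R[i] :=
  [set r%:C * z | z in [set z : R[i] | Normc.normc z <= 1]].

Definition grid (n : nat) (r : R) : set R[i] :=
  [set l | exists a b : int, l = (a%:~R +i* b%:~R) / n%:R] `&` open_disc r.

Definition dist_to (s : R[i]) T : \bar R :=
  ereal_inf [set (Normc.normc (s - t))%:E | t in T].

(* Extended-real valued: it is [+oo] when exactly one of [S], [T] is empty, so
   that a finite bound on, or convergence to [0] of, the distance to a nonempty
   set carries non-emptiness. *)
Definition hausdorff S T : \bar R :=
  Order.max (ereal_sup [set dist_to s T | s in S])
            (ereal_sup [set dist_to t S | t in T]).

End SubsetsOfC.

Section Ell2.
Variable R : realType.
Implicit Types (x y : int -> R[i]) (T S : (int -> R[i]) -> int -> R[i]).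

Definition linf_norm x : \bar R :=
  ereal_sup (range (fun j => (Normc.normc (x j))%:E)).

Definition ell2_norm x : \bar R :=
  sqrte (\esum_(i in [set: int]) (Normc.normc (x i) ^+ 2)%:E).

Definition ell2 : set (int -> R[i]) := [set x | (ell2_norm x < +oo)%E].

(* Operators on ell2 are represented by maps on all sequences, of which only
   the action on ell2 is relevant. *)
Definition op_norm T : \bar R :=
  ereal_sup [set ell2_norm (T x) | x in [set x | (ell2_norm x <= 1)%E]].

Definition bounded_linear_op T : Prop :=
  [/\ forall x, ell2 x -> ell2 (T x),
      forall (a : R[i]) x y, ell2 x -> ell2 y ->
        T (fun i => a * x i + y i) = (fun i => a * T x i + T y i)
    & (op_norm T < +oo)%E].

Definition is_inverse T S : Prop :=
  bounded_linear_op S /\ forall x, ell2 x -> S (T x) = x /\ T (S x) = x.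

(* All inverses of [T] agree on ell2, so this is the infimum of a singleton
   when [T] is invertible; it is [+oo], the infimum of the empty set, when [T]
   is not, as the usual convention for [||T^-1||] requires. *)
Definition inv_norm T : \bar R := ereal_inf [set op_norm S | S in is_inverse T].

Definition shift_op T (l : R[i]) : (int -> R[i]) -> int -> R[i] :=
  fun x i => T x i - l * x i.

Definition Spec T : set R[i] :=
  [set l | ~ exists S, is_inverse (shift_op T l) S].

(* The extended-real inverse satisfies [+oo^-1 = 0]. *)
Definition Spec_eps (eps : R) T : set R[i] :=
  [set l | ((inv_norm (shift_op T l))^-1 <= eps%:E)%E].

End Ell2.

Section FiniteMatrices.
Variables (R : realType) (n : nat).
Implicit Types (C B : 'M[R[i]]_n).

Definition l2norm (x : 'cV[R[i]]_n) : R :=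
  Num.sqrt (\sum_(i < n) Normc.normc (x i ord0) ^+ 2).

Definition mx_opnorm C : \bar R :=
  ereal_sup [set (l2norm (C *m x))%:E | x in [set x | l2norm x <= 1]].

Definition nu C : \bar R :=
  ereal_inf [set (l2norm (C *m x))%:E | x in [set x | l2norm x = 1]].

Definition tridiag_mxs (Sa Sb Sg : set R[i]) : set 'M[R[i]]_n :=
  [set B | forall i j : 'I_n,
     [/\ (i = j.+1 :> nat -> Sa (B i j)),
         (i = j -> Sb (B i j)),
         (j = i.+1 :> nat -> Sg (B i j))
       & ((i <> j.+1 :> nat) -> i <> j -> (j <> i.+1 :> nat) -> B i j = 0)]].

(* For [n = 1] both corner entries fall on the single entry, and for [n = 2]
   they fall on the sub- and superdiagonal of the tridiagonal summand. *)
Definition corner_mxs (t : R[i]) (Sa Sg : set R[i]) : set 'M[R[i]]_n :=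
  [set B | exists a g : R[i], [/\ Sa a, Sg g &
     B = \matrix_(i, j)
       (((i == 0 :> nat) && (j == n.-1 :> nat))%:R * (t * a)
        + ((i == n.-1 :> nat) && (j == 0 :> nat))%:R * (t^* * g))]].

Definition periodised_mxs (t : R[i]) (Sa Sb Sg : set R[i]) : set 'M[R[i]]_n :=
  [set M + C | M in tridiag_mxs Sa Sb Sg & C in corner_mxs t Sa Sg].

(* The infimum is the minimum as soon as the three sets are finite and
   non-empty, since there are then finitely many matrices. *)
Definition Delta_fin_per (t : R[i]) (Sa Sb Sg : set R[i]) (eps : R) :
    set R[i] :=
  [set l : R[i] |
     (ereal_inf [set nu (B - l%:M) | B in periodised_mxs t Sa Sb Sg]
        <= eps%:E)%E].

End FiniteMatrices.

Section Tridiagonal.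
Variable R : realType.

(* [subd], [diag], [supd] are alpha, beta, gamma; the sub- and superdiagonal
   entries are indexed by their column. *)
Record tridiag := Tridiag {
  subd : int -> R[i];
  diag : int -> R[i];
  supd : int -> R[i] }.

Implicit Types A : tridiag.

Definition tri_op A (x : int -> R[i]) : int -> R[i] :=
  fun i => subd A (i - 1) * x (i - 1) + diag A i * x i + supd A (i + 1) * x (i + 1).

Definition entry A (i j : int) : R[i] :=
  if i == j + 1 then subd A j
  else if i == j then diag A j
  else if i == j - 1 then supd A j
  else 0.

(* Rows and columns [k + 1, ..., k + n]; the indices of ['I_n] start at 0. *)
Definition finite_section A (n : nat) (k : int) : 'M[R[i]]_n :=
  \matrix_(i, j) entry A (k + 1 + i%:Z) (k + 1 + j%:Z).

Definition pseudoergodic A (Sa Sb Sg : set R[i]) : Prop :=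
  (forall j, [/\ Sa (subd A j), Sb (diag A j) & Sg (supd A j)]) /\
  forall (eps : R) (n : nat) (B : 'M[R[i]]_n),
    0 < eps -> tridiag_mxs Sa Sb Sg B ->
    exists k : int, (mx_opnorm (finite_section A n k - B) < eps%:E)%E.

Definition Omega_Psi : set tridiag := [set A |
  [/\ (linf_norm (subd A) < +oo)%E, (linf_norm (diag A) < +oo)%E,
      (linf_norm (supd A) < +oo)%E
    & exists Sa Sb Sg : set R[i],
      [/\ Sa !=set0 /\ compact (Sa : set (R[i] : numFieldType)),
          Sb !=set0 /\ compact (Sb : set (R[i] : numFieldType)),
          Sg !=set0 /\ compact (Sg : set (R[i] : numFieldType))
        & pseudoergodic A Sa Sb Sg]]].

(* Sigma_alpha, Sigma_beta, Sigma_gamma are the closures of the ranges of the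
   three sequences. *)
Definition entry_closure (x : int -> R[i]) : set R[i] :=
  closure (range x : set (R[i] : numFieldType)).

Definition bound_map (B : tridiag -> R * R * R) : Prop :=
  forall A, Omega_Psi A ->
    [/\ (linf_norm (subd A) <= (B A).1.1%:E)%E,
        (linf_norm (diag A) <= (B A).1.2%:E)%E
      & (linf_norm (supd A) <= (B A).2%:E)%E].

Definition approximates (n : nat) (Sn S : set R[i]) : Prop :=
  [/\ finite_set Sn, Sn `<=` S & (hausdorff S Sn <= (1 / (3 * n%:R))%:E)%E].

Definition entry_set_map
    (E : tridiag -> nat -> set R[i] * set R[i] * set R[i]) : Prop :=
  forall A n, Omega_Psi A -> (0 < n)%N ->
    [/\ approximates n (E A n).1.1 (entry_closure (subd A)),
        approximates n (E A n).1.2 (entry_closure (diag A))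
      & approximates n (E A n).2 (entry_closure (supd A))].

End Tridiagonal.

Section PiFin.
Variable R : realType.
Implicit Types (n : nat) (t : R[i]) (b : R * R * R)
  (S : set R[i] * set R[i] * set R[i]).

Definition eps_dagger n b : R := (b.1.1 + b.2) * (22 / (7 * n%:R)).

Definition Pi_fin n t b S : set R[i] :=
  @Delta_fin_per R n t S.1.1 S.1.2 S.2 (eps_dagger n b + 3 / n%:R)
  `&` grid n (b.1.1 + b.1.2 + b.2).

Definition hatPi_fin n t b S : set R[i] :=
  mink (Pi_fin n t b S) (closed_disc (2 / n%:R)).

End PiFin.

(* Finitely many arithmetic operations: a real random-access machine.  Real
   numbers live in arrays and are accessed only through the field operations,
   the embedding of naturals and order comparison (there is no floor, root or
   real constant); natural-number registers serve as loop counters and array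
   indices.  Programs are finite and independent of the input, and a terminating
   run performs finitely many operations. *)

Inductive iexp :=
| IConst of nat
| IReg of nat
| IAdd of iexp & iexp
| ISub of iexp & iexp
| IMul of iexp & iexp
| IDiv of iexp & iexp
| IMod of iexp & iexp.

Inductive rexp :=
| RNat of iexp
| RGet of nat & iexp
| RAdd of rexp & rexp
| RSub of rexp & rexp
| RMul of rexp & rexp
| RDiv of rexp & rexp.

Inductive bexp :=
| BRle of rexp & rexp
| BIle of iexp & iexp
| BNot of bexp
| BAnd of bexp & bexp.

Inductive prog :=
| PSkip
| PISet of nat & iexp
| PRSet of nat & iexp & rexp
| PSeq of prog & prog
| PIf of bexp & prog & prog
| PWhile of bexp & prog.

Section Semantics.
Variable R : realType.

Record state := State {
  ireg : nat -> nat;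
  rarr : nat -> nat -> R }.

Implicit Types s : state.

Fixpoint ieval s (e : iexp) : nat :=
  match e with
  | IConst k => k
  | IReg v => ireg s v
  | IAdd e1 e2 => (ieval s e1 + ieval s e2)%N
  | ISub e1 e2 => (ieval s e1 - ieval s e2)%N
  | IMul e1 e2 => (ieval s e1 * ieval s e2)%N
  | IDiv e1 e2 => (ieval s e1 %/ ieval s e2)%N
  | IMod e1 e2 => (ieval s e1 %% ieval s e2)%N
  end.

Fixpoint reval s (e : rexp) : R :=
  match e with
  | RNat k => (ieval s k)%:R
  | RGet a k => rarr s a (ieval s k)
  | RAdd e1 e2 => reval s e1 + reval s e2
  | RSub e1 e2 => reval s e1 - reval s e2
  | RMul e1 e2 => reval s e1 * reval s e2
  | RDiv e1 e2 => reval s e1 / reval s e2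
  end.

Fixpoint beval s (e : bexp) : bool :=
  match e with
  | BRle e1 e2 => reval s e1 <= reval s e2
  | BIle e1 e2 => (ieval s e1 <= ieval s e2)%N
  | BNot e1 => ~~ beval s e1
  | BAnd e1 e2 => beval s e1 && beval s e2
  end.

Definition iset s (v k : nat) : state :=
  State (fun w => if w == v then k else ireg s w) (rarr s).

Definition rset s (a k : nat) (x : R) : state :=
  State (ireg s)
        (fun b l => if (b == a) && (l == k) then x else rarr s b l).

Inductive exec : prog -> state -> state -> Prop :=
| exec_skip s : exec PSkip s s
| exec_iset s v e : exec (PISet v e) s (iset s v (ieval s e))
| exec_rset s a k e :
    exec (PRSet a k e) s (rset s a (ieval s k) (reval s e))
| exec_seq p q s1 s2 s3 :
    exec p s1 s2 -> exec q s2 s3 -> exec (PSeq p q) s1 s3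
| exec_if b p q s1 s2 :
    exec (if beval s1 b then p else q) s1 s2 -> exec (PIf b p q) s1 s2
| exec_while_false b p s :
    beval s b = false -> exec (PWhile b p) s s
| exec_while_true b p s1 s2 s3 :
    beval s1 b = true -> exec p s1 s2 -> exec (PWhile b p) s2 s3 ->
    exec (PWhile b p) s1 s3.

Definition encode (l : seq R[i]) : seq R :=
  flatten [seq [:: complex.Re z; complex.Im z] | z <- l].

Definition input_state (n : nat) (t : R[i]) (b : R * R * R)
    (sa sb sg : seq R[i]) : state :=
  State (nth 0%N [:: n; size sa; size sb; size sg])
        (fun a => nth 0 (nth [::]
           [:: [:: b.1.1; b.1.2; b.2; complex.Re t; complex.Im t];
               encode sa; encode sb; encode sg] a)).

(* Register 0 holds the number of output points, array 0 their interleaved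
   real and imaginary parts. *)
Definition output_set s : set R[i] :=
  [set z | exists2 k : nat, (k < ireg s 0)%N &
     z = (rarr s 0 k.*2 +i* rarr s 0 k.*2.+1)].

(* The finite sets are given to the program by arbitrary listings of their
   elements. *)
Definition computes (p : prog) (n : nat) (t : R[i]) (b : R * R * R)
    (S : set R[i] * set R[i] * set R[i]) (out : set R[i]) : Prop :=
  forall sa sb sg : seq R[i],
    [set` sa] = S.1.1 -> [set` sb] = S.1.2 -> [set` sg] = S.2 ->
    exists2 s, exec p (input_state n t b sa sb sg) s & output_set s = out.

End Semantics.

(* Main.v *)
(* Spectral inclusion.  Let [l] be in the spectrum of [A].  Then [A - l] or its
   adjoint is not bounded below: otherwise [T = A - l] would be invertible, since
   [I - s T T^*] is a contraction for small [s], which makes [T] onto.  Cut an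
   almost null vector into all windows of length [n], multiplied by the weights
   [sin ((i + 1/2) pi / n)].  The weights are antiperiodic, so the periodised
   sections act on the windows like [A - l] up to an error whose total square is
   governed by [\sum (w_i - w_{i-1})^2 = 4 sin^2 (pi / 2n) \sum w_i^2], whence
   the constant [22 / 7 >= pi].  Hence some periodised matrix has [nu <= eps_dagger];
   rounding its entries into the finite sets costs at most [1 / n], and rounding
   [l] towards [0] onto the grid at most [2 / n].

   Conversely, a vector [x] with [|(B - l) x| <= eps |x|] for a periodised matrix
   [B] extends to a twisted periodic vector of the periodic operator built from
   [B], which pseudoergodicity makes a limit operator of [A].  Truncating to [N]
   periods and letting [N] grow shows that every lower bound of [A - l] is at most
   [eps].  This gives the inclusion in the pseudospectrum, and by compactness the
   convergence, because [A - l] has a positive lower bound off the spectrum.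

   Computability.  [nu C <= eps] fails exactly when [C^* C - eps^2] is positive
   definite, i.e. when Gaussian elimination meets only positive pivots, so finitely
   many matrices and grid points have to be tested by rational operations. *)
Require Import Defs.
From HB Require Import structures.
From mathcomp Require Import all_boot all_order all_algebra.
From mathcomp Require Import complex.
From mathcomp Require Import all_classical all_reals all_analysis.
From mathcomp Require Import zify ring lra.
Import Order.TTheory GRing.Theory Num.Theory.
Import numFieldNormedType.Exports.
Local Open Scope classical_set_scope.
Local Open Scope ring_scope.

Set Implicit Arguments.
Unset Strict Implicit.
Unset Printing Implicit Defensive.

(** * Square-summable families *)

(** Lower bounds [d * nrm x <= nrm (T x)] are the common currency, since they pass between finite
    matrices, limit operators and [A]. The spectral inclusion is proved in contrapositive form: if
    all periodised matrices minus [mu] are bounded below by [eps], then [A - l] is bounded below by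
    [eps] minus the losses, so that no almost null vector or particular window is ever chosen. The
    adjoint brings no new matrices: its periodised sections are conjugate transposes of the given
    ones, and positive lower bounds of a square matrix pass to its conjugate transpose. The
    contrapositive must end with a strictly positive bound, whereas losses of [1 / n] and [2 / n]
    would exhaust [3 / n]; the slack is found in the grid, whose cells have diagonal [sqrt 2 / n],
    below [3 / 2 / n]. As [hausdorff] is infinite against the empty set, convergence also needs a
    non-empty spectrum, and the case of [1 * 1] matrices supplies a point of it. In the program one
    flat index enumerates grid points, matrices, elimination steps and entries, so that a single
    loop with a single invariant does the testing. *)

Section Modulus.
Variable R : realType.
Implicit Types (z w : R[i]) (x y : R).
Local Notation nc := (@Normc.normc R).

Lemma nc_ge0 z : 0 <= nc z.
Proof. by case: z => a b; exact: sqrtr_ge0. Qed.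

Lemma nc_sqr z : nc z ^+ 2 = complex.Re z ^+ 2 + complex.Im z ^+ 2.
Proof. by case: z => a b; rewrite /= sqr_sqrtr// addr_ge0// sqr_ge0. Qed.

Lemma ncD z w : nc (z + w) <= nc z + nc w.
Proof. exact: le_normcD. Qed.

Lemma ncN z : nc (- z) = nc z.
Proof. exact: normcN. Qed.

Lemma ncB z w : nc (z - w) = nc (w - z).
Proof. by rewrite -ncN opprB. Qed.

Lemma ncM z w : nc (z * w) = nc z * nc w.
Proof. exact: Normc.normcM. Qed.

Lemma nc0 : nc 0 = 0.
Proof. exact: Normc.normc0. Qed.

Lemma nc1 : nc 1 = 1.
Proof. exact: Normc.normc1. Qed.

Lemma nc0_eq0 z : nc z = 0 -> z = 0.
Proof. exact: Normc.eq0_normc. Qed.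

Lemma ncX z n : nc (z ^+ n) = nc z ^+ n.
Proof. by elim: n => [|n ih]; rewrite ?expr0 ?nc1// !exprS ncM ih. Qed.

Lemma conj_def z : z^* = Complex (complex.Re z) (- complex.Im z).
Proof. by case: z. Qed.

Lemma cjD z w : (z + w)^* = z^* + w^*. Proof. exact: rmorphD. Qed.
Lemma cjM z w : (z * w)^* = z^* * w^*. Proof. exact: rmorphM. Qed.

Lemma ncJ z : nc z^* = nc z.
Proof. by rewrite conj_def; case: z => a b; rewrite /= sqrrN. Qed.

Lemma nc_real x : nc x%:C%C = `|x|.
Proof. by rewrite /= expr0n/= addr0 sqrtr_sqr. Qed.

Lemma nc_norm z : `|z| = (nc z)%:C%C.
Proof. by case: z. Qed.

Lemma nc_le_ReIm z : nc z <= `|complex.Re z| + `|complex.Im z|.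
Proof.
rewrite -(@ler_pXn2r _ 2) ?nnegrE ?nc_ge0 ?addr_ge0// nc_sqr.
by rewrite sqrrD !real_normK ?num_real// -addrA lerD2l lerDr mulrn_wge0// mulr_ge0.
Qed.

Lemma Re_le_nc z : `|complex.Re z| <= nc z.
Proof.
rewrite -(@ler_pXn2r _ 2) ?nnegrE ?nc_ge0// nc_sqr real_normK ?num_real//.
by rewrite lerDl sqr_ge0.
Qed.

Lemma Im_le_nc z : `|complex.Im z| <= nc z.
Proof.
rewrite -(@ler_pXn2r _ 2) ?nnegrE ?nc_ge0// nc_sqr real_normK ?num_real//.
by rewrite lerDr sqr_ge0.
Qed.

Lemma ReD z w : complex.Re (z + w) = complex.Re z + complex.Re w.
Proof. by case: z; case: w. Qed.
Lemma ImD z w : complex.Im (z + w) = complex.Im z + complex.Im w.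
Proof. by case: z; case: w. Qed.
Lemma ReN z : complex.Re (- z) = - complex.Re z.
Proof. by case: z. Qed.
Lemma ImN z : complex.Im (- z) = - complex.Im z.
Proof. by case: z. Qed.
Lemma Re_mul z w : complex.Re (z * w)
  = complex.Re z * complex.Re w - complex.Im z * complex.Im w.
Proof. by case: z; case: w. Qed.
Lemma Im_mul z w : complex.Im (z * w)
  = complex.Re z * complex.Im w + complex.Im z * complex.Re w.
Proof. by case: z; case: w. Qed.

Lemma complex_ext z w : complex.Re z = complex.Re w ->
  complex.Im z = complex.Im w -> z = w.
Proof. by case: z; case: w => a b c d /= -> ->. Qed.

(* The pointwise inequality behind Minkowski's: the infimum over [th] of the
   right-hand side is [(nc z + nc w) ^+ 2]. *)
Lemma nc_sqrD_le z w (th : R) : 0 < th ->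
  nc (z + w) ^+ 2 <= (1 + th) * nc z ^+ 2 + (1 + th^-1) * nc w ^+ 2.
Proof.
move=> th0.
have h : nc (z + w) ^+ 2 <= (nc z + nc w) ^+ 2.
  by rewrite ler_pXn2r ?nnegrE ?addr_ge0 ?nc_ge0// ncD.
apply: le_trans h _; rewrite -subr_ge0.
set a := nc z; set b := nc w.
have -> : (1 + th) * a ^+ 2 + (1 + th^-1) * b ^+ 2 - (a + b) ^+ 2
    = th * (a - th^-1 * b) ^+ 2.
  by field; rewrite gt_eqF.
by rewrite mulr_ge0 ?sqr_ge0// ltW.
Qed.

End Modulus.

(** * Sums of real families *)

Section RealSums.
Variables (R : realType) (I : choiceType).
Implicit Types (f g : I -> R).

Definition rsum f : \bar R := \esum_(i in [set: I]) (f i)%:E.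
Definition fsum f : R := fine (rsum f).
Definition nnsummable f : Prop := (forall i, 0 <= f i) /\ (rsum f < +oo)%E.

Lemma fsumE f : nnsummable f -> rsum f = (fsum f)%:E.
Proof.
move=> [f0 fo]; rewrite fineK// fin_numElt fo andbT.
by rewrite (lt_le_trans (ltNyr 0))// esum_ge0// => i _; rewrite lee_fin.
Qed.

Lemma rsum_ge0 f : (forall i, 0 <= f i) -> (0 <= rsum f)%E.
Proof. by move=> f0; apply: esum_ge0 => i _; rewrite lee_fin. Qed.

Lemma fsum_ge0 f : (forall i, 0 <= f i) -> 0 <= fsum f.
Proof. by move=> f0; apply: fine_ge0; exact: rsum_ge0. Qed.

Lemma nnsummableD f g : nnsummable f -> nnsummable g ->
  nnsummable (fun i => f i + g i) /\
  fsum (fun i => f i + g i) = fsum f + fsum g.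
Proof.
move=> sf sg; have [f0 fo] := sf; have [g0 go] := sg.
have h : rsum (fun i => f i + g i) = (fsum f + fsum g)%:E.
  rewrite /rsum; under eq_esum do rewrite EFinD.
  rewrite esumD; try by move=> *; rewrite lee_fin.
  by rewrite -/(rsum f) -/(rsum g) !fsumE.
split; last by rewrite /fsum h.
by split; [move=> i; rewrite addr_ge0|rewrite h ltry].
Qed.

Lemma nnsummable_le f g : (forall i, 0 <= f i) -> (forall i, f i <= g i) ->
  nnsummable g -> nnsummable f /\ fsum f <= fsum g.
Proof.
move=> f0 fg sg; have [g0 go] := sg.
have h : (rsum f <= rsum g)%E by apply: le_esum => i _; rewrite lee_fin.
have sf : nnsummable f by split=> //; exact: le_lt_trans go.
by split=> //; rewrite -lee_fin -!fsumE.
Qed.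

(** For positive [c] the inequality [le], used once with [c] and once with [c^-1], gives both
    directions. *)
Lemma rsumZ c f : 0 <= c -> (forall i, 0 <= f i) ->
  rsum (fun i => c * f i) = (c%:E * rsum f)%E.
Proof.
move=> c0 f0.
have le k g : 0 <= k -> (forall i, 0 <= g i) ->
    (rsum (fun i => (k * g i)%R) <= k%:E * rsum g)%E.
  move=> k0 g0; apply: ge_ereal_sup => _ /= [X [finX _]] <-.
  have -> : (\sum_(x \in X) (k * g x)%:E = k%:E * \sum_(x \in X) (g x)%:E)%E.
    rewrite !fsbig_finite//= ge0_sume_distrr; last by move=> *; rewrite lee_fin.
    by apply: eq_bigr => *; rewrite EFinM.
  rewrite lee_wpmul2l ?lee_fin//.
  by apply: ereal_sup_ubound; exists X.
apply/eqP; rewrite eq_le le//=.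
have [->|cn0] := eqVneq c 0.
  by rewrite mul0e rsum_ge0// => i; rewrite mul0r.
have := le c^-1 (fun i => c * f i).
rewrite invr_ge0 => /(_ c0 (fun i => mulr_ge0 c0 (f0 i))) h.
have {}h : (rsum f <= c^-1%:E * rsum (fun i => (c * f i)%R))%E.
  by apply: le_trans h; rewrite le_eqVlt; apply/orP; left; apply/eqP;
    apply: eq_esum => i _; rewrite mulKf.
apply: (@le_trans _ _ (c%:E * (c^-1%:E * rsum (fun i => (c * f i)%R)))%E).
  by rewrite lee_wpmul2l ?lee_fin.
by rewrite muleA -EFinM mulfV// mul1e.
Qed.

Lemma nnsummableZ c f : 0 <= c -> nnsummable f ->
  nnsummable (fun i => c * f i) /\ fsum (fun i => c * f i) = c * fsum f.
Proof.
move=> c0 sf; have [f0 fo] := sf.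
have h : rsum (fun i => c * f i) = (c * fsum f)%:E by rewrite rsumZ// fsumE.
split; last by rewrite /fsum h.
by split; [move=> i; rewrite mulr_ge0|rewrite h ltry].
Qed.

Lemma fsum_term f i : nnsummable f -> f i <= fsum f.
Proof.
move=> sf; have [f0 fo] := sf; rewrite -lee_fin -fsumE//.
apply: esum_ge; exists [set i]; first by split.
by rewrite fsbig_set1.
Qed.

Lemma nnsummable0 : nnsummable (fun=> 0) /\ fsum (fun=> 0) = 0.
Proof.
have h : rsum (fun=> 0) = 0%E by apply: esum1.
by split; [split=> //; rewrite h ltry|rewrite /fsum h].
Qed.

Lemma eq_fsum f g : f =1 g -> fsum f = fsum g.
Proof. by move=> /funext ->. Qed.

Lemma nnsummable_sum (J : Type) (s : seq J) (F : J -> I -> R) :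
  (forall j, nnsummable (F j)) ->
  nnsummable (fun i => \sum_(j <- s) F j i) /\
  fsum (fun i => \sum_(j <- s) F j i) = \sum_(j <- s) fsum (F j).
Proof.
move=> sF; elim: s => [|j s [ih1 ih2]].
  have -> : (fun i => \sum_(j <- [::]) F j i) = (fun=> 0).
    by apply/funext => i; rewrite big_nil.
  by rewrite big_nil; exact: nnsummable0.
have -> : (fun i => \sum_(k <- j :: s) F k i)
    = (fun i => F j i + (fun i => \sum_(k <- s) F k i) i).
  by apply/funext => i; rewrite big_cons.
by rewrite big_cons -ih2; apply: nnsummableD.
Qed.

(* Both sums have nonnegative terms; when [f] is absolutely summable their
   difference is its sum. *)
Definition ssum f : R := fsum (fun i => `|f i| + f i) - fsum (fun i => `|f i|).
Definition asummable f : Prop := nnsummable (fun i => `|f i|).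

Lemma asummable_pos f : asummable f -> nnsummable (fun i => `|f i| + f i).
Proof.
move=> sf; apply: (nnsummable_le _ _ (nnsummableZ (ler0n R 2) sf).1).1 => i.
  by rewrite addrC -lerBlDr sub0r lerNl -normrN ler_norm.
by rewrite mulr_natl mulr2n lerD2l ler_norm.
Qed.

Lemma ssum_nonneg f : nnsummable f -> asummable f /\ ssum f = fsum f.
Proof.
move=> sf; have [f0 _] := sf.
have -> : asummable f = nnsummable f.
  by congr nnsummable; apply/funext => i; rewrite ger0_norm.
split=> //; rewrite /ssum.
have -> : (fun i => `|f i| + f i) = (fun i => f i + f i).
  by apply/funext => i; rewrite ger0_norm.
have -> : (fun i => `|f i|) = f by apply/funext => i; rewrite ger0_norm.
by rewrite (nnsummableD sf sf).2 addrK.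
Qed.

Lemma ssumD f g : asummable f -> asummable g ->
  asummable (fun i => f i + g i) /\
  ssum (fun i => f i + g i) = ssum f + ssum g.
Proof.
move=> sf sg; have [sfg efg] := nnsummableD sf sg.
have sfgn : asummable (fun i => f i + g i).
  by apply: (nnsummable_le _ _ sfg).1 => // i; exact: ler_normD.
split=> //; rewrite /ssum.
have pf := asummable_pos sf; have pg := asummable_pos sg.
have pfg := asummable_pos sfgn.
have [s1 e1] := nnsummableD pfg sfg.
have [s2 e2] := nnsummableD pf pg.
have [s3 e3] := nnsummableD s2 sfgn.
(* [fsum] is additive on nonnegative families only, so the terms are regrouped into such families
   before the sums are compared. *)
have : fsum (fun i => `|f i + g i| + (f i + g i) + (`|f i| + `|g i|)) =
       fsum (fun i => `|f i| + f i + (`|g i| + g i) + `|f i + g i|).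
  by apply: eq_fsum => i; ring.
rewrite e1 e3 efg e2 => h.
lra.
Qed.

Lemma ssumZ c f : 0 <= c -> asummable f ->
  asummable (fun i => c * f i) /\ ssum (fun i => c * f i) = c * ssum f.
Proof.
move=> c0 sf; have [s1 e1] := nnsummableZ c0 sf.
have [s2 e2] := nnsummableZ c0 (asummable_pos sf).
have E : (fun i => `|c * f i|) = (fun i => c * `|f i|).
  by apply/funext => i; rewrite normrM (ger0_norm c0).
split; first by rewrite /asummable E.
rewrite /ssum E e1 mulrBr -e2; congr (_ - _).
by apply: eq_fsum => i; rewrite normrM (ger0_norm c0) mulrDr.
Qed.

End RealSums.

Lemma rsum_bij (R : realType) (I J : choiceType) (h : J -> I) (f : I -> R) :
  bijective h -> rsum (fun j => f (h j)) = rsum f.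
Proof.
move=> bh; rewrite /rsum (@reindex_esum _ _ _ [set: J] [set: I] h)//.
by rewrite setTT_bijective.
Qed.

Lemma fsum_bij (R : realType) (I J : choiceType) (h : J -> I) (f : I -> R) :
  bijective h -> fsum (fun j => f (h j)) = fsum f.
Proof. by move=> bh; rewrite /fsum rsum_bij. Qed.

Lemma nnsummable_bij (R : realType) (I J : choiceType) (h : J -> I) (f : I -> R) :
  bijective h -> nnsummable f -> nnsummable (fun j => f (h j)).
Proof. by move=> bh [f0 fo]; split=> [j|]; rewrite ?rsum_bij. Qed.

Lemma ssum_bij (R : realType) (I J : choiceType) (h : J -> I) (f : I -> R) :
  bijective h -> ssum (fun j => f (h j)) = ssum f.
Proof.
move=> bh; rewrite /ssum (fsum_bij (fun i => `|f i|) bh).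
by rewrite (fsum_bij (fun i => `|f i| + f i) bh).
Qed.

(** In the application [I] indexes the windows and [J] the positions inside a window. *)
Lemma rsum_pair (R : realType) (I : choiceType) (J : finType)
    (f : I * J -> R) : (forall p, 0 <= f p) ->
  (forall j, nnsummable (fun i => f (i, j))) ->
  nnsummable f /\ fsum f = \sum_(j : J) fsum (fun i => f (i, j)).
Proof.
move=> f0 fs.
have h : rsum f = (\sum_(j : J) fsum (fun i => f (i, j)))%:E.
  have -> : rsum f = \esum_(i in [set: I]) \esum_(j in [set: J]) (f (i, j))%:E.
    rewrite esum_esum; last by move=> *; rewrite lee_fin.
    rewrite /rsum; have -> : [set: I] `*`` (fun=> [set: J]) = [set: I * J].
      by apply/seteqP; split.
    by apply: eq_esum => -[].
  transitivity (\esum_(i in [set: I]) (\sum_(j <- index_enum J) f (i, j))%:E).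
    apply: eq_esum => i _.
    rewrite -(set_mem_set setT) esum_fset//; last by move=> *; rewrite lee_fin.
    rewrite fsbig_finite// -sumEFin.
    rewrite (perm_big (index_enum J)) ?sumEFin//; apply: uniq_perm => //.
    - by rewrite finmap.fset_uniq.
    - by rewrite (index_enum_uniq J).
    - move=> j; rewrite mem_index_enum in_fset_set//; apply/mem_set => /=.
      by rewrite in_setT.
  have [s e] := nnsummable_sum (index_enum J) fs.
  by rewrite -e -fsumE.
split; last by rewrite /fsum h.
by split=> //; rewrite h ltry.
Qed.

(** * The l2 norm and the real inner product *)

Section L2.
Variables (R : realType) (I : choiceType).
Implicit Types (x y : I -> R[i]).
Local Notation nc := (@Normc.normc R).

Definition l2 x : Prop := nnsummable (fun i => nc (x i) ^+ 2).
Definition nrm x : R := Num.sqrt (fsum (fun i => nc (x i) ^+ 2)).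

Lemma nrm_ge0 x : 0 <= nrm x. Proof. exact: sqrtr_ge0. Qed.

Lemma nrm_sqr x : nrm x ^+ 2 = fsum (fun i => nc (x i) ^+ 2).
Proof. by rewrite sqr_sqrtr// fsum_ge0// => i; rewrite sqr_ge0. Qed.

Lemma eq_nrm x y : x =1 y -> nrm x = nrm y.
Proof. by move=> /funext ->. Qed.

Lemma nc_le_nrm x i : l2 x -> nc (x i) <= nrm x.
Proof.
move=> lx; rewrite -(@ler_pXn2r _ 2) ?nnegrE ?nc_ge0 ?nrm_ge0// nrm_sqr.
exact: (fsum_term i lx).
Qed.

Lemma nrm0_eq0 x : l2 x -> nrm x = 0 -> forall i, x i = 0.
Proof.
move=> lx x0 i; apply: nc0_eq0; apply/eqP; rewrite eq_le nc_ge0 andbT -x0.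
exact: nc_le_nrm.
Qed.

Lemma l2D x y : l2 x -> l2 y ->
  l2 (fun i => x i + y i) /\ nrm (fun i => x i + y i) <= nrm x + nrm y.
Proof.
move=> lx ly.
have titu th : 0 < th -> l2 (fun i => x i + y i) /\
    nrm (fun i => x i + y i) ^+ 2
      <= (1 + th) * nrm x ^+ 2 + (1 + th^-1) * nrm y ^+ 2.
  move=> th0.
  have thi0 : 0 < th^-1 by rewrite invr_gt0.
  have [s1 e1] := nnsummableZ (ltW (addr_gt0 ltr01 th0)) lx.
  have [s2 e2] := nnsummableZ (ltW (addr_gt0 ltr01 thi0)) ly.
  have [s3 e3] := nnsummableD s1 s2.
  have [s4 e4] := nnsummable_le (fun i => sqr_ge0 (nc (x i + y i)))
    (fun i => nc_sqrD_le (x i) (y i) th0) s3.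
  by split=> //; rewrite !nrm_sqr -e1 -e2 -e3.
have l := (titu 1 ltr01).1; split=> //.
have := nrm_ge0 x; rewrite le_eqVlt => /orP[/eqP x0|x0].
  rewrite -x0 add0r (_ : (fun i => x i + y i) = y)//.
  by apply/funext => i; rewrite (nrm0_eq0 lx)// add0r.
have := nrm_ge0 y; rewrite le_eqVlt => /orP[/eqP y0|y0].
  rewrite -y0 addr0 (_ : (fun i => x i + y i) = x)//.
  by apply/funext => i; rewrite (nrm0_eq0 ly)// addr0.
(* This [th] minimises the bound of [titu], whose value then is [(nrm x + nrm y) ^+ 2]. *)
have [_] := titu (nrm y / nrm x) (divr_gt0 y0 x0).
rewrite (_ : (_ + _) = (nrm x + nrm y) ^+ 2); last by field; rewrite !gt_eqF.
by rewrite ler_pXn2r ?nnegrE ?addr_ge0 ?nrm_ge0.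
Qed.

Lemma l2_le x y c : 0 <= c -> (forall i, nc (x i) <= c * nc (y i)) -> l2 y ->
  l2 x /\ nrm x <= c * nrm y.
Proof.
move=> c0 xy ly.
have [s1 e1] := nnsummableZ (sqr_ge0 c) ly.
have le i : nc (x i) ^+ 2 <= c ^+ 2 * nc (y i) ^+ 2.
  by rewrite -exprMn ler_pXn2r ?nnegrE ?mulr_ge0 ?nc_ge0.
have [s2 e2] := nnsummable_le (fun i => sqr_ge0 (nc (x i))) le s1.
split=> //.
by rewrite -(@ler_pXn2r _ 2) ?nnegrE ?mulr_ge0 ?nrm_ge0// exprMn !nrm_sqr -e1.
Qed.

Lemma l2Z (c : R[i]) x : l2 x ->
  l2 (fun i => c * x i) /\ nrm (fun i => c * x i) = nc c * nrm x.
Proof.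
move=> lx; have E : (fun i => nc (c * x i) ^+ 2)
    = (fun i => nc c ^+ 2 * nc (x i) ^+ 2).
  by apply/funext => i; rewrite ncM exprMn.
have [s1 e1] := nnsummableZ (sqr_ge0 (nc c)) lx.
split; first by rewrite /l2 E.
by rewrite /nrm E e1 sqrtrM ?sqr_ge0// sqrtr_sqr ger0_norm ?nc_ge0.
Qed.

Lemma l2N x : l2 x -> l2 (fun i => - x i) /\ nrm (fun i => - x i) = nrm x.
Proof.
move=> lx; have [] := l2Z (-1) lx; rewrite ncN nc1 mul1r.
by rewrite (_ : (fun i => -1 * x i) = (fun i => - x i))//; apply/funext => i;
  rewrite mulN1r.
Qed.

Lemma l2B x y : l2 x -> l2 y ->
  l2 (fun i => x i - y i) /\ nrm (fun i => x i - y i) <= nrm x + nrm y.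
Proof. by move=> lx /l2N[ly <-]; apply: l2D. Qed.

Lemma l2_0 : l2 (fun=> 0) /\ nrm (fun=> 0) = 0.
Proof.
have E : (fun _ : I => nc 0 ^+ 2) = (fun=> 0) by rewrite nc0 expr0n.
by rewrite /l2 /nrm E (nnsummable0 R I).2 sqrtr0; split=> //; exact: (nnsummable0 R I).1.
Qed.

Lemma nrmB_ge x y : l2 x -> l2 y -> nrm x - nrm y <= nrm (fun i => x i - y i).
Proof.
move=> lx ly; have [l _] := l2B lx ly.
rewrite lerBlDr; have [_] := l2D l ly.
by rewrite (_ : (fun i => x i - y i + y i) = x)//; apply/funext => i;
  rewrite subrK.
Qed.

(** The terms of the real part of the inner product; the norm of [x - c y] with real [c] involves
    nothing more, so only real sums occur. *)
Definition redot x y : I -> R := fun i => complex.Re ((x i)^* * y i).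

Lemma redot_summable x y : l2 x -> l2 y -> asummable (redot x y).
Proof.
move=> lx ly; have [s e] := nnsummableD lx ly.
suff le i : `|redot x y i| <= nc (x i) ^+ 2 + nc (y i) ^+ 2.
  exact: (nnsummable_le (fun i => normr_ge0 _) le s).1.
rewrite /redot.
apply: (le_trans (Re_le_nc _)); rewrite ncM ncJ -subr_ge0.
set a := nc _; set b := nc _.
have -> : a ^+ 2 + b ^+ 2 - a * b = (a - b / 2) ^+ 2 + 3 * (b / 2) ^+ 2 by field.
exact: addr_ge0 (sqr_ge0 _) (mulr_ge0 (ler0n _ 3) (sqr_ge0 _)).
Qed.

Lemma ssum_redot_self x : l2 x -> ssum (redot x x) = nrm x ^+ 2.
Proof.
move=> lx; rewrite nrm_sqr -(ssum_nonneg lx).2; congr ssum.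
apply/funext => i; rewrite /redot conj_def nc_sqr; case: (x i) => a b /=; ring.
Qed.

Lemma nrm_subZ_sqr x y (c : R) : 0 <= c -> l2 x -> l2 y ->
  nrm (fun i => x i - c%:C%C * y i) ^+ 2
  = nrm x ^+ 2 + c ^+ 2 * nrm y ^+ 2 - 2 * c * ssum (redot x y).
Proof.
move=> c0 lx ly.
have [lcy ncy] := l2Z c%:C%C ly.
have [lxy _] := l2B lx lcy.
have [s1 e1] := ssum_nonneg lxy.
have [s2 e2] := ssumZ (mulr_ge0 (ler0n R 2) c0) (redot_summable lx ly).
have [s3 e3] := ssumD s1 s2.
have [s4 e4] := nnsummableZ (sqr_ge0 c) ly.
have [s5 e5] := nnsummableD lx s4.
rewrite nrm_sqr -e1 -e2; apply/eqP; rewrite eq_sym subr_eq -e3 !nrm_sqr -e4 -e5.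
rewrite -(ssum_nonneg s5).2; apply/eqP; congr ssum; apply/funext => i.
rewrite /redot conj_def !nc_sqr; case: (x i) => a b; case: (y i) => a' b' /=.
by ring.
Qed.

End L2.

Lemma l2_bij (R : realType) (I J : choiceType) (h : J -> I) (x : I -> R[i]) :
  bijective h -> l2 x -> l2 (fun j => x (h j)).
Proof. by move=> bh; exact: (nnsummable_bij bh). Qed.

Lemma nrm_bij (R : realType) (I J : choiceType) (h : J -> I) (x : I -> R[i]) :
  bijective h -> nrm (fun j => x (h j)) = nrm x.
Proof.
by move=> bh; rewrite /nrm (fsum_bij (fun i => Normc.normc (x i) ^+ 2) bh).
Qed.

(** * Tridiagonal operators and their invertibility *)

Section GeometricLimits.
Variable R : realType.

Lemma le0_geometric (a E q : R) : 0 <= q < 1 -> (forall N, a <= E * q ^+ N) ->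
  a <= 0.
Proof.
move=> /andP[q0 q1] h; apply/ler_addgt0Pr => e e0; rewrite add0r.
have E0 : 0 < `|E| + 1 by rewrite ltr_wpDl.
have : (fun N => q ^+ N) @ \oo --> (0 : R).
  by apply: cvg_expr; rewrite ger0_norm.
move=> /cvgrPdist_le /(_ (e / (`|E| + 1)) (divr_gt0 e0 E0)) [N _ /(_ N (leqnn N))].
rewrite /= sub0r normrN ger0_norm ?exprn_ge0// => hN.
apply: le_trans (h N) _.
apply: (@le_trans _ _ ((`|E| + 1) * q ^+ N)).
  by rewrite ler_wpM2r ?exprn_ge0// (le_trans (ler_norm _))// lerDl.
by rewrite mulrC -ler_pdivlMr.
Qed.

(** The intervals with centre [a N] and radius [e N] are nested because [e N - e N.+1 = C * q ^+ N];
    the limit is the supremum of their left ends. *)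
Lemma geometric_limit (a : nat -> R) (C q : R) : 0 <= C -> 0 <= q < 1 ->
  (forall N, `|a N.+1 - a N| <= C * q ^+ N) ->
  exists l, forall N, `|a N - l| <= C / (1 - q) * q ^+ N.
Proof.
move=> C0 /andP[q0 q1] ha.
have q1' : 0 < 1 - q by rewrite subr_gt0.
pose e N := C / (1 - q) * q ^+ N.
have e0 N : 0 <= e N by rewrite mulr_ge0 ?exprn_ge0// divr_ge0// ltW.
have eS N : e N - e N.+1 = C * q ^+ N.
  by rewrite /e exprS; field; rewrite gt_eqF.
have step N : a N - e N <= a N.+1 - e N.+1 /\ a N.+1 + e N.+1 <= a N + e N.
  by have := ha N; rewrite -eS ler_norml => /andP[]; lra.
have mono N k : a N - e N <= a (N + k)%N - e (N + k)%N /\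
    a (N + k)%N + e (N + k)%N <= a N + e N.
  elim: k => [|k [ih1 ih2]]; first by rewrite addn0.
  rewrite addnS; have [s1 s2] := step (N + k)%N.
  by split; [exact: le_trans s1|exact: le_trans ih2].
have cross N k : a N - e N <= a k + e k.
  case: (leqP N k) => [/subnKC <-|/ltnW/subnKC <-].
    by have [h1 _] := mono N (k - N)%N; have := e0 (N + (k - N))%N; lra.
  by have [_ h1] := mono k (N - k)%N; have := e0 (k + (N - k))%N; lra.
pose S := range (fun N => a N - e N).
have ubS k : ubound S (a k + e k) by move=> _ [N _ <-]; exact: cross.
have hS : has_sup S by split; [exists (a 0%N - e 0%N); exists 0%N|exists (a 0%N + e 0%N)].
exists (sup S) => N.
have h1 : a N - e N <= sup S by apply: ub_le_sup; [exact: hS.2|exists N].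
have h2 : sup S <= a N + e N by apply: ge_sup; [exact: hS.1|exact: ubS].
by rewrite -/(e N) ler_norml; lra.
Qed.

End GeometricLimits.

(** * Tridiagonal operators and their adjoints *)

Section TridiagonalOperators.
Variable R : realType.
Local Notation nc := (@Normc.normc R).
Implicit Types (x y : int -> R[i]) (A : tridiag R) (a b g M : R).

Lemma addr_bij (c : int) : bijective (fun i : int => i + c).
Proof. by exists (fun i => i - c) => i; rewrite ?addrK ?subrK. Qed.

Lemma l2_addr x c : l2 x -> l2 (fun i : int => x (i + c)).
Proof. exact: (l2_bij (addr_bij c)). Qed.

Lemma nrm_addr x c : nrm (fun i : int => x (i + c)) = nrm x.
Proof. exact: (nrm_bij x (addr_bij c)). Qed.

Lemma ell2_normE x : l2 x -> ell2_norm x = (nrm x)%:E.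
Proof. by move=> lx; rewrite /ell2_norm -/(rsum _) fsumE. Qed.

Lemma ell2E x : ell2 x <-> l2 x.
Proof.
split=> [|lx]; last by rewrite /ell2 /= ell2_normE// ltry.
rewrite /ell2 /= /ell2_norm -/(rsum _) => h.
split=> [i|]; first by rewrite sqr_ge0.
have := rsum_ge0 (fun i => sqr_ge0 (nc (x i))).
by move: h; case: (rsum _) => [r _ _||//] //=; rewrite ltry.
Qed.

Definition entry_bounds A a b g : Prop :=
  forall j, [/\ nc (subd A j) <= a, nc (diag A j) <= b & nc (supd A j) <= g].

Lemma entry_bounds_ge0 A a b g : entry_bounds A a b g ->
  [/\ 0 <= a, 0 <= b & 0 <= g].
Proof. by move=> /(_ 0) [h1 h2 h3]; split; apply: le_trans (nc_ge0 _) _; eauto. Qed.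

Lemma subd_le A a b g : entry_bounds A a b g -> forall j, nc (subd A j) <= a.
Proof. by move=> h j; have [] := h j. Qed.
Lemma diag_le A a b g : entry_bounds A a b g -> forall j, nc (diag A j) <= b.
Proof. by move=> h j; have [] := h j. Qed.
Lemma supd_le A a b g : entry_bounds A a b g -> forall j, nc (supd A j) <= g.
Proof. by move=> h j; have [] := h j. Qed.

Lemma l2_mul_bounded (u : int -> R[i]) x c : (forall i, nc (u i) <= c) ->
  l2 x -> l2 (fun i => u i * x i) /\ nrm (fun i => u i * x i) <= c * nrm x.
Proof.
move=> uc lx; apply: l2_le => // [|i]; first exact: le_trans (nc_ge0 _) (uc 0).
by rewrite ncM ler_wpM2r ?nc_ge0.
Qed.

Lemma tri_op_l2 A a b g x : entry_bounds A a b g -> l2 x ->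
  l2 (tri_op A x) /\ nrm (tri_op A x) <= (a + b + g) * nrm x.
Proof.
move=> hA lx.
have [l1 n1] := l2_mul_bounded (subd_le hA) lx.
have [l2' n2] := l2_mul_bounded (diag_le hA) lx.
have [l3 n3] := l2_mul_bounded (supd_le hA) lx.
have l1' := l2_addr (-1) l1; have l3' := l2_addr 1 l3.
have [l4 n4] := l2D l1' l2'.
have [l5 n5] := l2D l4 l3'.
split=> //; apply: le_trans n5 _; rewrite !mulrDl.
apply: lerD; last by rewrite (nrm_addr (fun i => supd A i * x i)).
by apply: le_trans n4 _; rewrite lerD// (nrm_addr (fun i => subd A i * x i)).
Qed.

(** The sup-norm bound serves the pointwise limit in the construction of the right inverse, where
    errors are controlled uniformly in the coordinate. *)
Lemma tri_op_sup A a b g x c i : entry_bounds A a b g ->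
  (forall j, nc (x j) <= c) -> nc (tri_op A x i) <= (a + b + g) * c.
Proof.
move=> hA xc; have [a0 b0 g0] := entry_bounds_ge0 hA.
apply: (le_trans (ncD _ _)); rewrite mulrDl lerD//.
  apply: (le_trans (ncD _ _)); rewrite mulrDl lerD// ncM.
    by apply: ler_pM; rewrite ?nc_ge0//; have [] := hA (i - 1).
  by apply: ler_pM; rewrite ?nc_ge0//; have [] := hA i.
by rewrite ncM; apply: ler_pM; rewrite ?nc_ge0//; have [] := hA (i + 1).
Qed.

Lemma tri_opB A x y :
  tri_op A (fun i => x i - y i) = (fun i => tri_op A x i - tri_op A y i).
Proof. by apply/funext => i; rewrite /tri_op; ring. Qed.

Lemma tri_opZ A (c : R[i]) x :
  tri_op A (fun i => c * x i) = (fun i => c * tri_op A x i).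
Proof. by apply/funext => i; rewrite /tri_op; ring. Qed.

Lemma tri_op_linear A (c : R[i]) x y :
  tri_op A (fun i => c * x i + y i)
  = (fun i => c * tri_op A x i + tri_op A y i).
Proof. by apply/funext => i; rewrite /tri_op; ring. Qed.

(** Entries are indexed by their column, so transposition shifts the index on the two
    off-diagonals. *)
Definition adj A : tridiag R :=
  Tridiag (fun j => (supd A (j + 1))^*) (fun j => (diag A j)^*)
          (fun j => (subd A (j - 1))^*).

Lemma adj_bounds A a b g : entry_bounds A a b g -> entry_bounds (adj A) g b a.
Proof.
by move=> hA j; rewrite /= !ncJ; have [_ _ ?] := hA (j + 1);
  have [_ ? _] := hA j; have [? _ _] := hA (j - 1).
Qed.

(** The three diagonals are summed separately, and a shift of the summation index by one in the two
    outer sums turns one side into the other. *)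
Lemma adjoint_identity A a b g x y : entry_bounds A a b g -> l2 x -> l2 y ->
  ssum (redot x (tri_op A y)) = ssum (redot (tri_op (adj A) x) y).
Proof.
move=> hA lx ly.
have [la _] := l2_mul_bounded (subd_le hA) ly.
have [lb _] := l2_mul_bounded (diag_le hA) ly.
have [lg _] := l2_mul_bounded (supd_le hA) ly.
pose f1 := redot (fun i => x (i + 1)) (fun i => subd A i * y i).
pose f2 := redot x (fun i => diag A i * y i).
pose f3 := redot (fun i => x (i - 1)) (fun i => supd A i * y i).
have s1 : asummable f1 := redot_summable (l2_addr 1 lx) la.
have s2 : asummable f2 := redot_summable lx lb.
have s3 : asummable f3 := redot_summable (l2_addr (-1) lx) lg.
have s1' : asummable (fun i => f1 (i - 1)).
  exact: (nnsummable_bij (addr_bij (-1)) s1).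
have s3' : asummable (fun i => f3 (i + 1)).
  exact: (nnsummable_bij (addr_bij 1) s3).
transitivity (ssum f1 + ssum f2 + ssum f3).
  rewrite -(ssum_bij f1 (addr_bij (-1))) -(ssum_bij f3 (addr_bij 1)).
  have [s4 <-] := ssumD s1' s2; have [s5 <-] := ssumD s4 s3'.
  congr ssum; apply/funext => i; rewrite /f1 /f2 /f3 /redot /tri_op.
  rewrite subrK addrK -!ReD; congr complex.Re; ring.
have [s4 <-] := ssumD s1 s2; have [s5 <-] := ssumD s4 s3.
congr ssum; apply/funext => i; rewrite /f1 /f2 /f3 /redot /tri_op /=.
rewrite subrK addrK -!ReD; congr complex.Re. 
by rewrite !cjD !cjM !conjCK; ring.
Qed.

End TridiagonalOperators.

(** * Invertibility from lower bounds of an operator and its adjoint *)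

Section Invertibility.
Variables (R : realType) (A : tridiag R) (a b g d : R).
Hypothesis hA : entry_bounds A a b g.
Hypothesis d0 : 0 < d.
Hypothesis lowA : forall x, l2 x -> d * nrm x <= nrm (tri_op A x).
Hypothesis lowA' : forall x, l2 x -> d * nrm x <= nrm (tri_op (adj A) x).
Local Notation nc := (@Normc.normc R).

Let M := a + b + g + 1.
Let T := tri_op A.
Let T' := tri_op (adj A).

Let M0 : 0 < M.
Proof. by have [? ? ?] := entry_bounds_ge0 hA; rewrite /M; lra. Qed.

Let Tl2 x : l2 x -> l2 (T x) /\ nrm (T x) <= M * nrm x.
Proof.
move=> lx; have [l n] := tri_op_l2 hA lx; split=> //; apply: le_trans n _.
by rewrite ler_wpM2r ?nrm_ge0// lerDl.
Qed.

Let T'l2 x : l2 x -> l2 (T' x) /\ nrm (T' x) <= M * nrm x.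
Proof.
move=> lx; have [l n] := tri_op_l2 (adj_bounds hA) lx; split=> //.
by apply: le_trans n _; rewrite ler_wpM2r ?nrm_ge0// /M; lra.
Qed.

Let s : R := M ^- 2.
Let K (x : int -> R[i]) : int -> R[i] := fun i => x i - s%:C%C * T (T' x) i.
Let q : R := Num.sqrt (1 - s * d ^+ 2).

Let s0 : 0 < s. Proof. by rewrite /s invr_gt0 exprn_gt0. Qed.

Let q01 : 0 <= q < 1.
Proof.
rewrite /q sqrtr_ge0/= -[ltRHS]sqrtr1 ltr_sqrt// ltrBlDr ltrDl.
by rewrite mulr_gt0// exprn_gt0.
Qed.

(* [<x, T T' x> = |T' x|^2] and [s |T v| <= |v| / M] give
   [|K x|^2 <= |x|^2 - s |T' x|^2]. *)
Let Kcontr x : l2 x -> l2 (K x) /\ nrm (K x) <= q * nrm x.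
Proof.
move=> lx; have [lT' nT'] := T'l2 lx; have [lT nT] := Tl2 lT'.
have [lsT _] := l2Z s%:C%C lT.
have [lK _] := l2B lx lsT; split=> //.
have q0 : 0 <= q by case/andP: q01.
rewrite -(@ler_pXn2r _ 2) ?nnegrE ?nrm_ge0 ?mulr_ge0 ?nrm_ge0//.
rewrite (nrm_subZ_sqr (ltW s0) lx lT) (adjoint_identity hA lx lT').
rewrite ssum_redot_self// exprMn.
(* The square root of a negative number is 0, so that only an inequality holds in general. *)
have hq : 1 - s * d ^+ 2 <= q ^+ 2.
  rewrite /q; have [h|h] := leP 0 (1 - s * d ^+ 2); first by rewrite sqr_sqrtr.
  by rewrite (le_trans (ltW h))// sqr_ge0.
apply: (@le_trans _ _ ((1 - s * d ^+ 2) * nrm x ^+ 2)); last first.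
  by rewrite ler_wpM2r ?sqr_ge0.
have h1 : s ^+ 2 * nrm (T (T' x)) ^+ 2 <= s * nrm (T' x) ^+ 2.
  have -> : s * nrm (T' x) ^+ 2 = s ^+ 2 * (M * nrm (T' x)) ^+ 2.
    by rewrite /s; field; rewrite gt_eqF.
  apply: ler_wpM2l; first exact: sqr_ge0.
  rewrite ler_pXn2r ?nnegrE ?nrm_ge0//.
  by rewrite mulr_ge0 ?nrm_ge0// ltW.
have h2 : s * (d * nrm x) ^+ 2 <= s * nrm (T' x) ^+ 2.
  apply: ler_wpM2l; first exact: ltW.
  rewrite ler_pXn2r ?nnegrE ?nrm_ge0//; first exact: lowA'.
  exact: mulr_ge0 (ltW d0) (nrm_ge0 _).
rewrite exprMn in h2; lra.
Qed.

Section RightInverse.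
Variable y : int -> R[i].
Hypothesis ly : l2 y.

(** Neumann iteration for [x = K x + y]; a fixed point satisfies [s T (T' x) = y]. *)
Let z N := iter N (fun x i => K x i + y i) (fun=> 0).

Let zl2 N : l2 (z N).
Proof.
elim: N => [|N ih]; first exact: (l2_0 R int).1.
exact: (l2D (Kcontr ih).1 ly).1.
Qed.

Let q1' : 0 < 1 - q. Proof. by rewrite subr_gt0; case/andP: q01. Qed.

Let znrm N : nrm (z N) <= nrm y / (1 - q).
Proof.
elim: N => [|N ih].
  by rewrite /z /= (l2_0 R int).2 divr_ge0 ?nrm_ge0// ltW.
apply: (le_trans (l2D (Kcontr (zl2 N)).1 ly).2).
have [_ h] := Kcontr (zl2 N).
have q0 : 0 <= q by case/andP: q01.
have h2 : q * nrm (z N) <= q * (nrm y / (1 - q)) by rewrite ler_wpM2l.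
have -> : nrm y / (1 - q) = q * (nrm y / (1 - q)) + nrm y.
  by field; rewrite gt_eqF.
by rewrite lerD// (le_trans h).
Qed.

Let dz N : l2 (fun i => z N.+1 i - z N i) /\
  nrm (fun i => z N.+1 i - z N i) <= nrm y * q ^+ N.
Proof.
elim: N => [|N [l n]].
  have -> : (fun i => z 1%N i - z 0%N i) = y.
    by apply/funext => i; rewrite /z /= /K /T /T' /tri_op; ring.
  by rewrite expr0 mulr1.
have -> : (fun i => z N.+2 i - z N.+1 i) = K (fun i => z N.+1 i - z N i).
  have -> : z N.+2 = (fun i => K (z N.+1) i + y i) by [].
  apply/funext => i; rewrite {2}/z iterS -/(z N).
  by rewrite /K /T' tri_opB /T tri_opB; ring.
have [l' n'] := Kcontr l; split=> //; apply: le_trans n' _.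
rewrite exprS mulrCA; apply: ler_wpM2l => //; by case/andP: q01.
Qed.

(** One summand for the real parts and one for the imaginary parts. *)
Let E := nrm y / (1 - q) + nrm y / (1 - q).

Let pointwise_limit : exists w : int -> R[i], forall N i,
  nc (z N i - w i) <= E * q ^+ N.
Proof.
suff /choice[w hw] : forall i, exists w, forall N, nc (z N i - w) <= E * q ^+ N.
  by exists w.
move=> i.
have h N : nc (z N.+1 i - z N i) <= nrm y * q ^+ N.
  by have [l n] := dz N; apply: le_trans n; exact: (nc_le_nrm i l).
have [|wr hr] := @geometric_limit _ (fun N => complex.Re (z N i)) _ _
  (nrm_ge0 y) q01.
  by move=> N; rewrite -ReN -ReD; exact: le_trans (Re_le_nc _) (h N).
have [|wi hi] := @geometric_limit _ (fun N => complex.Im (z N i)) _ _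
  (nrm_ge0 y) q01.
  by move=> N; rewrite -ImN -ImD; exact: le_trans (Im_le_nc _) (h N).
exists (Complex wr wi) => N; apply: (le_trans (nc_le_ReIm _)).
by rewrite ReD ReN ImD ImN /E mulrDl lerD.
Qed.

Lemma right_inverse_exists : exists x, l2 x /\ tri_op A x = y.
Proof.
have [w hw] := pointwise_limit.
have q0 : 0 <= q by case/andP: q01.
have E0 : 0 <= E.
  by rewrite /E addr_ge0// divr_ge0 ?nrm_ge0// ltW.
have lw : l2 w.
  split=> [i|]; first exact: sqr_ge0.
  (* A finite partial sum of [w] is compared with that of [z N], where [N] depends on the number of
     terms and makes the total error at most 1; the resulting bound is the same for all finite
     sets. *)
  apply: (@le_lt_trans _ _ (2 * (nrm y / (1 - q)) ^+ 2 + 1)%:E); last exact: ltry.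
  apply: ge_ereal_sup => _ /= [X [finX _] <-].
  rewrite fsbig_finite//= sumEFin lee_fin.
  set r := finmap.enum_fset (fset_set X); set k := (size r)%:R : R.
  have : 2 * k * E ^+ 2 - 2 * k * E ^+ 2 <= 0 by rewrite subrr.
  have [N hN] : exists N, 2 * k * E ^+ 2 * (q ^+ 2) ^+ N <= 1.
    apply: contrapT => /forallNP h.
    suff : 1 <= (0 : R) by rewrite ler10.
    apply: (@le0_geometric _ _ (2 * k * E ^+ 2) (q ^+ 2)).
      by rewrite sqr_ge0 expr_lt1//; case/andP: q01.
    by move=> N; have /negP := h N; rewrite -ltNge => /ltW.
  move=> _; apply: (@le_trans _ _ (\sum_(i <- r)
      (2 * nc (z N i) ^+ 2 + 2 * (E * q ^+ N) ^+ 2))).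
    apply: ler_sum => i _.
    have -> : w i = z N i + (w i - z N i) by rewrite addrC subrK.
    have := nc_sqrD_le (z N i) (w i - z N i) ltr01; rewrite invr1 => /le_trans; apply.
    rewrite lerD2l ler_wpM2l// ler_pXn2r ?nnegrE ?nc_ge0 ?mulr_ge0 ?exprn_ge0//.
    by rewrite ncB.
  rewrite big_split/= lerD//.
    rewrite -big_distrr/= ler_wpM2l//.
    apply: (@le_trans _ _ (nrm (z N) ^+ 2)); last first.
      rewrite ler_pXn2r ?nnegrE ?nrm_ge0//.
      by rewrite divr_ge0 ?nrm_ge0// ltW.
    rewrite nrm_sqr -lee_fin -fsumE//; last exact: zl2.
    apply: esum_ge; exists X => //.
    by rewrite fsbig_finite//= sumEFin.
  apply: le_trans hN; rewrite big_const_seq count_predT iter_addr_0.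
  rewrite -mulr_natl -/k exprMn -exprM mulnC exprM; lra.
(* The defect is a combination of [z N - w] and [z N.+1 - z N], hence of order [q ^+ N] for every
   [N]. *)
have eqw i : s%:C%C * T (T' w) i = y i.
  apply/eqP; rewrite -subr_eq0; apply/eqP/nc0_eq0/eqP.
  rewrite eq_le nc_ge0 andbT.
  apply: (@le0_geometric _ _ (nc s%:C%C * (M * (M * E)) + nrm y) q q01) => N.
  have -> : s%:C%C * T (T' w) i - y i =
     - (s%:C%C * T (T' (fun j => z N j - w j)) i) + - (z N.+1 i - z N i).
    by rewrite [z N.+1]iterS -/(z N) /K /T' tri_opB /T tri_opB; ring.
  apply: (le_trans (ncD _ _)); rewrite !ncN mulrDl lerD//; last first.
    by have [l n] := dz N; apply: le_trans n; exact: (nc_le_nrm i l).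
  rewrite ncM -mulrA ler_wpM2l ?nc_ge0//.
  have M1 : a + b + g <= M by rewrite lerDl.
  have M2 : g + b + a <= M by rewrite /M; lra.
  have EN0 : 0 <= E * q ^+ N by rewrite mulr_ge0 ?exprn_ge0.
  rewrite -!mulrA; apply: (le_trans (@tri_op_sup _ _ _ _ _ _ (M * (E * q ^+ N)) i hA _)).
    move=> j; apply: (le_trans (@tri_op_sup _ _ _ _ _ _ (E * q ^+ N) j (adj_bounds hA) _)).
      by move=> k; exact: hw.
    by rewrite ler_wpM2r.
  by rewrite ler_wpM2r// mulr_ge0// ltW.
exists (fun i => s%:C%C * T' w i); split; first exact: (l2Z _ (T'l2 lw).1).1.
by rewrite tri_opZ; apply/funext => i; rewrite -/T eqw.
Qed.

End RightInverse.

(** The bound for the adjoint has made [A] onto; the bound for [A] makes preimages unique, hence the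
    inverse linear, and bounds its norm by [d^-1]. *)
Lemma invertible_of_bounded_below : exists S, is_inverse (tri_op A) S.
Proof.
have [S hS] : exists S : (int -> R[i]) -> int -> R[i],
    forall y, l2 y -> l2 (S y) /\ tri_op A (S y) = y.
  (* Operators act on all sequences, so a value is also needed off [l2]; 0 is chosen there. *)
  have /choice[S hS] : forall y, exists x, l2 y -> l2 x /\ tri_op A x = y.
    move=> y; have [/right_inverse_exists[x hx]|ny] := pselect (l2 y).
      by exists x.
    by exists (fun=> 0).
  by exists S.
have inj x y : l2 x -> l2 y -> tri_op A x = tri_op A y -> x = y.
  move=> lx ly e; have [l _] := l2B lx ly.
  have := lowA l; rewrite tri_opB e.
  have -> : (fun i => tri_op A y i - tri_op A y i) = (fun=> 0).
    by apply/funext => i; rewrite subrr.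
  rewrite (l2_0 R int).2 pmulr_rle0// => n0.
  apply/funext => i; apply/eqP; rewrite -subr_eq0; apply/eqP.
  by apply: (nrm0_eq0 l); apply/eqP; rewrite eq_le n0 nrm_ge0.
exists S; split; last first.
  move=> x /ell2E lx; split; last exact: (hS x lx).2.
  by apply: inj; rewrite ?(hS _ (Tl2 lx).1).2//; exact: (hS _ (Tl2 lx).1).1.
split.
- by move=> x /ell2E lx; apply/ell2E; exact: (hS x lx).1.
- move=> c x y /ell2E lx /ell2E ly.
  have [l1 _] := l2D (l2Z c lx).1 ly.
  have [l2' _] := l2D (l2Z c (hS x lx).1).1 (hS y ly).1.
  apply: inj => //; first exact: (hS _ l1).1.
  by rewrite tri_op_linear (hS _ l1).2 (hS _ lx).2 (hS _ ly).2.
- apply: (@le_lt_trans _ _ (d^-1)%:E); last exact: ltry.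
  apply: ge_ereal_sup => _ /= [x x1 <-].
  have lx : l2 x by apply/ell2E; rewrite /ell2/= (le_lt_trans x1)// ltry.
  rewrite ell2_normE; last exact: (hS _ lx).1.
  move: x1; rewrite ell2_normE// !lee_fin => x1.
  have := lowA (hS _ lx).1; rewrite (hS _ lx).2 => h.
  by rewrite -[leRHS]mulr1 mulrC ler_pdivlMr// mulrC (le_trans h).
Qed.

End Invertibility.

(** * Sine weights *)

Section TrigonometricWeights.
Variable R : realType.
Implicit Types (x th : R) (n : nat).

(** Starting from [cos <= 1], each Taylor bound below follows from the preceding one, which is the
    sign of its derivative. *)
Lemma ge0_of_derive_ge0 (f df : R -> R) : f 0 = 0 ->
  (forall x : R, is_derive x 1 f (df x)) -> (forall x, 0 <= x -> 0 <= df x) ->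
  forall x, 0 <= x -> 0 <= f x.
Proof.
move=> f0 fd df0 x; rewrite le_eqVlt => /predU1P[<-|x0]; first by rewrite f0.
have [|c /andP[c0 _] h] := @MVT _ f df 0 x x0 (fun y _ => fd y).
  apply: continuous_subspaceT => y; apply: differentiable_continuous.
  by apply/derivable1_diffP; have [] := fd y.
move: h; rewrite f0 !subr0 => ->; apply: mulr_ge0 (ltW x0); apply: df0.
by move: c0; rewrite bnd_simp => /ltW.
Qed.

Lemma sin_le_id x : 0 <= x -> sin x <= x.
Proof.
move=> x0; rewrite -subr_ge0.
apply: (@ge0_of_derive_ge0 (fun y => y - sin y) (fun y => 1 - cos y)) => //.
by rewrite sin0 subr0.
Qed.

Lemma cos_ge_taylor2 x : 0 <= x -> 1 - x ^+ 2 / 2 <= cos x.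
Proof.
move=> x0; rewrite -subr_ge0.
apply: (@ge0_of_derive_ge0 (fun y => cos y - (1 - y ^+ 2 / 2))
  (fun y => y - sin y)) => //.
- by rewrite cos0 expr0n/= mul0r subr0 subrr.
- move=> y; apply: is_derive_eq.
  by rewrite /GRing.scale/=; field.
- by move=> y y0; rewrite subr_ge0 sin_le_id.
Qed.

Lemma sin_ge_taylor3 x : 0 <= x -> x - x ^+ 3 / 6 <= sin x.
Proof.
move=> x0; rewrite -subr_ge0.
apply: (@ge0_of_derive_ge0 (fun y => sin y - (y - y ^+ 3 / 6))
  (fun y => cos y - (1 - y ^+ 2 / 2))) => //.
- by rewrite sin0 expr0n/= mul0r !subr0.
- move=> y; apply: is_derive_eq.
  by rewrite /GRing.scale/=; field.
- by move=> y y0; rewrite subr_ge0 cos_ge_taylor2.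
Qed.

Lemma cos_le_taylor4 x : 0 <= x -> cos x <= 1 - x ^+ 2 / 2 + x ^+ 4 / 24.
Proof.
move=> x0; rewrite -subr_ge0.
apply: (@ge0_of_derive_ge0 (fun y => (1 - y ^+ 2 / 2 + y ^+ 4 / 24) - cos y)
  (fun y => sin y - (y - y ^+ 3 / 6))) => //.
- by rewrite cos0 !expr0n/= !mul0r subr0 addr0 subrr.
- move=> y; apply: is_derive_eq.
  by rewrite /GRing.scale/=; field.
- by move=> y y0; rewrite subr_ge0 sin_ge_taylor3.
Qed.

(* Two duplications of the Taylor bound at [11 / 28] give [cos (11 / 7) < 0]. *)
Lemma pi_le_22div7 : pi <= 22 / 7 :> R.
Proof.
suff h : pi / 2 <= 11 / 7 :> R by lra.
rewrite leNgt; apply/negP => h.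
have : 0 <= cos (11 / 7 : R).
  by apply: cos_ge0_pihalf; apply/andP; split; last exact: ltW; have := pi_ge0 R; lra.
(* [70 / 99] lies just below [1 / sqrt 2], so that one more duplication is negative, and
   [2 * (182 / 197) ^+ 2 - 1 <= 70 / 99]. *)
have c1 : cos (11 / 28 : R) <= 182 / 197.
  by apply: le_trans (cos_le_taylor4 _) _; lra.
have c0 : 0 <= cos (11 / 28 : R).
  by apply: cos_ge0_pihalf; apply/andP; split; have := pi_ge0 R; lra.
have c2 : cos (11 / 14 : R) <= 70 / 99.
  have -> : 11 / 14 = (11 / 28) *+ 2 :> R by rewrite -mulr_natr; field.
  rewrite cos_mulr2n -mulr_natr; nra.
have c3 : 0 <= cos (11 / 14 : R).
  by apply: cos_ge0_pihalf; apply/andP; split; have := pi_ge0 R; lra.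
have -> : 11 / 7 = (11 / 14) *+ 2 :> R by rewrite -mulr_natr; field.
rewrite cos_mulr2n -mulr_natr; nra.
Qed.

(* [w] is antiperiodic and is an eigenvector of the second difference, so it
   minimises the ratio of [\sum (w_i - w_{i-1}) ^+ 2] to [\sum w_i ^+ 2] among
   antiperiodic sequences. *)
Definition weight n (z : R) : R := sin ((z + 2^-1) * (pi / n%:R)).
(** The eigenvalue [4 sin^2 (pi / 2n)] of the negated second difference, written without the half
    angle. *)
Definition wgap n : R := 2 - 2 * cos (pi / n%:R).

Lemma weight_rec n z :
  weight n (z + 1) + weight n (z - 1) = 2 * cos (pi / n%:R) * weight n z.
Proof.
rewrite /weight; set th := pi / n%:R.
have -> : (z + 1 + 2^-1) * th = (z + 2^-1) * th + th by ring.
have -> : (z - 1 + 2^-1) * th = (z + 2^-1) * th - th by ring.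
rewrite sinD sinB; ring.
Qed.

Lemma weight_anti n z : (0 < n)%N -> weight n (z + n%:R) = - weight n z.
Proof.
move=> n0; rewrite /weight.
have -> : (z + n%:R + 2^-1) * (pi / n%:R) = (z + 2^-1) * (pi / n%:R) + pi.
  by field; rewrite pnatr_eq0 -lt0n.
by rewrite sinDpi.
Qed.

Lemma weight0_gt0 n : (0 < n)%N -> 0 < weight n 0.
Proof.
move=> n0; rewrite /weight add0r; apply: sin_gt0_pi.
have np : 0 < n%:R :> R by rewrite ltr0n.
have n1 : 1 <= n%:R :> R by rewrite ler1n.
have p0 := pi_gt0 R; apply/andP; split; first by rewrite mulr_gt0 ?divr_gt0 ?invr_gt0.
rewrite mulrCA -[ltRHS]mulr1 ltr_pM2l// -invfM invf_lt1 ?mulr_gt0//; lra.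
Qed.

Lemma weight_last n : (0 < n)%N -> weight n n.-1%:R = weight n 0.
Proof.
move=> n0; rewrite /weight.
have -> : (n.-1%:R + 2^-1) * (pi / n%:R) = - ((0 + 2^-1) * (pi / n%:R)) + pi :> R.
  have -> : n.-1%:R = n%:R - 1 :> R by rewrite -subn1 natrB.
  by field; rewrite pnatr_eq0 -lt0n.
by rewrite sinDpi sinN opprK.
Qed.

(** Summation by parts: by the recurrence the difference of the two sides telescopes, and
    [f n = f 0] because [f] is quadratic in the antiperiodic weights. *)
Lemma weight_sum_prev n : (0 < n)%N ->
  \sum_(i < n) (weight n i%:R - weight n (i%:R - 1)) ^+ 2
  = wgap n * \sum_(i < n) weight n i%:R ^+ 2.
Proof.
move=> n0; apply/eqP; rewrite mulr_sumr -subr_eq0 -sumrB; apply/eqP.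
pose f (i : nat) := weight n i%:R * weight n (i%:R - 1) - weight n (i%:R - 1) ^+ 2.
rewrite (eq_bigr (fun i : 'I_n => f i.+1 - f i)); last first.
  move=> i _; have := weight_rec n i%:R; rewrite /f /wgap.
  have -> : i.+1%:R = i%:R + 1 :> R by rewrite -natr1.
  rewrite addrK; set u := weight n (i%:R + 1); set v := weight n i%:R.
  set w := weight n (i%:R - 1); set c := cos _.
  move=> h; have -> : u = 2 * c * v - w by rewrite -h; ring.
  by ring.
rewrite -(big_mkord xpredT (fun i => f i.+1 - f i)) telescope_sumr//.
have e1 : weight n n%:R = - weight n 0 by rewrite -[in LHS](add0r n%:R) weight_anti.
have e2 : weight n (n%:R - 1) = - weight n (0 - 1).
  by rewrite -weight_anti// add0r addrC.
by rewrite /f e1 e2 sub0r; ring.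
Qed.

Lemma weight_sum_next n : (0 < n)%N ->
  \sum_(i < n) (weight n (i%:R + 1) - weight n i%:R) ^+ 2
  = wgap n * \sum_(i < n) weight n i%:R ^+ 2.
Proof.
move=> n0; apply/eqP; rewrite mulr_sumr -subr_eq0 -sumrB; apply/eqP.
pose f (i : nat) := weight n i%:R ^+ 2 - weight n i%:R * weight n (i%:R - 1).
rewrite (eq_bigr (fun i : 'I_n => f i.+1 - f i)); last first.
  move=> i _; have := weight_rec n i%:R; rewrite /f /wgap.
  have -> : i.+1%:R = i%:R + 1 :> R by rewrite -natr1.
  rewrite addrK; set u := weight n (i%:R + 1); set v := weight n i%:R.
  set w := weight n (i%:R - 1); set c := cos _.
  move=> h; have -> : u = 2 * c * v - w by rewrite -h; ring.
  by ring.
rewrite -(big_mkord xpredT (fun i => f i.+1 - f i)) telescope_sumr//.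
have e1 : weight n n%:R = - weight n 0 by rewrite -[in LHS](add0r n%:R) weight_anti.
have e2 : weight n (n%:R - 1) = - weight n (0 - 1).
  by rewrite -weight_anti// add0r addrC.
by rewrite /f e1 e2 sub0r; ring.
Qed.

Lemma wgap_ge0 n : 0 <= wgap n.
Proof. by rewrite subr_ge0 ler_piMr ?cos_le1. Qed.

Lemma sqrt_wgap_le n : (0 < n)%N -> Num.sqrt (wgap n) <= 22 / (7 * n%:R).
Proof.
move=> n0; have np : 0 < n%:R :> R by rewrite ltr0n.
have th0 : 0 <= pi / n%:R :> R by rewrite divr_ge0 ?pi_ge0// ltW.
apply: (@le_trans _ _ (pi / n%:R)).
  rewrite -(@ler_pXn2r _ 2) ?nnegrE ?sqrtr_ge0// sqr_sqrtr ?wgap_ge0//.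
  by have := cos_ge_taylor2 th0; rewrite /wgap; lra.
rewrite invfM mulrA ler_pM2r ?invr_gt0//; exact: pi_le_22div7.
Qed.

End TrigonometricWeights.

(** * Periodised matrices *)

Section LowerBounds.
Variable R : realType.
Local Notation nc := (@Normc.normc R).
Variable n : nat.
Implicit Types (B C : 'M[R[i]]_n) (x y : 'cV[R[i]]_n) (c d e : R).

Lemma l2norm_ge0 x : 0 <= l2norm x. Proof. exact: sqrtr_ge0. Qed.

Lemma l2norm_sqr x : l2norm x ^+ 2 = \sum_(i < n) nc (x i ord0) ^+ 2.
Proof. by rewrite sqr_sqrtr// sumr_ge0// => i _; rewrite sqr_ge0. Qed.

Lemma l2normZ (k : R[i]) x : l2norm (k *: x) = nc k * l2norm x.
Proof.
rewrite /l2norm (eq_bigr (fun i => nc k ^+ 2 * nc (x i ord0) ^+ 2)); last first.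
  by move=> i _; rewrite mxE ncM exprMn.
by rewrite -mulr_sumr sqrtrM ?sqr_ge0// sqrtr_sqr ger0_norm ?nc_ge0.
Qed.

Lemma l2norm0_eq0 x : l2norm x = 0 -> x = 0.
Proof.
move=> /eqP; rewrite -sqrf_eq0 l2norm_sqr psumr_eq0; last first.
  by move=> i _; rewrite sqr_ge0.
move=> /allP h; apply/colP => i; rewrite mxE; apply: nc0_eq0.
by have /implyP/(_ isT) := h i (mem_index_enum i); rewrite sqrf_eq0 => /eqP.
Qed.

Definition bounded_below c C : Prop := forall y, c * l2norm y <= l2norm (C *m y).

Lemma bounded_belowP c C :
  bounded_below c C <-> (c%:E <= nu C)%E.
Proof.
split=> [h|].
  by apply: le_ereal_inf_tmp => _ /= [x x1 <-]; rewrite lee_fin -[c]mulr1 -x1.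
move=> h y.
have [/l2norm0_eq0 ->|y0] := eqVneq (l2norm y) 0.
  by rewrite mulmx0 (_ : l2norm 0 = 0) ?mulr0 ?l2norm_ge0// -(scale0r 0) l2normZ nc0 mul0r.
have yp : 0 < l2norm y by rewrite lt_neqAle eq_sym y0 l2norm_ge0.
pose k : R[i] := ((l2norm y)^-1)%:C%C.
have nk : nc k = (l2norm y)^-1 by rewrite nc_real ger0_norm// invr_ge0 ltW.
have : (nu C <= (l2norm (C *m (k *: y)))%:E)%E.
  apply: ereal_inf_lbound; exists (k *: y) => //=.
  by rewrite l2normZ nk mulVf.
move=> /(le_trans h); rewrite -scalemxAr l2normZ nk lee_fin.
by rewrite mulrC ler_pdivlMr.
Qed.

(* With [y = C x], [|y|^2 = Re <C^* y, x>] is at most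
   [(|C^* y|^2 / c^2 + c^2 |x|^2) / 2], and [c |x| <= |y|]. *)
Lemma bounded_below_ctrmx c C : 0 < c -> bounded_below c C ->
  bounded_below c (map_mx Num.conj C^T).
Proof.
move=> c0 h y.
have unitC : C \in unitmx.
  rewrite -unitmx_tr -row_free_unit -kermx_eq0; apply/eqP/row_matrixP => i.
  rewrite row0; set r := row i _.
  have r0 : r *m C^T = 0 by rewrite -row_mul mulmx_ker row0.
  have : C *m r^T = 0 by rewrite -[C]trmxK -trmx_mul r0 trmx0.
  move=> e; have := h r^T; rewrite e.
  have -> : l2norm (0 : 'cV[R[i]]_n) = 0 by rewrite -(scale0r 0) l2normZ nc0 mul0r.
  rewrite pmulr_rle0// => l0.
  have /l2norm0_eq0 : l2norm r^T = 0 by apply/eqP; rewrite eq_le l0 l2norm_ge0.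
  by move=> /(congr1 trmx); rewrite trmxK trmx0.
set z := _ *m y; pose x := invmx C *m y.
have Cx : C *m x = y by rewrite mulKVmx.
have dual : \sum_(i < n) (y i ord0)^* * y i ord0 = \sum_(j < n) (z j ord0)^* * x j ord0.
  transitivity (\sum_(i < n) \sum_(j < n) (y i ord0)^* * (C i j * x j ord0)).
    apply: eq_bigr => i _; rewrite -mulr_sumr; congr (_ * _).
    by rewrite -[in LHS]Cx mxE.
  rewrite exchange_big; apply: eq_bigr => j _.
  have -> : z j ord0 = \sum_(i < n) (C i j)^* * y i ord0.
    by rewrite mxE; apply: eq_bigr => i _; rewrite !mxE.
  rewrite (big_morph _ (@cjD R) (rmorph0 _)) mulr_suml; apply: eq_bigr => i _.
  by rewrite cjM conjCK; ring.
have e1 : l2norm y ^+ 2 = \sum_(j < n) complex.Re ((z j ord0)^* * x j ord0).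
  rewrite l2norm_sqr; have := congr1 (@complex.Re R) dual.
  rewrite (big_morph _ (@ReD R) (erefl : complex.Re 0 = 0)).
  rewrite (big_morph _ (@ReD R) (erefl : complex.Re 0 = 0)) => <-.
  apply: eq_bigr => i _; rewrite conj_def nc_sqr; case: (y i ord0) => a b /=; ring.
have h1 : l2norm y ^+ 2 <= (c ^- 2 * l2norm z ^+ 2 + c ^+ 2 * l2norm x ^+ 2) / 2.
  rewrite e1 [l2norm z ^+ 2]l2norm_sqr [l2norm x ^+ 2]l2norm_sqr 2!mulr_sumr.
  rewrite -big_split/= mulr_suml; apply: ler_sum => j _.
  apply: (le_trans (ler_norm _)); apply: (le_trans (Re_le_nc _)).
  rewrite ncM ncJ -subr_ge0; set p := nc _; set r := nc _.
  have -> : (c ^- 2 * p ^+ 2 + c ^+ 2 * r ^+ 2) / 2 - p * r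
      = (c^-1 * p - c * r) ^+ 2 / 2 by field; rewrite gt_eqF.
  by rewrite divr_ge0 ?sqr_ge0.
have h2 : c ^+ 2 * l2norm x ^+ 2 <= l2norm y ^+ 2.
  rewrite -exprMn ler_pXn2r ?nnegrE ?l2norm_ge0//; last first.
    by rewrite mulr_ge0 ?l2norm_ge0// ltW.
  by have := h x; rewrite Cx.
rewrite -(@ler_pXn2r _ 2) ?nnegrE ?l2norm_ge0 ?mulr_ge0 ?l2norm_ge0 ?(ltW c0)//.
have : l2norm y ^+ 2 <= c ^- 2 * l2norm z ^+ 2.
  move: h1 h2; move: (l2norm y ^+ 2) (c ^+ 2 * _) (c ^- 2 * _) => p u v; lra.
by rewrite mulrC ler_pdivlMr ?exprn_gt0// exprMn mulrC.
Qed.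

End LowerBounds.

Section PeriodisedMatrices.
Variable R : realType.
Implicit Types (t : R[i]) (al be ga f : nat -> R[i]) (n : nat).

(* As in the tridiagonal operators, entries are indexed by their column;
   [al n.-1] and [ga 0] are the corner entries. *)
Definition per_mx n t al be ga : 'M[R[i]]_n := \matrix_(r, s)
  ((r == s :> nat)%:R * be s + (r == s.+1 :> nat)%:R * al s
   + (s == r.+1 :> nat)%:R * ga s
   + ((r == 0%N :> nat) && (s == n.-1 :> nat))%:R * (t * al n.-1)
   + ((r == n.-1 :> nat) && (s == 0%N :> nat))%:R * (t^* * ga 0%N)).

(** With the corners included, each of the three diagonals has exactly [n] entries, which is one
    period of a periodic operator. *)
Lemma per_mxP n t Sa Sb Sg (B : 'M[R[i]]_n) : (0 < n)%N ->
  periodised_mxs t Sa Sb Sg B <->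
  exists al be ga, (forall j, (j < n)%N -> [/\ Sa (al j), Sb (be j) & Sg (ga j)])
    /\ B = per_mx n t al be ga.
Proof.
case: n B => // n B _; split.
  move=> [M hM [C [a [g [Sa_a Sg_g ->]]] <-]].
  (* The last [al] and the first [ga] have no place in the tridiagonal part and are the corner
     entries. *)
  exists (fun j => if (j < n)%N then M (inord j.+1) (inord j) else a),
    (fun j => M (inord j) (inord j)),
    (fun j => if j is k.+1 then M (inord k) (inord j) else g).
  split.
    move=> j jn; split.
    - case: ifP => // jn'; have [h _ _ _] := hM (inord j.+1) (inord j).
      by apply: h; rewrite !inordK// ltnS ltnW.
    - by have [_ h _ _] := hM (inord j) (inord j); apply: h.
    - case: j jn => // k kn; have [_ _ h _] := hM (inord k) (inord k.+1).
      by apply: h; rewrite !inordK// ltnW.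
  apply/matrixP => r s; rewrite !mxE /= ltnn [LHS]addrA; congr (_ + _ + _).
  have [h1 h2 h3 h4] := hM r s.
  have [/val_inj rs|rs] := eqVneq (nat_of_ord r) s.
    subst s; rewrite inord_val mul1r.
    by rewrite [_ == r.+1]ltn_eqF// !mul0r !addr0.
  rewrite mul0r add0r; have [e|rs1] := eqVneq (nat_of_ord r) s.+1.
    have sn : (s < n)%N by rewrite -ltnS -e.
    rewrite mul1r sn -e !inord_val [_ == _.+1]ltn_eqF ?mul0r ?addr0//.
    by rewrite e ltnS leqnSn.
  rewrite mul0r add0r; have [e|sr1] := eqVneq (nat_of_ord s) r.+1.
    by rewrite mul1r e /= -e !inord_val.
  by rewrite mul0r h4//; [exact/eqP|move=> e; rewrite e eqxx in rs|exact/eqP].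
move=> [al [be [ga [h ->]]]].
exists (\matrix_(r, s) ((r == s :> nat)%:R * be s + (r == s.+1 :> nat)%:R * al s
   + (s == r.+1 :> nat)%:R * ga s)).
  move=> r s; rewrite mxE; split.
  - move=> e; rewrite e eqxx [s.+1 == s]gtn_eqF// [_ == _.+2]ltn_eqF//.
    by rewrite !mul0r mul1r add0r addr0; have [] := h s (ltn_ord s).
  - move=> ->; rewrite eqxx [_ == _.+1]ltn_eqF// !mul0r mul1r !addr0.
    by have [] := h s (ltn_ord s).
  - move=> e; rewrite e eqxx [_ == _.+1]ltn_eqF// [_ == _.+2]ltn_eqF//.
    by rewrite !mul0r mul1r !add0r -e; have [] := h s (ltn_ord s).
  - move=> /eqP/negbTE -> rs /eqP/negbTE ->.
    have /negbTE -> : nat_of_ord r != s by apply/eqP => /val_inj.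
    by rewrite !mul0r !addr0.
exists (\matrix_(i, j)
       (((i == 0 :> nat) && (j == n :> nat))%:R * (t * al n)
        + ((i == n :> nat) && (j == 0 :> nat))%:R * (t^* * ga 0%N))).
  exists (al n), (ga 0%N); split=> //.
  - by have [] := h n (ltnSn n).
  - by have [] := h 0%N (ltn0Sn n).
by apply/matrixP => r s; rewrite !mxE [LHS]addrA.
Qed.

Lemma sum_delta n (m : nat) (f : nat -> R[i]) :
  \sum_(j < n) (m == j :> nat)%:R * f j = (m < n)%:R * f m.
Proof.
case: ltnP => mn.
  rewrite (bigD1 (Ordinal mn))//= eqxx mul1r big1 ?addr0 ?mul1r// => j jm.
  have /negbTE -> : m != j by apply: contraNneq jm => e; apply/eqP/val_inj.
  by rewrite mul0r.
rewrite mul0r big1// => j _.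
by rewrite gtn_eqF ?mul0r// (leq_trans (ltn_ord j)).
Qed.

(** The indicator factors add up correctly also for [n = 1] and [n = 2], where corners fall on other
    entries. Extending [y] to [f] on naturals lets neighbours be named without range proofs. *)
Lemma per_mx_mul n t al be ga (y : 'cV[R[i]]_n) f (r : 'I_n) :
  (forall j : 'I_n, y j ord0 = f j) ->
  (per_mx n t al be ga *m y) r ord0 =
  be r * f r + (0 < r)%:R * (al r.-1 * f r.-1)
  + (r.+1 < n)%:R * (ga r.+1 * f r.+1)
  + (r == 0%N :> nat)%:R * (t * al n.-1 * f n.-1)
  + (r == n.-1 :> nat)%:R * (t^* * ga 0%N * f 0%N).
Proof.
move=> yf; have n0 : (0 < n)%N by apply: leq_ltn_trans (ltn_ord r).
have nn : (n.-1 < n)%N by rewrite prednK.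
rewrite mxE (eq_bigr (fun s : 'I_n =>
  (nat_of_ord r == s)%:R * (be s * f s)
  + (0 < r)%:R * ((r.-1 == s)%:R * (al s * f s))
  + (r.+1 == s)%:R * (ga s * f s)
  + (r == 0%N :> nat)%:R * ((n.-1 == s)%:R * (t * al n.-1 * f s))
  + (r == n.-1 :> nat)%:R * ((0%N == s)%:R * (t^* * ga 0%N * f s)))); last first.
  move=> s _; rewrite mxE yf.
  have -> : (nat_of_ord r == s.+1) = (0 < r)%N && (r.-1 == s) by case: (nat_of_ord r).
  rewrite [nat_of_ord s == r.+1]eq_sym [nat_of_ord s == n.-1]eq_sym [nat_of_ord s == 0%N]eq_sym.
  by do 3 rewrite -mulnb natrM; ring.
rewrite !big_split/= -!mulr_sumr.
rewrite (sum_delta n r (fun i => be i * f i)).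
rewrite (sum_delta n r.-1 (fun i => al i * f i)).
rewrite (sum_delta n r.+1 (fun i => ga i * f i)).
rewrite (sum_delta n n.-1 (fun i => t * al n.-1 * f i)).
rewrite (sum_delta n 0%N (fun i => t^* * ga 0%N * f i)).
rewrite ltn_ord n0 nn !mul1r.
have [r0|r0] := posnP r; first by rewrite r0 !mul0r.
by rewrite (leq_ltn_trans (leq_pred r))// !mul1r.
Qed.

(** Both conjugation and transposition exchange the factors [t] and [t^*] of the corners, so the
    same [t] serves the adjoint. *)
Lemma per_mx_ctr n t al be ga : (0 < n)%N ->
  map_mx Num.conj (per_mx n t al be ga)^T =
  per_mx n t (fun j => if j == n.-1 then (ga 0%N)^* else (ga j.+1)^*)
    (fun j => (be j)^*)
    (fun j => if j == 0%N then (al n.-1)^* else (al j.-1)^*).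
Proof.
move=> n0; apply/matrixP => r s; rewrite !mxE eqxx /=.
rewrite !cjD !cjM !conjCK !conjC_nat.
rewrite [nat_of_ord s == r]eq_sym [(nat_of_ord s == 0%N) && _]andbC.
rewrite [(nat_of_ord s == n.-1) && _]andbC.
have -> : (nat_of_ord r == s :> nat)%:R * (be r)^* = (r == s :> nat)%:R * (be s)^*.
  by have [->|] := eqVneq (nat_of_ord r) s => //; rewrite !mul0r.
have -> : (nat_of_ord r == s.+1)%:R * (if nat_of_ord s == n.-1 then (ga 0%N)^* else (ga s.+1)^*)
  = (nat_of_ord r == s.+1)%:R * (ga r)^*.
  have [rs|] := eqVneq (nat_of_ord r) s.+1; last by rewrite !mul0r.
  by rewrite ltn_eqF ?rs// -ltnS prednK// -rs.
have -> : (nat_of_ord s == r.+1)%:R * (if nat_of_ord s == 0%N then (al n.-1)^* else (al s.-1)^*)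
  = (nat_of_ord s == r.+1)%:R * (al r)^*.
  have [->|] := eqVneq (nat_of_ord s) r.+1 => //; by rewrite !mul0r.
by ring.
Qed.

End PeriodisedMatrices.

(** * Norms of families of windows *)

Section WindowedSums.
Variables (R : realType) (n : nat).
Local Notation nc := (@Normc.normc R).
Implicit Types (v : int * 'I_n -> R[i]).

Lemma l2_rows v : (forall i, l2 (fun k => v (k, i))) ->
  l2 v /\ nrm v ^+ 2 = \sum_(i < n) nrm (fun k => v (k, i)) ^+ 2.
Proof.
move=> lv; have [s e] := @rsum_pair _ int 'I_n (fun p => nc (v p) ^+ 2)
  (fun p => sqr_ge0 _) lv.
split; first exact: s.
by rewrite nrm_sqr e; apply: eq_bigr => i _; rewrite nrm_sqr.
Qed.

(** At a fixed position [i] the windows run through a shift of a single sequence, so each row is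
    bounded by a weight [d i] times a common norm, and the weights sum up separately. *)
Lemma nrm_rows_le v (W c : R) (d : 'I_n -> R) : 0 <= W -> 0 <= c ->
  (forall i, l2 (fun k => v (k, i)) /\ nrm (fun k => v (k, i)) <= `|d i| * c) ->
  \sum_(i < n) d i ^+ 2 = W ^+ 2 ->
  l2 v /\ nrm v <= W * c.
Proof.
move=> W0 c0 h dW; have [l e] := l2_rows (fun i => (h i).1).
split=> //; rewrite -(@ler_pXn2r _ 2) ?nnegrE ?nrm_ge0 ?mulr_ge0// e exprMn -dW.
rewrite mulr_suml; apply: ler_sum => i _.
rewrite -[d i ^+ 2]real_normK ?num_real// -exprMn.
by rewrite ler_pXn2r ?nnegrE ?nrm_ge0 ?mulr_ge0//; have [] := h i.
Qed.

Lemma nrm_rows_eq v (W c : R) (d : 'I_n -> R) : 0 <= W -> 0 <= c ->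
  (forall i, l2 (fun k => v (k, i)) /\ nrm (fun k => v (k, i)) = `|d i| * c) ->
  \sum_(i < n) d i ^+ 2 = W ^+ 2 ->
  l2 v /\ nrm v = W * c.
Proof.
move=> W0 c0 h dW; have [l e] := l2_rows (fun i => (h i).1).
split=> //; apply/eqP; rewrite -(@eqrXn2 _ 2) ?nrm_ge0 ?mulr_ge0// e exprMn -dW.
rewrite mulr_suml; apply/eqP/eq_bigr => i _.
by rewrite (h i).2 exprMn real_normK ?num_real.
Qed.

(** Matrix lower bounds hold window by window, at fixed [k], whereas norms are computed position by
    position, at fixed [i]; this exchanges the two orders. *)
Lemma nrm_slices_le (u v : int * 'I_n -> R[i]) (c : R) : 0 <= c ->
  (forall i, l2 (fun k => u (k, i))) -> (forall i, l2 (fun k => v (k, i))) ->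
  (forall k, c ^+ 2 * (\sum_(i < n) nc (u (k, i)) ^+ 2)
     <= \sum_(i < n) nc (v (k, i)) ^+ 2) ->
  c * nrm u <= nrm v.
Proof.
move=> c0 lu lv h; have [l1 e1] := l2_rows lu; have [l2' e2] := l2_rows lv.
rewrite -(@ler_pXn2r _ 2) ?nnegrE ?nrm_ge0 ?mulr_ge0 ?nrm_ge0// exprMn e1 e2.
have [s1 f1] := @nnsummable_sum _ _ _ (index_enum 'I_n) (fun i k => nc (u (k, i)) ^+ 2) lu.
have [s2 f2] := @nnsummable_sum _ _ _ (index_enum 'I_n) (fun i k => nc (v (k, i)) ^+ 2) lv.
have [s3 f3] := nnsummableZ (sqr_ge0 c) s1.
under eq_bigr do rewrite nrm_sqr.
under [leRHS]eq_bigr do rewrite nrm_sqr.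
rewrite -f1 -f2 -f3; apply: (nnsummable_le _ _ s2).2 => // k.
by rewrite mulr_ge0 ?sqr_ge0// sumr_ge0// => i _; rewrite sqr_ge0.
Qed.

End WindowedSums.

(** * From lower bounds of periodised matrices to the operator *)

Section PeriodisedLowerBound.
Variables (R : realType) (n : nat) (t : R[i]).
Local Notation nc := (@Normc.normc R).
Hypothesis n0 : (0 < n)%N.
Hypothesis t1 : nc t = 1.

Lemma l2_mul_shift (u x : int -> R[i]) (c : R) (k : R[i]) (p q : int) :
  (forall i, nc (u i) <= c) -> l2 x ->
  l2 (fun i => k * (u (i + p) * x (i + q))) /\
  nrm (fun i => k * (u (i + p) * x (i + q))) <= nc k * (c * nrm x).
Proof.
move=> uc lx.
have [l e] := @l2_mul_bounded _ (fun i => u (i + p)) _ c (fun i => uc _) (l2_addr q lx).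
have [l' e'] := l2Z k l; split=> //; rewrite e' ler_wpM2l ?nc_ge0//.
by rewrite -(nrm_addr x q).
Qed.

Variables (P : tridiag R) (a b g : R) (Sa Sb Sg : set R[i]) (mu : R[i]) (c : R).
Hypothesis hP : entry_bounds P a b g.
Hypothesis hS : forall j, [/\ Sa (subd P j), Sb (diag P j) & Sg (supd P j)].
Hypothesis c0 : 0 <= c.
Hypothesis hC : forall C, @periodised_mxs R n t Sa Sb Sg C ->
  bounded_below c (C - mu%:M).

Let w (i : nat) : R := weight n i%:R.

(* The windows [y k] of [w x] satisfy [(C k - mu) (y k) = w (P - mu) x + EA + EG],
   where the terms of the commutators [EA] and [EG] are differences of
   consecutive weights; the corner entries of [C k] contribute the sums
   [w (n - 1) + w 0], which are such differences for the antiperiodic [w]. *)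
Lemma periodised_lower_bound x : l2 x ->
  (c - (a + g) * (22 / (7 * n%:R))) * nrm x
    <= nrm (fun i => tri_op P x i - mu * x i).
Proof.
move=> lx; set D := fun i => _ - _.
have [a0 b0 g0] := entry_bounds_ge0 hP.
have lD : l2 D := (l2B (tri_op_l2 hP lx).1 (l2Z mu lx).1).1.
pose C (k : int) := per_mx n t (fun j => subd P (k + j%:Z))
  (fun j => diag P (k + j%:Z)) (fun j => supd P (k + j%:Z)).
have CS k : periodised_mxs t Sa Sb Sg (C k).
  by apply/per_mxP => //; do 3 eexists; split=> // j _; exact: hS.
pose f k (j : nat) : R[i] := (w j)%:C%C * x (k + j%:Z).
pose y k : 'cV[R[i]]_n := \col_(j < n) f k j.
pose W := Num.sqrt (\sum_(i < n) w i ^+ 2).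
have W2 : \sum_(i < n) w i ^+ 2 = W ^+ 2.
  by rewrite sqr_sqrtr// sumr_ge0// => i _; rewrite sqr_ge0.
have W0 : 0 < W.
  rewrite sqrtr_gt0 (bigD1 (Ordinal n0))//= ltr_pwDl ?exprn_gt0 ?weight0_gt0//.
  by rewrite sumr_ge0// => i _; rewrite sqr_ge0.
pose G := Num.sqrt (wgap R n).
have G0 : 0 <= G by rewrite sqrtr_ge0.
have nx := nrm_ge0 x.
pose Y (p : int * 'I_n) := f p.1 p.2.
pose V (p : int * 'I_n) := ((C p.1 - mu%:M) *m y p.1) p.2 ord0.
pose ED (p : int * 'I_n) := (w p.2)%:C%C * D (p.1 + p.2%:Z).
(* At [i = 0] the corner couples to the last entry of the same window in place of the entry before
   the window. These are different entries of [x], so the norms of the two terms are added. *)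
pose EA (p : int * 'I_n) := let k := p.1 in let i := nat_of_ord p.2 in
  if i == 0%N then t * (w n.-1)%:C%C * (subd P (k + n.-1%:Z) * x (k + n.-1%:Z))
    + - (w 0%N)%:C%C * (subd P (k + (-1)) * x (k + (-1)))
  else (w i.-1 - w i)%:C%C * (subd P (k + i.-1%:Z) * x (k + i.-1%:Z)).
pose EG (p : int * 'I_n) := let k := p.1 in let i := nat_of_ord p.2 in
  if i == n.-1 then t^* * (w 0%N)%:C%C * (supd P (k + 0%:Z) * x (k + 0%:Z))
    + - (w n.-1)%:C%C * (supd P (k + n%:Z) * x (k + n%:Z))
  else (w i.+1 - w i)%:C%C * (supd P (k + i.+1%:Z) * x (k + i.+1%:Z)).
have rcB (u v : R) : (u - v)%:C%C = u%:C%C - v%:C%C by exact: rmorphB.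
have decomp p : V p = ED p + (EA p + EG p).
  case: p => k i; rewrite /V /ED /EA /EG /=.
  have yf j : y k j ord0 = f k j by rewrite mxE.
  have -> : ((C k - mu%:M) *m y k) i ord0 = (C k *m y k) i ord0 - mu * f k i.
    by rewrite mulmxBl mul_scalar_mx [LHS]mxE; congr (_ + _); rewrite !mxE.
  rewrite (per_mx_mul _ _ _ _ _ yf) /D /tri_op /f.
  (* For [n = 1] the only row is both first and last, and both neighbours come from the corners. *)
  have [i0|i0] := eqVneq (nat_of_ord i) 0%N.
    have [en|en] := eqVneq (nat_of_ord i) n.-1.
      have n1 : n = 1%N by rewrite -(prednK n0) -en i0.
      rewrite i0 n1 /= mul0r !mul1r !addr0.
      by ring.
    have i1 : (1 < n)%N by rewrite -(prednK n0) ltnS lt0n -i0 eq_sym.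
    rewrite i0 ltnn i1 /= !mul0r !mul1r !addr0.
    by rewrite !rcB; ring.
  have ip : (0 < i)%N by rewrite lt0n.
  have e1 : k + i%:Z - 1 = k + i.-1%:Z by lia.
  have e2 : k + i%:Z + 1 = k + i.+1%:Z by lia.
  rewrite ip e1 e2 !mul0r !mul1r.
  have [en|en] := eqVneq (nat_of_ord i) n.-1.
    have -> : (i.+1 < n)%N = false by rewrite en prednK// ltnn.
    have -> : k + i.+1%:Z = k + n%:Z by rewrite en prednK.
    rewrite /= !mul0r !mul1r !addr0 -en.
    by rewrite !rcB; ring.
  have -> : (i.+1 < n)%N.
    by move: (ltn_ord i) en n0 => ? /eqP ? ?; lia.
  rewrite /= !mul0r !mul1r !addr0.
  by rewrite !rcB; ring.
have nw i : nc (w i)%:C%C = `|w i| by rewrite nc_real.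
have [lY nY] : l2 Y /\ nrm Y = W * nrm x.
  apply: (nrm_rows_eq (ltW W0) nx _ W2) => i.
  have [l e] := l2Z (w i)%:C%C (l2_addr i%:Z lx); split=> //.
  by rewrite (_ : (fun k => Y (k, i)) = (fun k => (w i)%:C%C * x (k + i%:Z)))// e nw nrm_addr.
have [lED nED] : l2 ED /\ nrm ED = W * nrm D.
  apply: (nrm_rows_eq (ltW W0) (nrm_ge0 D) _ W2) => i.
  have [l e] := l2Z (w i)%:C%C (l2_addr i%:Z lD); split=> //.
  by rewrite (_ : (fun k => ED (k, i)) = (fun k => (w i)%:C%C * D (k + i%:Z)))// e nw nrm_addr.
have W00 : 0 < w 0%N by exact: weight0_gt0.
have Wn : w n.-1 = w 0%N by exact: weight_last.
have GW : wgap R n * \sum_(i < n) weight n i%:R ^+ 2 = (G * W) ^+ 2.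
  by rewrite exprMn -W2 [G ^+ 2]sqr_sqrtr ?wgap_ge0.
have [lEA nEA] : l2 EA /\ nrm EA <= (G * W) * (a * nrm x).
  apply: (nrm_rows_le (mulr_ge0 G0 (ltW W0)) (mulr_ge0 a0 nx)); last first.
    by rewrite -GW; exact: weight_sum_prev.
  move=> i; rewrite /EA /=; have [i0|i0] := eqVneq (nat_of_ord i) 0%N.
    rewrite ?i0 ?eqxx /=.
    have [l1 e1] := l2_mul_shift (t * (w n.-1)%:C%C) n.-1%:Z n.-1%:Z (subd_le hP) lx.
    have [l2' e2] := l2_mul_shift (- (w 0%N)%:C%C) (-1) (-1) (subd_le hP) lx.
    have [l e] := l2D l1 l2'; split=> //; apply: (le_trans e).
    rewrite (_ : weight n 0%:R - weight n (0%:R - 1) = w 0%N + w 0%N); last first.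
      have e0 := @weight_anti R n (0%:R - 1) n0.
      congr (_ + _); rewrite -e0 -Wn /w -subn1 natrB//.
      by congr weight; ring.
    apply: (le_trans (lerD e1 e2)); rewrite ncN ncM t1 mul1r !nw Wn.
    by rewrite -mulrDl ler_wpM2r ?mulr_ge0//; rewrite !gtr0_norm// addr_gt0.
  rewrite ?(negbTE i0) /=.
  have [l e] := l2_mul_shift (w i.-1 - w i)%:C%C i.-1%:Z i.-1%:Z (subd_le hP) lx.
  split=> //; apply: (le_trans e); rewrite nc_real distrC.
  have -> : i%:R - 1 = i.-1%:R :> R by rewrite -subn1 natrB// lt0n.
  exact: lexx.
have [lEG nEG] : l2 EG /\ nrm EG <= (G * W) * (g * nrm x).
  apply: (nrm_rows_le (mulr_ge0 G0 (ltW W0)) (mulr_ge0 g0 nx)); last first.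
    by rewrite -GW; exact: weight_sum_next.
  move=> i; rewrite /EG /=; have [i0|i0] := eqVneq (nat_of_ord i) n.-1.
    rewrite ?i0 ?eqxx /=.
    have [l1 e1] := l2_mul_shift (t^* * (w 0%N)%:C%C) 0%:Z 0%:Z (supd_le hP) lx.
    have [l2' e2] := l2_mul_shift (- (w n.-1)%:C%C) n%:Z n%:Z (supd_le hP) lx.
    have [l e] := l2D l1 l2'; split=> //; apply: (le_trans e).
    rewrite (_ : weight n (n.-1%:R + 1) - weight n n.-1%:R = - (w 0%N + w 0%N)); last first.
      rewrite natr1 prednK// -[n%:R in X in X - _]add0r weight_anti//.
      by rewrite -/(w n.-1) Wn /w; ring.
    apply: (le_trans (lerD e1 e2)); rewrite ncN ncM ncJ t1 mul1r !nw Wn normrN.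
    by rewrite -mulrDl ler_wpM2r ?mulr_ge0//; rewrite !gtr0_norm// addr_gt0.
  rewrite ?(negbTE i0) /=.
  have [l e] := l2_mul_shift (w i.+1 - w i)%:C%C i.+1%:Z i.+1%:Z (supd_le hP) lx.
  by split=> //; apply: (le_trans e); rewrite nc_real natr1.
have lV i : l2 (fun k => V (k, i)).
  have row (u : int * 'I_n -> R[i]) : l2 u -> l2 (fun k => u (k, i)).
    move=> lu; split=> [k|]; first exact: sqr_ge0.
    have [_ h] := lu; apply: le_lt_trans h.
    apply: ge_ereal_sup => _ /= [X [finX _] <-].
    apply: esum_ge; exists ((fun k => (k, i)) @` X).
      by split=> //; exact: finite_image.
    by rewrite fsbig_image//= => k k' _ _ [].
  rewrite (_ : (fun k => V (k, i)) = (fun k => ED (k, i) + (EA (k, i) + EG (k, i)))).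
    exact: (l2D (row _ lED) (l2D (row _ lEA) (row _ lEG)).1).1.
  by apply/funext => k; rewrite decomp.
have main : c * nrm Y <= nrm V.
  apply: nrm_slices_le => // [i|k].
    rewrite (_ : (fun k => Y (k, i)) = (fun k => (w i)%:C%C * x (k + i%:Z)))//.
    exact: (l2Z _ (l2_addr _ lx)).1.
  have := hC (CS k) (y k).
  rewrite -(@ler_pXn2r _ 2) ?nnegrE ?l2norm_ge0 ?mulr_ge0 ?l2norm_ge0//.
  rewrite exprMn !l2norm_sqr => h; apply: le_trans h.
  by rewrite ler_wpM2l ?sqr_ge0//; apply: ler_sum => i _; rewrite mxE.
have nV : nrm V <= W * nrm D + (G * W * (a * nrm x) + G * W * (g * nrm x)).
  rewrite (_ : V = (fun p => ED p + (EA p + EG p))); last by apply/funext.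
  have [l e] := l2D lEA lEG; have [_ e'] := l2D lED l.
  by apply: (le_trans e'); rewrite nED lerD2l (le_trans e)// lerD.
rewrite nY in main.
have h1 : c * nrm x <= nrm D + G * ((a + g) * nrm x).
  rewrite -(ler_pM2l W0) [leLHS]mulrCA; apply: (le_trans (le_trans main nV)).
  by rewrite le_eqVlt; apply/orP; left; apply/eqP; ring.
have h2 : G * ((a + g) * nrm x) <= 22 / (7 * n%:R) * ((a + g) * nrm x).
  by rewrite ler_wpM2r ?mulr_ge0 ?addr_ge0//; exact: sqrt_wgap_le.
rewrite mulrBl lerBlDr (le_trans h1)// lerD2l (le_trans h2)//.
by rewrite le_eqVlt; apply/orP; left; apply/eqP; ring.
Qed.

End PeriodisedLowerBound.

(** * Limit operators and Floquet vectors *)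

Section FinitelySupported.
Variable R : realType.
Local Notation nc := (@Normc.normc R).

Lemma fsum_single (c : int) (v : R) : 0 <= v ->
  nnsummable (fun i => if i == c then v else 0) /\
  fsum (fun i => if i == c then v else 0) = v.
Proof.
move=> v0; suff h : rsum (fun i => if i == c then v else 0) = v%:E.
  split; last by rewrite /fsum h.
  by split=> [i|]; [case: ifP|rewrite h ltry].
transitivity (\esum_(i in [set c]) (v%:E : \bar R)); last by rewrite esum_set1.
rewrite [RHS]esum_mkcond; apply: eq_esum => i _.
by case: eqP => [->|ne]; [rewrite mem_set|rewrite memNset].
Qed.

Lemma fsum_window (f : int -> R) (p : int) (m : nat) : (forall i, 0 <= f i) ->
  (forall i, ~~ (p <= i < p + m%:Z) -> f i = 0) ->
  nnsummable f /\ fsum f = \sum_(j < m) f (p + j%:Z).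
Proof.
move=> f0 fs.
have E : f = (fun i => \sum_(j < m) (if i == p + j%:Z then f (p + j%:Z) else 0)).
  apply/funext => i; have [/andP[h1 h2]|h] := boolP (p <= i < p + m%:Z).
    have [k km ->] : exists2 k : nat, (k < m)%N & i = p + k%:Z.
      by exists `|i - p|%N; lia.
    rewrite (bigD1 (Ordinal km))//=.
    rewrite eqxx big1 ?addr0// => j /negP jn.
    case: ifPn => // /eqP e; case: jn; apply/eqP/val_inj => /=; lia.
  rewrite fs// big1// => j _; case: ifPn => // /eqP e.
  by move: (ltn_ord j) => ?; lia.
have [s e] := @nnsummable_sum _ _ _ (index_enum 'I_m)
  (fun j i => if i == p + (nat_of_ord j)%:Z then f (p + (nat_of_ord j)%:Z) else 0)
  (fun j => (fsum_single _ (f0 _)).1).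
rewrite -E in s e; split=> //; rewrite {1}e.
by apply: eq_bigr => j _; rewrite (fsum_single _ (f0 _)).2.
Qed.

Lemma l2_window (x : int -> R[i]) (p : int) (m : nat) :
  (forall i, ~~ (p <= i < p + m%:Z) -> x i = 0) ->
  l2 x /\ nrm x ^+ 2 = \sum_(j < m) nc (x (p + j%:Z)) ^+ 2.
Proof.
move=> xs; rewrite nrm_sqr; apply: fsum_window => [i|i /xs ->].
  exact: sqr_ge0.
by rewrite nc0 expr0n.
Qed.

Lemma l2_delta (p : int) (v : R[i]) :
  l2 (fun i => (i == p)%:R * v) /\ nrm (fun i => (i == p)%:R * v) = nc v.
Proof.
have [|l e] := @l2_window (fun i => (i == p)%:R * v) p 1.
  move=> i h; have [e|_] := eqVneq i p; last by rewrite mul0r.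
  by exfalso; move: h; rewrite e lexx ltrDl.
split=> //; apply/eqP; rewrite -(@eqrXn2 _ 2) ?nrm_ge0 ?nc_ge0// e.
by rewrite big_ord1 addr0 eqxx mul1r.
Qed.

Lemma sum_modn (n N : nat) (h : nat -> R) :
  \sum_(j < (N * n)%N) h (j %% n)%N = N%:R * \sum_(r < n) h r.
Proof.
elim: N => [|N ih]; first by rewrite mul0r big_ord0.
rewrite mulSn -(big_mkord xpredT (fun j => h (j %% n)%N)).
rewrite (@big_cat_nat _ _ _ n)//= ?leq_addr//.
have -> : \sum_(n <= j < n + N * n) h (j %% n)%N = \sum_(0 <= j < N * n) h (j %% n)%N.
  rewrite -{1}(add0n n) big_addn addKn.
  by apply: eq_bigr => j _; rewrite modnDr.
rewrite !big_mkord ih -natr1 mulrDl mul1r addrC; congr (_ + _).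
by apply: eq_bigr => r _; rewrite modn_small.
Qed.

Lemma mx_entry_le_opnorm n (C : 'M[R[i]]_n) (e : R) (i j : 'I_n) :
  (mx_opnorm C < e%:E)%E -> nc (C i j) < e.
Proof.
rewrite -lte_fin; apply: le_lt_trans.
pose x : 'cV[R[i]]_n := delta_mx j ord0.
have x1 : l2norm x = 1.
  rewrite /l2norm (bigD1 j)//= mxE !eqxx nc1 expr1n big1 ?addr0 ?sqrtr1// => k kj.
  by rewrite mxE (negbTE kj) nc0 expr0n.
apply: (@le_trans _ _ (l2norm (C *m x))%:E).
  rewrite lee_fin -(@ler_pXn2r _ 2) ?nnegrE ?nc_ge0 ?l2norm_ge0// l2norm_sqr.
  rewrite -colE (bigD1 i)//= mxE lerDl sumr_ge0// => k _; exact: sqr_ge0.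
by apply: ereal_sup_ubound; exists x => //=; rewrite x1.
Qed.

End FinitelySupported.

(** * Lower bounds pass to limit operators *)

Section LimitOperators.
Variable R : realType.
Local Notation nc := (@Normc.normc R).
Implicit Types (A P : tridiag R) (l : R[i]) (d : R) (x U : int -> R[i]).

Definition op_below A l d : Prop := forall x, l2 x ->
  d * nrm x <= nrm (fun i => tri_op A x i - l * x i).

(** A finitely supported [U] sees finitely many entries of [P], and pseudoergodicity finds these in
    [A] up to [eta]; the bound of [A] at the translate of [U] to that place gives the bound of [P]
    in the limit. *)
Lemma op_below_limit A P Sa Sb Sg a b g l d (m : nat) U :
  pseudoergodic A Sa Sb Sg -> entry_bounds P a b g ->
  (forall j, [/\ Sa (subd P j), Sb (diag P j) & Sg (supd P j)]) ->
  op_below A l d -> (forall i : int, ~~ (0 <= i < m%:Z) -> U i = 0) ->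
  d * nrm U <= nrm (fun i => tri_op P U i - l * U i).
Proof.
move=> [_ hA] hP hS low U0.
have [lU _] : l2 U /\ nrm U ^+ 2 = \sum_(j < m) nc (U (0 + j%:Z)) ^+ 2.
  by apply: l2_window => i; rewrite add0r; exact: U0.
apply/ler_addgt0Pr => e e0.
have nU := nrm_ge0 U.
(* Each of the three diagonals contributes [eta * nrm U]; the summand 1 covers [U = 0]. *)
pose eta := e / (3 * nrm U + 1).
have eta0 : 0 < eta by rewrite divr_gt0// ltr_wpDl// mulr_ge0.
(* The columns [0] to [m - 1] reach the rows [-1] to [m]: hence the size [m.+2], and the offset [-2]
   because sections start at [k + 1]. *)
have [|k hk] := hA eta m.+2 (finite_section P m.+2 (-2)) eta0.
  move=> i j; rewrite mxE /entry; split.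
  - move=> e1; rewrite ifT; last by apply/eqP; lia.
    by have [] := hS (-2 + 1 + j%:Z).
  - move=> e1; rewrite ifF; last by rewrite e1; apply/eqP; lia.
    by rewrite e1 eqxx; have [] := hS (-2 + 1 + j%:Z).
  - move=> e1; rewrite ifF; last by apply/eqP; lia.
    rewrite ifF; last by apply/eqP; lia.
    rewrite ifT; last by apply/eqP; lia.
    by have [] := hS (-2 + 1 + j%:Z).
  - move=> e1 e2 e3.
    have e2' : nat_of_ord i <> j by move=> /val_inj.
    by rewrite !ifF//; apply/eqP; lia.
pose c := k + 2.
have near (i j : nat) : (i < m.+2)%N -> (j < m.+2)%N ->
    nc (entry A (k + 1 + i%:Z) (k + 1 + j%:Z) - entry P (-1 + i%:Z) (-1 + j%:Z)) <= eta.
  move=> im jm; have := mx_entry_le_opnorm (Ordinal im) (Ordinal jm) hk.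
  by rewrite !mxE => /ltW.
pose A' := Tridiag (fun j => subd A (j + c)) (fun j => diag A (j + c))
  (fun j => supd A (j + c)).
have lowU : d * nrm U <= nrm (fun i => tri_op A' U i - l * U i).
  have := low _ (l2_addr (- c) lU); rewrite nrm_addr => h; apply: (le_trans h).
  rewrite -(nrm_addr _ c) le_eqVlt; apply/orP; left; apply/eqP/eq_nrm => i.
  rewrite /tri_op /A' /=.
  have -> : i + c - 1 = i - 1 + c by lia.
  have -> : i + c + 1 = i + 1 + c by lia.
  by rewrite !addrK.
have coef (u : int -> R[i]) : (forall j, 0 <= j < m%:Z -> nc (u j) <= eta) ->
    l2 (fun i => u i * U i) /\ nrm (fun i => u i * U i) <= eta * nrm U.
  move=> h; apply: l2_le => // [|i]; first exact: ltW.
  have [hi|hi] := boolP (0 <= i < m%:Z); last by rewrite U0// mulr0 nc0 mulr0.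
  by rewrite ncM ler_wpM2r ?nc_ge0// h.
have entryS (Q : tridiag R) (j : int) : entry Q (j + 1) j = subd Q j.
  by rewrite /entry eqxx.
have entryD (Q : tridiag R) (j : int) : entry Q j j = diag Q j.
  by rewrite /entry ifF ?eqxx//; apply/eqP; lia.
have entryG (Q : tridiag R) (j : int) : entry Q (j - 1) j = supd Q j.
  have /negbTE h1 : j - 1 != j + 1 by apply/eqP; lia.
  have /negbTE h2 : j - 1 != j by apply/eqP; lia.
  by rewrite /entry h1 h2 eqxx.
have hj (j : int) : 0 <= j < m%:Z -> exists2 j' : nat, (j' < m)%N & j = j'%:Z.
  by move=> ?; exists `|j|%N; lia.
have [|l1 n1] := coef (fun j => subd A' j - subd P j).
  move=> _ /hj[j jm ->]; rewrite -!entryS.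
  have -> : j%:Z + 1 = -1 + j.+2%:Z by lia.
  have -> : entry A' (-1 + j.+2%:Z) j%:Z = entry A (k + 1 + j.+2%:Z) (k + 1 + j.+1%:Z).
    have -> : -1 + j.+2%:Z = j%:Z + 1 by lia.
    have -> : k + 1 + j.+2%:Z = k + 1 + j.+1%:Z + 1 by lia.
    by rewrite !entryS /=; congr subd; rewrite /c; lia.
  have -> : entry P (-1 + j.+2%:Z) j%:Z = entry P (-1 + j.+2%:Z) (-1 + j.+1%:Z).
    by congr entry; lia.
  by apply: near; lia.
have [|l2' n2] := coef (fun j => diag A' j - diag P j).
  move=> _ /hj[j jm ->]; rewrite -!entryD.
  have -> : entry A' j%:Z j%:Z = entry A (k + 1 + j.+1%:Z) (k + 1 + j.+1%:Z).
    by rewrite !entryD /=; congr diag; rewrite /c; lia.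
  have -> : entry P j%:Z j%:Z = entry P (-1 + j.+1%:Z) (-1 + j.+1%:Z) by congr entry; lia.
  by apply: near; lia.
have [|l3 n3] := coef (fun j => supd A' j - supd P j).
  move=> _ /hj[j jm ->]; rewrite -!entryG.
  have -> : entry A' (j%:Z - 1) j%:Z = entry A (k + 1 + j%:Z) (k + 1 + j.+1%:Z).
    have -> : k + 1 + j%:Z = k + 1 + j.+1%:Z - 1 by lia.
    by rewrite !entryG /=; congr supd; rewrite /c; lia.
  have -> : entry P (j%:Z - 1) j%:Z = entry P (-1 + j%:Z) (-1 + j.+1%:Z).
    by congr entry; lia.
  by apply: near; lia.
have lP : l2 (fun i => tri_op P U i - l * U i).
  exact: (l2B (tri_op_l2 hP lU).1 (l2Z l lU).1).1.
have [l4 n4] := l2D (l2_addr (-1) l1) (l2D l2' (l2_addr 1 l3)).1.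
have [_ n5] := l2D l2' (l2_addr 1 l3).
rewrite (nrm_addr (fun i => (subd A' i - subd P i) * U i)) in n4.
rewrite (nrm_addr (fun i => (supd A' i - supd P i) * U i)) in n5.
have [_ n6] := l2D lP l4.
apply: (le_trans lowU); rewrite (_ : (fun i => tri_op A' U i - l * U i) =
    (fun i => tri_op P U i - l * U i + ((subd A' (i + -1) - subd P (i + -1)) * U (i + -1)
      + ((diag A' i - diag P i) * U i + (supd A' (i + 1) - supd P (i + 1)) * U (i + 1))))).
  apply: (le_trans n6); rewrite lerD2l.
  have : 3 * (eta * nrm U) <= e.
    rewrite /eta mulrCA mulrC mulrA ler_pdivrMr ?ltr_wpDl// ?mulr_ge0//.
    by rewrite mulrC ler_wpM2l ?ltW// ltrDl.
  by lra.
by apply/funext => i; rewrite /tri_op; ring.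
Qed.

End LimitOperators.

(** * Floquet vectors of periodic operators *)

Section Floquet.
Variables (R : realType) (n : nat) (t : R[i]) (al be ga : nat -> R[i]).
Variables (a b g : R) (l : R[i]) (d : R).
Local Notation nc := (@Normc.normc R).
Hypothesis n0 : (0 < n)%N.
Hypothesis t1 : nc t = 1.

(** Because of the absolute value this is periodic on each half line only; the truncated Floquet
    vectors below live on positive indices. *)
Definition periodic_tridiag : tridiag R :=
  Tridiag (fun j => al (`|j|%N %% n)) (fun j => be (`|j|%N %% n))
          (fun j => ga (`|j|%N %% n)).

Hypothesis hP : entry_bounds periodic_tridiag a b g.
Hypothesis low : forall (m : nat) (U : int -> R[i]),
  (forall i : int, ~~ (0 <= i < m%:Z) -> U i = 0) ->
  d * nrm U <= nrm (fun i => tri_op periodic_tridiag U i - l * U i).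

Let tJt : t * t^* = 1.
Proof.
apply: complex_ext; have := congr1 (fun x => x ^+ 2) t1;
  rewrite nc_sqr expr1n conj_def; case: t => u v /= h; lra.
Qed.

(* The twisted periodic extension of [f], which satisfies
   [X (j + n) = t^* X j]. *)
Let X (f : nat -> R[i]) (j : int) : R[i] :=
  t^* ^+ (`|j|%N %/ n) * f (`|j|%N %% n)%N.

Lemma nc_floquet f j : nc (X f j) = nc (f (`|j|%N %% n)%N).
Proof. by rewrite ncM ncX ncJ t1 expr1n mul1r. Qed.

(** Passing the end of a period multiplies the extension by [t^*] and passing its start by [t],
    which is what the corner entries do. *)
Lemma floquet_row (f : nat -> R[i]) (y : 'cV[R[i]]_n) (j : nat) : (0 < j)%N ->
  (forall r : 'I_n, y r ord0 = f r) ->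
  tri_op periodic_tridiag (X f) j%:Z
  = t^* ^+ (j %/ n) * (per_mx n t al be ga *m y) (Ordinal (ltn_pmod j n0)) ord0.
Proof.
move=> j0 yf; rewrite (per_mx_mul _ _ _ _ _ yf) /tri_op.
have -> : j%:Z - 1 = j.-1%:Z by lia.
have -> : j%:Z + 1 = j.+1%:Z by lia.
rewrite /X /=.
have [q [r [rn jE]]] : exists q r, (r < n)%N /\ j = (q * n + r)%N.
  by exists (j %/ n)%N, (j %% n)%N; rewrite ltn_pmod// -divn_eq.
subst j; rewrite /=.
have ED k s : (s < n)%N -> ((k * n + s) %/ n)%N = k.
  by move=> sn; rewrite divnMDl// divn_small// addn0.
have EM k s : (s < n)%N -> ((k * n + s) %% n)%N = s.
  by move=> sn; rewrite modnMDl modn_small.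
rewrite ED// EM//.
have prev : al ((q * n + r).-1 %% n) * (t^* ^+ ((q * n + r).-1 %/ n) * f ((q * n + r).-1 %% n)%N)
    = t^* ^+ q * ((0 < r)%:R * (al r.-1 * f r.-1) + (r == 0%N)%:R * (t * al n.-1 * f n.-1)).
  case: r rn j0 => [|r] rn j0.
    rewrite mul0r add0r mul1r addn0; rewrite addn0 in j0.
    case: q j0 => [|q _]; first by rewrite mul0n ltnn.
    have -> : (q.+1 * n).-1 = (q * n + n.-1)%N by lia.
    rewrite ED ?EM ?prednK// exprSr.
    by rewrite -[LHS]mul1r -tJt; ring.
  rewrite addnS /= ED ?EM; try exact: ltnW; by rewrite mul0r mul1r addr0; ring.
have next : ga ((q * n + r).+1 %% n) * (t^* ^+ ((q * n + r).+1 %/ n) * f ((q * n + r).+1 %% n)%N)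
    = t^* ^+ q * ((r.+1 < n)%:R * (ga r.+1 * f r.+1) + (r == n.-1)%:R * (t^* * ga 0%N * f 0%N)).
  have [e|rn'] := eqVneq r n.-1.
    have -> : (q * n + r).+1 = (q.+1 * n + 0)%N by rewrite e; lia.
    by rewrite ED// EM// e prednK// ltnn mul0r add0r mul1r exprS; ring.
  have rn2 : (r.+1 < n)%N by lia.
  by rewrite -addnS ED// EM// rn2 mul0r mul1r addr0; ring.
rewrite prev next; ring.
Qed.

Lemma window_floquet (f : nat -> R[i]) (N : nat) :
  let x (i : int) :=
    (n%:Z <= i < n%:Z + (N * n)%N%:Z)%R%:R * X f i in
  l2 x /\ nrm x ^+ 2 = N%:R * \sum_(r < n) nc (f r) ^+ 2.
Proof.
move=> x; have [|l' e] := @l2_window _ x n%:Z (N * n)%N.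
  by move=> i /negbTE h; rewrite /x h mul0r.
split=> //; rewrite e -(sum_modn _ _ (fun r => nc (f r) ^+ 2)).
apply: eq_bigr => j _; congr (_ ^+ 2).
have jm := ltn_ord j.
rewrite /x; have -> : (n%:Z <= n%:Z + j%:Z < n%:Z + (N * n)%N%:Z) by lia.
rewrite mul1r nc_floquet; congr (nc (f _)).
have -> : `|(n%:Z + j%:Z)%R|%N = (n + j)%N by lia.
by rewrite modnDl.
Qed.

Lemma le0_sqrt_growth (x K : R) :
  (forall N : nat, x * Num.sqrt N.+1%:R <= K) -> x <= 0.
Proof.
move=> h; rewrite leNgt; apply/negP => x0.
pose N := Num.truncn ((`|K| / x) ^+ 2).
have hN : (`|K| / x) ^+ 2 < N.+1%:R.
  by have := @truncnS_gt R ((`|K| / x) ^+ 2).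
have := h N; apply/negP; rewrite -ltNge.
apply: (le_lt_trans (ler_norm K)); rewrite mulrC -ltr_pdivrMr//.
rewrite -(@ltr_pXn2r _ 2) ?nnegrE ?sqrtr_ge0 ?divr_ge0// ?ltW//.
by rewrite sqr_sqrtr.
Qed.

(** The norms of [N] periods grow like [sqrt N], whereas cutting them off costs a constant, so
    [d * l2norm y - l2norm z] cannot be positive. *)
Lemma floquet_lower_bound : bounded_below d (per_mx n t al be ga - l%:M).
Proof.
move=> y; set z := _ *m y.
pose ext (v : 'cV[R[i]]_n) (r : nat) : R[i] :=
  if insub r is Some i then v i ord0 else 0.
have extE v (r : 'I_n) : ext v r = v r ord0 by rewrite /ext valK.
have ext_nrm v : \sum_(r < n) nc (ext v r) ^+ 2 = l2norm v ^+ 2.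
  by rewrite l2norm_sqr; apply: eq_bigr => r _; rewrite extE.
(* [K] bounds the four entries, two at each cut, where truncation fails to commute with the
   operator. *)
have [a0 b0 g0] := entry_bounds_ge0 hP.
pose f := ext y; pose K := (a + a + g + g) * l2norm y.
have zE (r : 'I_n) : z r ord0 = (per_mx n t al be ga *m y) r ord0 - l * f r.
  by rewrite /z mulmxBl mul_scalar_mx [LHS]mxE; congr (_ + _); rewrite !mxE /f extE.
suff : d * l2norm y - l2norm z <= 0 by rewrite subr_le0.
apply: (@le0_sqrt_growth _ K) => N.
(* The periods start at [n] and not at [0], so that left neighbours stay at nonnegative indices. *)
pose m : int := n%:Z + (N.+1 * n)%N%:Z.
pose phi (i : int) := n%:Z <= i < m.
pose U i : R[i] := (phi i)%:R * X f i.
pose Z i : R[i] := (phi i)%:R * X (ext z) i.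
have [lU nU] := window_floquet f N.+1.
have [lZ nZ] := window_floquet (ext z) N.+1.
rewrite -/U -/Z in lU nU lZ nZ; rewrite ext_nrm in nU; rewrite ext_nrm in nZ.
have sq (x : R) (w : R) : 0 <= x -> 0 <= w -> x ^+ 2 = N.+1%:R * w ^+ 2 ->
    x = Num.sqrt N.+1%:R * w.
  move=> x0 w0 e; apply/eqP; rewrite -(@eqrXn2 _ 2)// ?mulr_ge0 ?sqrtr_ge0//.
  by rewrite e exprMn sqr_sqrtr.
have {}nU := sq _ _ (nrm_ge0 _) (l2norm_ge0 _) nU.
have {}nZ := sq _ _ (nrm_ge0 _) (l2norm_ge0 _) nZ.
have lowU := @low (n + N.+1 * n)%N U _.
have {}lowU : d * nrm U <= nrm (fun i => tri_op periodic_tridiag U i - l * U i).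
  apply: lowU => i h; rewrite /U /phi.
  have /negbTE -> : ~~ (n%:Z <= i < m) by rewrite /m; lia.
  by rewrite mul0r.
pose va (j : int) := subd periodic_tridiag j * X f j.
pose vg (j : int) := supd periodic_tridiag j * X f j.
have fy j : nc (X f j) <= l2norm y.
  rewrite nc_floquet; pose r := Ordinal (ltn_pmod `|j|%N n0).
  have -> : f (`|j|%N %% n)%N = y r ord0 by exact: (extE y r).
  rewrite -(@ler_pXn2r _ 2) ?nnegrE ?nc_ge0 ?l2norm_ge0// l2norm_sqr.
  by rewrite (bigD1 r)//= lerDl sumr_ge0// => *; rewrite sqr_ge0.
have vaK j : nc (va j) <= a * l2norm y.
  by rewrite ncM ler_pM ?nc_ge0// (subd_le hP).
have vgK j : nc (vg j) <= g * l2norm y.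
  by rewrite ncM ler_pM ?nc_ge0// (supd_le hP).
have decomp : (fun i => tri_op periodic_tridiag U i - l * U i) =
    (fun i => Z i + (((i == m)%:R * va (m - 1) - (i == n%:Z)%:R * va (n%:Z - 1))
     + ((i == n%:Z - 1)%:R * vg n%:Z - (i == m - 1)%:R * vg m))).
  apply/funext => i.
  have nm : n%:Z < m by rewrite /m; lia.
  have p1 : (phi (i - 1))%:R = (phi i)%:R + (i == m)%:R - (i == n%:Z)%:R :> R[i].
    have [im|im] := eqVneq i m.
      have -> : phi (i - 1) by rewrite /phi; lia.
      have /negbTE -> : ~~ phi i by rewrite /phi; lia.
      have /negbTE -> : i != n%:Z by apply/eqP; lia.
      by rewrite add0r subr0.
    have [il|il] := eqVneq i n%:Z.
      have /negbTE -> : ~~ phi (i - 1) by rewrite /phi; lia.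
      have -> : phi i by rewrite /phi; lia.
      by rewrite addr0 subrr.
    have -> : phi (i - 1) = phi i by move/eqP: im; move/eqP: il; rewrite /phi; lia.
    by rewrite addr0 subr0.
  have p2 : (phi (i + 1))%:R = (phi i)%:R + (i == n%:Z - 1)%:R - (i == m - 1)%:R :> R[i].
    have [im|im] := eqVneq i (m - 1).
      have /negbTE -> : ~~ phi (i + 1) by rewrite /phi; lia.
      have -> : phi i by rewrite /phi; lia.
      have /negbTE -> : i != n%:Z - 1 by apply/eqP; lia.
      by rewrite addr0 subrr.
    have [il|il] := eqVneq i (n%:Z - 1).
      have -> : phi (i + 1) by rewrite /phi; lia.
      have /negbTE -> : ~~ phi i by rewrite /phi; lia.
      by rewrite add0r subr0.
    have -> : phi (i + 1) = phi i by move/eqP: im; move/eqP: il; rewrite /phi; lia.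
    by rewrite addr0 subr0.
  have dl (p : int) (v : int -> R[i]) : (i == p)%:R * v p = (i == p)%:R * v i.
    by have [->|] := eqVneq i p => //; rewrite !mul0r.
  rewrite (dl m (fun j => va (j - 1))) (dl n%:Z (fun j => va (j - 1))).
  have -> : vg n%:Z = vg (n%:Z - 1 + 1) by rewrite subrK.
  have -> : vg m = vg (m - 1 + 1) by rewrite subrK.
  rewrite (dl (n%:Z - 1) (fun j => vg (j + 1))) (dl (m - 1) (fun j => vg (j + 1))).
  have -> : Z i = (phi i)%:R * (tri_op periodic_tridiag (X f) i - l * X f i).
    rewrite /Z; case hphi : (phi i); rewrite ?mul0r// !mul1r.
    have [j j0 ->] : exists2 j : nat, (0 < j)%N & i = j%:Z.
      by exists `|i|%N; move: hphi; rewrite /phi; lia.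
    rewrite (@floquet_row f y) => [|//|r]; last by rewrite /f extE.
    rewrite /X /= (extE z (Ordinal (ltn_pmod j n0))) zE.
    rewrite /=; ring.
  rewrite {1}/tri_op /U p1 p2 /va /vg /tri_op; ring.
have [l1 e1] := l2_delta m (va (m - 1)).
have [l2' e2] := l2_delta n%:Z (va (n%:Z - 1)).
have [l3 e3] := l2_delta (n%:Z - 1) (vg n%:Z).
have [l4 e4] := l2_delta (m - 1) (vg m).
have [l5 e5] := l2B l1 l2'; have [l6 e6] := l2B l3 l4.
have [l7 e7] := l2D l5 l6; have [_ e8] := l2D lZ l7.
rewrite decomp nU in lowU.
have := vaK (m - 1); have := vaK (n%:Z - 1); have := vgK n%:Z; have := vgK m.
rewrite -e1 -e2 -e3 -e4 => k4 k3 k2 k1.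
have := le_trans lowU e8; rewrite nZ => h.
have : nrm (fun i => (i == m)%:R * va (m - 1) - (i == n%:Z)%:R * va (n%:Z - 1) +
   ((i == n%:Z - 1)%:R * vg n%:Z - (i == m - 1)%:R * vg m)) <= K.
  apply: (le_trans e7); apply: (le_trans (lerD e5 e6)); rewrite /K !mulrDl.
  by rewrite -(addrA (_ + _)); exact: lerD (lerD k1 k2) (lerD k3 k4).
move=> k; rewrite mulrBl lerBlDr -[leLHS]mulrA.
have := le_trans h (lerD (lexx _) k).
by rewrite [_ * l2norm z]mulrC [leRHS]addrC [_ * l2norm y]mulrC.
Qed.

End Floquet.

(** * The spectrum and its approximations *)

Section ComplexTopology.
Variable R : realType.
Local Notation nc := (@Normc.normc R).
Implicit Types (S T : set R[i]).

Lemma closure_nc S z : closure (S : set (R[i] : numFieldType)) z ->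
  forall e : R, 0 < e -> exists2 s, S s & nc (z - s) < e.
Proof.
move=> h e e0.
have [|s [Ss zs]] := h (ball (z : (R[i] : numFieldType)) e%:C%C).
  by apply: nbhsx_ballx; rewrite ltcR.
exists s => //; move: zs; rewrite -ball_normE /= /ball_ /= => zs.
by rewrite -ltcR -nc_norm.
Qed.

Lemma closure_nc_le S z (c : R) : (forall s, S s -> nc s <= c) ->
  closure (S : set (R[i] : numFieldType)) z -> nc z <= c.
Proof.
move=> h /closure_nc hz; apply/ler_addgt0Pr => e e0.
have [s Ss zs] := hz e e0.
have -> : z = s + (z - s) by rewrite addrC subrK.
by apply: (le_trans (ncD _ _)); rewrite lerD ?h// ltW.
Qed.

Lemma closure_sub_compact S T : compact (T : set (R[i] : numFieldType)) ->
  S `<=` T -> closure (S : set (R[i] : numFieldType)) `<=` T.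
Proof.
move=> cT ST; have clT : closed (T : set (R[i] : numFieldType)).
  by apply: compact_closed => //; exact: norm_hausdorff.
move=> z zS; apply: clT.
exact: (@closure_subset (R[i] : numFieldType) S T ST z zS).
Qed.

Lemma subset_closure_C S : S `<=` closure (S : set (R[i] : numFieldType)).
Proof. exact: (@subset_closure (R[i] : numFieldType) S). Qed.

Lemma hausdorff_near S T (r e : R) s : 0 < e -> (hausdorff S T <= r%:E)%E -> S s ->
  exists2 t, T t & nc (s - t) < r + e.
Proof.
move=> e0 h Ss.
have : (dist_to s T < (r + e)%:E)%E.
  apply: (@le_lt_trans _ _ r%:E); last by rewrite lte_fin ltrDl.
  apply: le_trans h; rewrite le_max; apply/orP; left.
  by apply: ereal_sup_ubound; exists s.
move=> /ereal_inf_lt [_ [t Tt <-]]; rewrite lte_fin => ?; by exists t.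
Qed.

Lemma dist_to_le s T t (r : R) : T t -> nc (s - t) <= r -> (dist_to s T <= r%:E)%E.
Proof.
move=> Tt h; apply: (@le_trans _ _ (nc (s - t))%:E); last by rewrite lee_fin.
by apply: ereal_inf_lbound; exists t.
Qed.

Lemma hausdorff_le S T (r : R) : (forall s, S s -> (dist_to s T <= r%:E)%E) ->
  (forall t, T t -> (dist_to t S <= r%:E)%E) -> (hausdorff S T <= r%:E)%E.
Proof.
move=> h1 h2; rewrite ge_max; apply/andP; split;
  by apply: ge_ereal_sup => _ [s Ss <-]; auto.
Qed.

Lemma hausdorff_ge0 S T s : S s -> (0%E <= hausdorff S T)%E.
Proof.
move=> Ss; rewrite le_max; apply/orP; left.
apply: (@le_trans _ _ (dist_to s T)).
  by apply: le_ereal_inf_tmp => _ [t _ <-]; rewrite lee_fin nc_ge0.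
by apply: ereal_sup_ubound; exists s.
Qed.

Lemma cvg_ereal0 (f : nat -> \bar R) :
  (forall e : R, 0 < e -> \forall n \near \oo, (0%E <= f n)%E /\ (f n <= e%:E)%E) ->
  f n @[n --> \oo] --> (0 : \bar R)%E.
Proof.
move=> h; apply/fine_cvgP; split.
  near=> n; have [h1 h2] : (0%E <= f n)%E /\ (f n <= 1%:E)%E by near: n; exact: h.
  by rewrite fin_numElt (lt_le_trans (ltNyr 0))//= (le_lt_trans h2)// ltry.
apply/cvgrPdist_le => e e0; near=> n.
have [h1 h2] : (0%E <= f n)%E /\ (f n <= e%:E)%E by near: n; exact: h.
rewrite sub0r normrN /=; move: h1 h2; case: (f n) => [r| |]//=.
by rewrite !lee_fin => r0; rewrite ger0_norm.
Unshelve. all: by end_near. Qed.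

Lemma closed_discP (r : R) z : 0 <= r -> nc z <= r -> closed_disc r z.
Proof.
rewrite le_eqVlt => /predU1P[<-|r0] h.
  exists 0; first by rewrite /mkset nc0 ler01.
  by rewrite mulr0; apply/esym/nc0_eq0/eqP; rewrite eq_le h nc_ge0.
exists (r^-1%:C%C * z).
  by rewrite /mkset ncM nc_real ger0_norm ?invr_ge0 ?(ltW r0)// mulrC ler_pdivrMr// mul1r.
by rewrite mulrA -rmorphM mulfV ?gt_eqF// rmorph1 mul1r.
Qed.

Lemma closed_disc_le (r : R) z : 0 <= r -> closed_disc r z -> nc z <= r.
Proof.
move=> r0 [w /= w1 <-]; rewrite ncM nc_real ger0_norm//.
by rewrite -[leRHS]mulr1 ler_wpM2l.
Qed.

Lemma open_disc_le (r : R) z : 0 <= r -> open_disc r z -> nc z <= r.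
Proof.
move=> r0 [w /= w1 <-]; rewrite ncM nc_real ger0_norm//.
by rewrite -[leRHS]mulr1 ler_wpM2l// ltW.
Qed.

(** A positive [x] is rounded to [ceil - 1] and not to the floor: the strict decrease brings points
    of the circle of radius [r] into the open disc. *)
Lemma truncate_toward0 (n : nat) (x : R) : (0 < n)%N -> exists p : int,
  [/\ `|p%:~R / n%:R| <= `|x|, x != 0 -> `|p%:~R / n%:R| < `|x|
    & `|x - p%:~R / n%:R| <= n%:R^-1].
Proof.
move=> n0; have np : 0 < n%:R :> R by rewrite ltr0n.
wlog x0 : x / 0 <= x.
  move=> h; have [x0|x0] := leP 0 x; first exact: h.
  have [|p [h1 h2 h3]] := h (- x); first by rewrite oppr_ge0 ltW.
  exists (- p); rewrite intrN mulNr normrN opprK.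
  split; first by rewrite -(normrN x).
    by rewrite -(normrN x) -oppr_eq0.
  by rewrite -normrN opprD.
move: x0; rewrite le_eqVlt => /predU1P[<-|x0].
  by exists 0; rewrite mul0r subrr normr0 eqxx invr_ge0 ler0n.
pose p := Num.ceil (x * n%:R) - 1.
have /andP[p1 p2] : (p%:~R < x * n%:R <= (p + 1)%:~R).
  by have := ceil_itv (x * n%:R); rewrite subrK.
have p0 : 0 <= p.
  have : 0 < (p + 1)%:~R :> R by apply: lt_le_trans p2; rewrite mulr_gt0.
  by rewrite (ltr_int R 0 _); lia.
have p0' : 0 <= p%:~R / n%:R :> R by rewrite divr_ge0 ?ler0n ?ler0z.
have lt : p%:~R / n%:R < x by rewrite ltr_pdivrMr.
exists p; split.
- by rewrite !ger0_norm// ltW.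
- by rewrite !ger0_norm// ltW.
- rewrite ger0_norm; last by rewrite subr_ge0 ltW.
  rewrite lerBlDr (_ : n%:R^-1 + _ = (1 + p%:~R) / n%:R); last by rewrite mulrDl mul1r.
  rewrite ler_pdivlMr//.
  by move: p2; rewrite intrD addrC.
Qed.

(** Each coordinate moves by at most [1 / n], and [2 <= (3 / 2) ^+ 2]. The origin is a grid point
    even when [r = 0]. *)
Lemma grid_near (n : nat) (r : R) z : (0 < n)%N -> nc z <= r ->
  exists2 m, grid n r m & nc (z - m) <= 3 / 2 / n%:R.
Proof.
move=> n0 zr; have np : 0 < n%:R :> R by rewrite ltr0n.
have [p [p1 p2 p3]] := truncate_toward0 (complex.Re z) n0.
have [q [q1 q2 q3]] := truncate_toward0 (complex.Im z) n0.
pose m : R[i] := Complex (p%:~R / n%:R) (q%:~R / n%:R).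
have mz : nc m <= nc z /\ (z != 0 -> nc m < nc z).
  rewrite -(@ler_pXn2r _ 2) ?nnegrE ?nc_ge0// -(@ltr_pXn2r _ 2) ?nnegrE ?nc_ge0//.
  rewrite !nc_sqr [complex.Re m]/= [complex.Im m]/=.
  have sqE (u : R) : u ^+ 2 = `|u| ^+ 2 by rewrite real_normK ?num_real.
  rewrite (sqE (_ / _)) (sqE (q%:~R / _)) (sqE (complex.Re z)) (sqE (complex.Im z)).
  have P1 : `|p%:~R / n%:R| ^+ 2 <= `|complex.Re z| ^+ 2 by rewrite ler_pXn2r ?nnegrE.
  have Q1 : `|q%:~R / n%:R| ^+ 2 <= `|complex.Im z| ^+ 2 by rewrite ler_pXn2r ?nnegrE.
  split; first exact: lerD.
  have [Re0|Re0] := eqVneq (complex.Re z) 0; last first.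
    by move=> _; apply: ltr_leD => //; rewrite ltr_pXn2r ?nnegrE// p2.
  have [Im0|Im0] := eqVneq (complex.Im z) 0; last first.
    by move=> _; apply: ler_ltD => //; rewrite ltr_pXn2r ?nnegrE// q2.
  by move=> /eqP; case; apply: complex_ext.
exists m; last first.
  rewrite -(@ler_pXn2r _ 2) ?nnegrE ?nc_ge0 ?divr_ge0// nc_sqr !ReD !ImD !ReN !ImN /=.
  rewrite -[(_ - p%:~R / _) ^+ 2]real_normK ?num_real//.
  rewrite -[(_ - q%:~R / _) ^+ 2]real_normK ?num_real//.
  have P3 : `|complex.Re z - p%:~R / n%:R| ^+ 2 <= n%:R^-1 ^+ 2.
    by rewrite ler_pXn2r ?nnegrE ?invr_ge0.
  have Q3 : `|complex.Im z - q%:~R / n%:R| ^+ 2 <= n%:R^-1 ^+ 2.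
    by rewrite ler_pXn2r ?nnegrE ?invr_ge0.
  apply: (le_trans (lerD P3 Q3)); rewrite exprMn.
  have : 0 <= n%:R^-1 ^+ 2 :> R by rewrite sqr_ge0.
  by move: (n%:R^-1 ^+ 2) => u u0; lra.
split.
  exists p, q; rewrite -(rmorph_nat (real_complex R)) -fmorphV.
  by apply: complex_ext; rewrite ?Re_mul ?Im_mul /=; ring.
have [z0|z0] := eqVneq z 0.
  have m0 : m = 0.
    by apply: nc0_eq0; apply/eqP; rewrite eq_le nc_ge0 andbT -(nc0 R) -z0 mz.1.
  by exists 0; [rewrite /mkset nc0 ltr01|rewrite mulr0 m0].
have r0 : 0 < r by apply: lt_le_trans zr; apply: le_lt_trans (mz.2 z0); exact: nc_ge0.
exists (r^-1%:C%C * m).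
  rewrite /mkset ncM nc_real gtr0_norm ?invr_gt0// mulrC ltr_pdivrMr// mul1r.
  exact: lt_le_trans (mz.2 z0) zr.
by rewrite mulrA -rmorphM mulfV ?gt_eqF// rmorph1 mul1r.
Qed.

End ComplexTopology.

(** * Spectrum, pseudospectrum and lower bounds *)

Section SpectralApproximation.
Variable R : realType.
Local Notation nc := (@Normc.normc R).
Implicit Types (A P : tridiag R) (l mu t : R[i]) (S : set R[i]).

Definition shift_diag A l : tridiag R :=
  Tridiag (subd A) (fun j => diag A j - l) (supd A).

Lemma shift_diagE A l : tri_op (shift_diag A l) = shift_op (tri_op A) l.
Proof.
by apply/funext => x; apply/funext => i; rewrite /shift_op /tri_op /=; ring.
Qed.

Lemma adj_shift_diag A l : adj (shift_diag A l) = shift_diag (adj A) l^*.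
Proof.
rewrite /adj /shift_diag /=; congr Tridiag; apply/funext => j.
by rewrite rmorphB.
Qed.

Lemma shift_diag_bounds A a b g l : entry_bounds A a b g ->
  entry_bounds (shift_diag A l) a (b + nc l) g.
Proof.
move=> hA j; have [h1 h2 h3] := hA j; split=> //=.
by apply: (le_trans (ncD _ _)); rewrite ncN lerD2r.
Qed.

Lemma notin_Spec A a b g l d : entry_bounds A a b g -> 0 < d ->
  op_below A l d -> op_below (adj A) l^* d -> ~ Spec (tri_op A) l.
Proof.
move=> hA d0 h1 h2; apply; rewrite -shift_diagE.
apply: (invertible_of_bounded_below (shift_diag_bounds l hA) d0) => x lx.
  by rewrite shift_diagE; exact: h1.
by rewrite adj_shift_diag shift_diagE; exact: h2.
Qed.

Lemma op_below_le A l d d' : d' <= d -> op_below A l d -> op_below A l d'.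
Proof. by move=> dd h x lx; apply: le_trans (h x lx); rewrite ler_wpM2r ?nrm_ge0. Qed.

Lemma op_below_perturb A P a b g (eta : R) l mu d : entry_bounds P a b g ->
  (forall j, [/\ nc (subd A j - subd P j) <= eta, nc (diag A j - diag P j) <= eta
             & nc (supd A j - supd P j) <= eta]) ->
  op_below P mu d -> op_below A l (d - 3 * eta - nc (l - mu)).
Proof.
move=> hP hAP h x lx.
pose D := Tridiag (fun j => subd A j - subd P j) (fun j => diag A j - diag P j)
  (fun j => supd A j - supd P j).
have [lD nD] := @tri_op_l2 _ D eta eta eta x hAP lx.
have [ll nl] := l2Z (l - mu) lx.
have [le ne] := l2B ll lD.
have lP : l2 (fun i => tri_op P x i - mu * x i).
  exact: (l2B (tri_op_l2 hP lx).1 (l2Z mu lx).1).1.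
have := nrmB_ge lP le.
rewrite (_ : (fun i => tri_op P x i - mu * x i - _)
  = (fun i => tri_op A x i - l * x i)); last first.
  by apply/funext => i; rewrite /tri_op /=; ring.
apply: le_trans; have := h x lx.
move: ne nD; rewrite nl; lra.
Qed.

(** Outside the disc the reverse triangle inequality bounds both [A - l] and its adjoint from
    below. *)
Lemma Spec_le A a b g l : entry_bounds A a b g -> Spec (tri_op A) l ->
  nc l <= a + b + g.
Proof.
move=> hA sl; rewrite leNgt; apply/negP => h.
have lowgen P a' b' g' k : entry_bounds P a' b' g' ->
    op_below P k (nc k - (a' + b' + g')).
  move=> hP x lx; have [l1 n1] := tri_op_l2 hP lx; have [l2' n2] := l2Z k lx.
  have := nrmB_ge l2' l1.
  rewrite (_ : (fun i => k * x i - tri_op P x i)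
    = (fun i => - (tri_op P x i - k * x i))); last first.
    by apply/funext => i; rewrite opprB.
  by rewrite (l2N (l2B l1 l2').1).2 n2; apply: le_trans; lra.
have d0 : 0 < nc l - (a + b + g) by rewrite subr_gt0.
apply: (notin_Spec hA d0 _ _ sl); first exact: lowgen.
have := lowgen _ _ _ _ l^* (adj_bounds hA); rewrite ncJ.
by rewrite (_ : g + b + a = a + b + g)//; ring.
Qed.

(** The norm of the inverse is a positive real, since [T] has to recover a unit vector. *)
Lemma inverse_op_below A a b g l T : entry_bounds A a b g ->
  is_inverse (shift_op (tri_op A) l) T ->
  exists2 s : R, 0 < s & op_norm T = s%:E /\ op_below A l s^-1.
Proof.
move=> hA [[Tl2 Tlin Tb] Tinv].
have lshift x : l2 x -> l2 (shift_op (tri_op A) l x).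
  by move=> lx; exact: (l2B (tri_op_l2 hA lx).1 (l2Z l lx).1).1.
have [l00 n00] := l2_0 R int.
have T0 : T (fun=> 0) = (fun=> 0).
  have e00 := (ell2E _).2 l00; have := Tlin 1 _ _ e00 e00.
  rewrite (_ : (fun _ : int => 1 * 0 + 0 : R[i]) = (fun=> 0)); last first.
    by apply/funext => i; rewrite mulr0 addr0.
  move=> e; apply/funext => i; have := congr1 (fun u => u i) e; rewrite /= mul1r => e'.
  by apply: (addrI (T (fun=> 0) i)); rewrite addr0 -e'.
have TZ (c : R[i]) x : l2 x -> T (fun i => c * x i) = (fun i => c * T x i).
  move=> lx; have := Tlin c x (fun=> 0) ((ell2E _).2 lx) ((ell2E _).2 l00).
  rewrite T0 (_ : (fun i => c * x i + 0) = (fun i => c * x i)); last first.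
    by apply/funext => i; rewrite addr0.
  by move=> ->; apply/funext => i; rewrite addr0.
have lT x : l2 x -> l2 (T x) by move=> /ell2E/Tl2/ell2E.
have T_le x : l2 x -> nrm x <= 1 -> ((nrm (T x))%:E <= op_norm T)%E.
  move=> lx x1; apply: ereal_sup_ubound; exists x; last by rewrite ell2_normE//; exact: lT.
  by rewrite /= ell2_normE// lee_fin.
have [s sE] : exists s, op_norm T = s%:E.
  have := T_le _ l00; rewrite n00 => /(_ ler01); rewrite T0 n00 => h.
  by move: Tb h; case: (op_norm T) => [s _ _||]//; exists s.
have Tnorm x : l2 x -> nrm (T x) <= s * nrm x.
  move=> lx; have [x0|x0] := eqVneq (nrm x) 0.
    have -> : x = (fun=> 0) by apply/funext => i; exact: nrm0_eq0.
    by rewrite T0 n00 mulr0.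
  have xp : 0 < nrm x by rewrite lt_neqAle eq_sym x0 nrm_ge0.
  have ek : nc (nrm x)^-1%:C%C = (nrm x)^-1 by rewrite nc_real ger0_norm// invr_ge0 ltW.
  have [l1 n1] := l2Z (nrm x)^-1%:C%C lx.
  have := T_le _ l1; rewrite n1 ek mulVf// => /(_ (lexx _)).
  rewrite TZ// (l2Z _ (lT x lx)).2 ek sE lee_fin.
  by rewrite mulrC ler_pdivrMr.
have low x : l2 x -> nrm x <= s * nrm (shift_op (tri_op A) l x).
  move=> lx; have [e _] := Tinv x ((ell2E _).2 lx).
  by rewrite -{1}e; apply: Tnorm; exact: lshift.
have s0 : 0 < s.
  have [ld nd] := l2_delta 0 (1 : R[i]); have := low _ ld; rewrite nd nc1.
  move=> h; have := nrm_ge0 (shift_op (tri_op A) l (fun i => (i == 0)%:R * 1)).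
  move: h; move: (nrm _) => u h u0; rewrite ltNge; apply/negP => s0.
  by have : s * u <= 0 by [rewrite mulr_le0_ge0]; lra.
exists s => //; split=> // x lx.
by rewrite mulrC ler_pdivrMr// mulrC; exact: low.
Qed.

Lemma Spec_of_no_lower_bound A a b g l : entry_bounds A a b g ->
  (forall d, 0 < d -> ~ op_below A l d) -> Spec (tri_op A) l.
Proof.
move=> hA h [T hT]; have [s s0 [_ low]] := inverse_op_below hA hT.
by apply: (h s^-1) => //; rewrite invr_gt0.
Qed.

(** Every inverse has norm at least [eps^-1]; when there is none the infimum is [+oo], so the two
    cases need no separation. *)
Lemma Spec_eps_of_lower_bounds A a b g l (eps : R) : entry_bounds A a b g ->
  0 < eps -> (forall d, op_below A l d -> d <= eps) ->
  Spec_eps eps (tri_op A) l.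
Proof.
move=> hA e0 h; rewrite /Spec_eps /=.
have le : (eps^-1%:E <= inv_norm (shift_op (tri_op A) l))%E.
  apply: le_ereal_inf_tmp => _ [T hT <-].
  have [s s0 [-> low]] := inverse_op_below hA hT.
  by rewrite lee_fin -[leRHS]invrK lef_pV2 ?posrE ?invr_gt0//; exact: h.
have i0 : (0 <= inv_norm (shift_op (tri_op A) l))%E.
  by apply: le_trans le; rewrite lee_fin invr_ge0 ltW.
rewrite inve_ple ?inE// ?lee_fin ?(ltW e0)//.
by rewrite inver gt_eqF.
Qed.

Definition conj_set S : set R[i] := [set z | S z^*].

Lemma periodised_conj n t Sa Sb Sg (C : 'M[R[i]]_n) : (0 < n)%N ->
  periodised_mxs t (conj_set Sg) (conj_set Sb) (conj_set Sa) C ->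
  periodised_mxs t Sa Sb Sg (map_mx Num.conj C^T).
Proof.
move=> n0 /per_mxP-/(_ n0)[al [be [ga [h ->]]]]; rewrite per_mx_ctr//.
apply/per_mxP => //; do 3 eexists; split; last reflexivity.
move=> j jn; split.
- case: ifPn => jl; first by have [_ _] := h 0%N n0.
  by have [|_ _] := h j.+1; [lia|].
- by have [_] := h j jn.
- case: ifPn => jl; first by have [|] := h n.-1; [lia|].
  by have [|] := h j.-1; [lia|].
Qed.

Lemma ctrmx_sub_scalar n (C : 'M[R[i]]_n) l :
  map_mx Num.conj (C - l%:M)^T = map_mx Num.conj C^T - (l^*)%:M.
Proof.
apply/matrixP => i j; rewrite !mxE rmorphB rmorphMn/=.
by rewrite eq_sym.
Qed.

(* If [l] is in the spectrum then [A - l] or its adjoint is not bounded below,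
   so that, by windowing with sine weights, neither is a periodised section. *)
Lemma Spec_sub_Delta A a b g t n Sa Sb Sg l mu : entry_bounds A a b g ->
  nc t = 1 -> (0 < n)%N ->
  approximates n Sa (entry_closure (subd A)) ->
  approximates n Sb (entry_closure (diag A)) ->
  approximates n Sg (entry_closure (supd A)) ->
  nc (l - mu) <= 3 / 2 / n%:R -> Spec (tri_op A) l ->
  @Delta_fin_per R n t Sa Sb Sg (eps_dagger n (a, b, g) + 3 / n%:R) mu.
Proof.
move=> hA t1 n0 [_ subSa hSa] [_ subSb hSb] [_ subSg hSg] lmu sl.
have np : 0 < n%:R :> R by rewrite ltr0n.
have [a0 b0 g0] := entry_bounds_ge0 hA.
rewrite /Delta_fin_per /= leNgt; apply/negP => hinf.
set eps := eps_dagger n (a, b, g) + 3 / n%:R in hinf.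
have eps0 : 0 < eps.
  by rewrite /eps ltr_wpDl ?divr_gt0// /eps_dagger mulr_ge0 ?addr_ge0 ?divr_ge0 ?mulr_ge0.
have low (C : 'M[R[i]]_n) : periodised_mxs t Sa Sb Sg C -> bounded_below eps (C - mu%:M).
  move=> hC; apply/bounded_belowP; apply: (le_trans (ltW hinf)).
  by apply: ereal_inf_lbound; exists C.
(* [11 / 30 = 1 / 3 + 1 / 30], where [1 / 30] pays for a distance that is an infimum. *)
pose eta := 11 / 30 / n%:R : R.
have eta0 : 0 < (1 / 30) / n%:R :> R by rewrite divr_gt0.
have etaE : 1 / (3 * n%:R) + 1 / 30 / n%:R = eta.
  by rewrite /eta; field; rewrite gt_eqF.
have near (x : int -> R[i]) Sn : (hausdorff (entry_closure x) Sn <= (1 / (3 * n%:R))%:E)%E ->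
    exists y : int -> R[i], forall j, Sn (y j) /\ nc (x j - y j) <= eta.
  move=> h; suff /choice[y hy] : forall j, exists z, Sn z /\ nc (x j - z) <= eta.
    by exists y.
  move=> j.
  have [|z Sz hz] := hausdorff_near eta0 h (s := x j).
    by apply: subset_closure_C; exists j.
  by exists z; split=> //; rewrite -etaE ltW.
have [ya hya] := near _ _ hSa; have [yb hyb] := near _ _ hSb.
have [yg hyg] := near _ _ hSg.
pose P := Tridiag ya yb yg.
have clo (x : int -> R[i]) (c : R) z : (forall j, nc (x j) <= c) ->
    entry_closure x z -> nc z <= c.
  by move=> h; apply: closure_nc_le => _ [j _ <-].
have hP : entry_bounds P a b g.
  move=> j; split.
  - exact: clo (subd_le hA) (subSa _ (hya j).1).
  - exact: clo (diag_le hA) (subSb _ (hyb j).1).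
  - exact: clo (supd_le hA) (subSg _ (hyg j).1).
(* What is left of [3 / n]: three diagonals cost [11 / 10] and the grid [3 / 2]. *)
have gap : 0 < (2 / 5) / n%:R :> R by rewrite divr_gt0.
have cE : (2 / 5) / n%:R <= eps - (a + g) * (22 / (7 * n%:R)) - 3 * eta - nc (l - mu).
  rewrite /eps /eps_dagger /eta /=.
  have : 11 / 30 / n%:R = 11 / 30 * n%:R^-1 :> R by [].
  move: lmu gap; move: (n%:R^-1) => u; move: ((a + g) * _) (nc _) => p q; lra.
apply: (notin_Spec hA gap _ _ sl).
- apply: (op_below_le cE); apply: (@op_below_perturb A P a b g eta l mu _ hP).
    by move=> j; split; [exact: (hya j).2|exact: (hyb j).2|exact: (hyg j).2].
  move=> x lx; apply: (periodised_lower_bound n0 t1 hP _ (ltW eps0) low lx).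
  by move=> j; split; [exact: (hya j).1|exact: (hyb j).1|exact: (hyg j).1].
- have cE' : (2 / 5) / n%:R <=
      eps - (g + a) * (22 / (7 * n%:R)) - 3 * eta - nc (l^* - mu^*).
    by rewrite -rmorphB ncJ [g + a]addrC.
  apply: (op_below_le cE').
  apply: (@op_below_perturb (adj A) (adj P) g b a eta l^* mu^* _ (adj_bounds hP)).
    by move=> j; rewrite /= -!rmorphB !ncJ; split;
      [exact: (hyg _).2|exact: (hyb j).2|exact: (hya _).2].
  move=> x lx; apply: (@periodised_lower_bound _ _ _ n0 t1 _ _ _ _
    (conj_set Sg) (conj_set Sb) (conj_set Sa) _ _ (adj_bounds hP) _ (ltW eps0) _ _ lx).
    by move=> j; rewrite /conj_set /= !conjCK; split;
      [exact: (hyg _).1|exact: (hyb j).1|exact: (hya _).1].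
  move=> C hC; have := bounded_below_ctrmx eps0 (low _ (periodised_conj n0 hC)).
  rewrite ctrmx_sub_scalar; congr (bounded_below _ (_ - _)).
  by apply/matrixP => i j; rewrite !mxE conjCK.
Qed.

(* Pseudoergodicity makes the periodic operator built from a periodised matrix
   a limit operator of [A]. *)
Lemma per_mx_lower_bound A Sa Sb Sg a b g t n al be ga l d :
  compact (Sa : set (R[i] : numFieldType)) ->
  compact (Sb : set (R[i] : numFieldType)) ->
  compact (Sg : set (R[i] : numFieldType)) ->
  pseudoergodic A Sa Sb Sg -> entry_bounds A a b g -> nc t = 1 -> (0 < n)%N ->
  (forall j, (j < n)%N -> [/\ entry_closure (subd A) (al j),
     entry_closure (diag A) (be j) & entry_closure (supd A) (ga j)]) ->
  op_below A l d -> bounded_below d (per_mx n t al be ga - l%:M).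
Proof.
move=> cSa cSb cSg hA bA t1 n0 h low.
have hS := hA.1.
have rS (x : int -> R[i]) S z : compact (S : set (R[i] : numFieldType)) ->
    (forall j, S (x j)) -> entry_closure x z -> S z.
  by move=> cS xS; apply: closure_sub_compact => // _ [j _ <-].
have rB (x : int -> R[i]) (c : R) z : (forall j, nc (x j) <= c) ->
    entry_closure x z -> nc z <= c.
  by move=> hx; apply: closure_nc_le => _ [j _ <-].
have hP : entry_bounds (periodic_tridiag n al be ga) a b g.
  move=> j; have [h1 h2 h3] := h _ (ltn_pmod `|j|%N n0).
  split; [exact: rB (subd_le bA) h1|exact: rB (diag_le bA) h2|
    exact: rB (supd_le bA) h3].
apply: (floquet_lower_bound n0 t1 hP) => m U U0.
apply: (op_below_limit hA hP _ low U0) => j.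
have [h1 h2 h3] := h _ (ltn_pmod `|j|%N n0).
split.
- by apply: rS h1 => // k; have [] := hS k.
- by apply: rS h2 => // k; have [] := hS k.
- by apply: rS h3 => // k; have [] := hS k.
Qed.

End SpectralApproximation.

(** * Inclusions and Hausdorff convergence *)

Section SpectralConvergence.
Variables (R : realType) (t : R[i]) (A : tridiag R) (Sa Sb Sg : set R[i]).
Variables (bd : R * R * R) (S : nat -> set R[i] * set R[i] * set R[i]).
Local Notation nc := (@Normc.normc R).
Hypothesis t1 : nc t = 1.
Hypothesis cSa : compact (Sa : set (R[i] : numFieldType)).
Hypothesis cSb : compact (Sb : set (R[i] : numFieldType)).
Hypothesis cSg : compact (Sg : set (R[i] : numFieldType)).
Hypothesis psi : pseudoergodic A Sa Sb Sg.
Hypothesis hA : entry_bounds A bd.1.1 bd.1.2 bd.2.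
Hypothesis hS : forall n, (0 < n)%N ->
  [/\ approximates n (S n).1.1 (entry_closure (subd A)),
      approximates n (S n).1.2 (entry_closure (diag A))
    & approximates n (S n).2 (entry_closure (supd A))].

Let rad : R := bd.1.1 + bd.1.2 + bd.2.
Let eps n : R := eps_dagger n bd + 3 / n%:R.
Let Pi n := Pi_fin n t bd (S n).
Let hatPi n := hatPi_fin n t bd (S n).

Let bd0 : [/\ 0 <= bd.1.1, 0 <= bd.1.2 & 0 <= bd.2].
Proof. exact: entry_bounds_ge0 hA. Qed.

Let rad0 : 0 <= rad.
Proof. by rewrite /rad; have [? ? ?] := bd0; rewrite !addr_ge0. Qed.

Lemma eps_gt0 n : (0 < n)%N -> 0 < eps n.
Proof.
move=> n0; have [a0 b0 g0] := bd0; have np : 0 < n%:R :> R by rewrite ltr0n.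
by rewrite /eps ltr_wpDl ?divr_gt0// /eps_dagger mulr_ge0 ?addr_ge0 ?divr_ge0 ?mulr_ge0.
Qed.

Lemma Spec_near_Pi n l : (0 < n)%N -> Spec (tri_op A) l ->
  exists2 m, Pi n m & nc (l - m) <= 3 / 2 / n%:R.
Proof.
move=> n0 sl; have lr := Spec_le hA sl.
have [m gm lm] := grid_near n0 lr; exists m => //; split=> //.
have [h1 h2 h3] := hS n0.
have := Spec_sub_Delta hA t1 n0 h1 h2 h3 lm sl.
by rewrite /eps_dagger.
Qed.

Lemma Spec_sub_hatPi n : (0 < n)%N -> Spec (tri_op A) `<=` hatPi n.
Proof.
move=> n0 l sl; have [m Pm lm] := Spec_near_Pi n0 sl.
exists m => //; exists (l - m); last by rewrite addrC subrK.
have np : 0 < n%:R :> R by rewrite ltr0n.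
apply: closed_discP; first by rewrite divr_ge0 ?ler0n.
by apply: (le_trans lm); rewrite ler_wpM2r ?invr_ge0 ?ltW//; lra.
Qed.

(** The only information about [Pi n] that the pseudospectral inclusion and the convergence draw
    from pseudoergodicity. *)
Lemma Pi_lower_bound n l d : (0 < n)%N -> Pi n l -> op_below A l d -> d <= eps n.
Proof.
move=> n0 [hD _] low; rewrite -lee_fin; apply: le_trans hD.
apply: le_ereal_inf_tmp => _ [B hB <-]; apply/bounded_belowP.
have [[_ sa _] [_ sb _] [_ sg _]] := hS n0.
move: hB => /per_mxP-/(_ n0)[al [be [ga [h ->]]]].
apply: (per_mx_lower_bound cSa cSb cSg psi hA t1 n0 _ low) => j jn.
by have [h1 h2 h3] := h j jn; split; [exact: sa|exact: sb|exact: sg].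
Qed.

Lemma Pi_sub_Spec_eps n : (0 < n)%N -> Pi n `<=` Spec_eps (eps n) (tri_op A).
Proof.
move=> n0 l hl; apply: (Spec_eps_of_lower_bounds hA (eps_gt0 n0)) => d.
exact: Pi_lower_bound.
Qed.

(** For [n = 1] a periodised matrix is a number, and subtracting that number leaves 0, which has no
    positive lower bound. *)
Lemma Spec_neq0 : Spec (tri_op A) !=set0.
Proof.
pose M := per_mx 1 t (fun=> subd A 0) (fun=> diag A 0) (fun=> supd A 0).
pose l := M ord0 ord0.
exists l; apply: (Spec_of_no_lower_bound hA) => d d0 low.
have cl (x : int -> R[i]) : entry_closure x (x 0).
  by apply: subset_closure_C; exists 0.
have := @per_mx_lower_bound _ _ _ _ _ _ _ _ _ 1 (fun=> subd A 0) (fun=> diag A 0)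
  (fun=> supd A 0) l d cSa cSb cSg psi hA t1 isT _ low.
move=> /(_ (fun j _ => And3 (cl _) (cl _) (cl _))) /(_ (const_mx 1)).
rewrite -/M (_ : M - l%:M = 0) ?mul0mx; last first.
  by rewrite {1}[M]mx11_scalar subrr.
rewrite /l2norm !big_ord1 !mxE nc0 nc1 expr0n expr1n sqrtr0 sqrtr1 mulr1.
by rewrite leNgt d0.
Qed.

Lemma Pi_le n l : Pi n l -> nc l <= rad.
Proof. by move=> [_ [_ h]]; exact: open_disc_le rad0 h. Qed.

Lemma eps_cvg0 (e : R) : 0 < e -> exists N, forall n, (N < n)%N -> eps n < e.
Proof.
move=> e0; have [a0 b0 g0] := bd0.
pose C : R := (bd.1.1 + bd.2) * (22 / 7) + 3.
have C0 : 0 < C by rewrite /C ltr_wpDl// mulr_ge0 ?addr_ge0.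
exists (Num.truncn (C / e)) => n hn.
have np : 0 < n%:R :> R by rewrite ltr0n (leq_ltn_trans _ hn).
have -> : eps n = C / n%:R by rewrite /eps /eps_dagger /C; field; rewrite gt_eqF.
rewrite ltr_pdivrMr// mulrC -ltr_pdivrMr//.
by apply: (lt_le_trans (truncnS_gt _)); rewrite ler_nat.
Qed.

(* Near a point outside the spectrum [A] is uniformly bounded below, which the
   points of [Pi n] forbid for large [n]; compactness of the disc makes the
   threshold uniform. *)
Lemma Pi_near_Spec (e : R) : 0 < e ->
  \forall n \near \oo, forall l, Pi n l -> (dist_to l (Spec (tri_op A)) <= e%:E)%E.
Proof.
move=> e0.
(* In real coordinates compactness is that of a product of segments; this square contains the
   disc. *)
pose box := `[- rad, rad]%classic `*` `[- rad, rad]%classic : set (R * R).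
have cbox : compact box by apply: compact_setX; exact: segment_compact.
have := (compact_near_coveringP box).1 cbox nat \oo
  (fun n (p : R * R) => Pi n (Complex p.1 p.2) ->
    (dist_to (Complex p.1 p.2) (Spec (tri_op A)) <= e%:E)%E) _.
move=> H.
have {}H : \forall n \near \oo, box `<=` (fun p => Pi n (Complex p.1 p.2) ->
    (dist_to (Complex p.1 p.2) (Spec (tri_op A)) <= e%:E)%E).
  apply: H => -[x y] _.
  pose z : R[i] := Complex x y.
  have close (r : R) : 0 < r -> \forall p \near nbhs ((x, y) : R * R),
      nc (Complex p.1 p.2 - z) <= r.
    move=> r0; have r2 : 0 < r / 2 by rewrite divr_gt0.
    exists (ball x (r / 2), ball y (r / 2)) => /=.
      by split; exact: nbhsx_ballx.
    move=> [u v] [hu hv]; change (nc (Complex u v - z) <= r).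
    apply: (le_trans (nc_le_ReIm _)); rewrite ReD ReN ImD ImN /=.
    move: hu hv; rewrite -!ball_normE /= /ball_ /= => hu hv.
    by rewrite distrC [X in _ + X]distrC; lra.
  have [sz|nsz] := pselect (Spec (tri_op A) z).
    exists ([set p : R * R | nc (Complex p.1 p.2 - z) <= e] : set (R * R)%type, [set: nat]).
      by split; [exact: close|exact: filterT].
    by move=> [p n] [hp _] _; exact: dist_to_le sz hp.
  have [d d0 low] : exists2 d, 0 < d & op_below A z d.
    apply: contrapT => h; apply: nsz; apply: (Spec_of_no_lower_bound hA) => d d0 low.
    by apply: h; exists d.
  have d2 : 0 < d / 2 by rewrite divr_gt0.
  (* Moving the spectral parameter by at most [d / 2] keeps the lower bound [d / 2], which exceeds
     [eps n] beyond [N]. *)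
  have [N hN] := eps_cvg0 d2.
  exists ([set p : R * R | nc (Complex p.1 p.2 - z) <= d / 2] : set (R * R)%type,
    [set n | (N < n)%N]).
    by split; [exact: close|exact: nbhs_infty_gt].
  move=> [p n] [pz Nn]; have {}pz : nc (Complex p.1 p.2 - z) <= d / 2 := pz.
  have {}Nn : (N < n)%N := Nn.
  change (Pi n (Complex p.1 p.2) ->
    (dist_to (Complex p.1 p.2) (Spec (tri_op A)) <= e%:E)%E).
  move=> Pp; exfalso.
  have n0 : (0 < n)%N by exact: leq_ltn_trans Nn.
  have lowp : op_below A (Complex p.1 p.2) (d / 2).
    have := @op_below_perturb _ A A _ _ _ 0 (Complex p.1 p.2) z d hA _ low.
    move=> h; apply: (op_below_le _ (h _)); first by lra.
    by move=> j; rewrite !subrr nc0.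
  have := Pi_lower_bound n0 Pp lowp.
  by rewrite leNgt hN.
apply: filterS H => n H l Pl.
have lr := Pi_le Pl.
have := H (complex.Re l, complex.Im l); rewrite /= (_ : Complex _ _ = l); last by case: (l).
apply=> //; split; rewrite /= in_itv /= -ler_norml.
  by rewrite (le_trans (Re_le_nc _)).
by rewrite (le_trans (Im_le_nc _)).
Qed.

Lemma Pi_cvg : hausdorff (Pi n) (Spec (tri_op A)) @[n --> \oo] --> (0 : \bar R)%E.
Proof.
apply: cvg_ereal0 => e e0; near=> n.
have n0 : (0 < n)%N by near: n; exact: nbhs_infty_gt.
have np : 0 < n%:R :> R by rewrite ltr0n.
have [s ss] := Spec_neq0; have [m Pm _] := Spec_near_Pi n0 ss.
split; first exact: hausdorff_ge0 Pm.
apply: hausdorff_le => [l Pl|l sl].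
  by move: l Pl; near: n; exact: Pi_near_Spec.
have [m' Pm' lm'] := Spec_near_Pi n0 sl; apply: (dist_to_le Pm').
apply: (le_trans lm'); rewrite ler_pdivrMr// [leRHS]mulrC -ler_pdivrMr//.
near: n; exact: nbhs_infty_ger.
Unshelve. all: by end_near. Qed.

Lemma hatPi_cvg : hausdorff (hatPi n) (Spec (tri_op A)) @[n --> \oo] --> (0 : \bar R)%E.
Proof.
apply: cvg_ereal0 => e e0.
have e2 : 0 < e / 2 by rewrite divr_gt0.
have e4 : 0 < e / 4 by rewrite divr_gt0.
near=> n.
have n0 : (0 < n)%N by near: n; exact: nbhs_infty_gt.
have np : 0 < n%:R :> R by rewrite ltr0n.
have [s ss] := Spec_neq0; have hs := Spec_sub_hatPi n0 ss.
split; first exact: hausdorff_ge0 hs.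
apply: hausdorff_le => [_ [l Pl [w hw <-]]|l sl]; last first.
  by apply: (dist_to_le (Spec_sub_hatPi n0 sl)); rewrite subrr nc0; exact: ltW e0.
have h : (dist_to l (Spec (tri_op A)) <= (e / 4)%:E)%E.
  by move: l Pl; near: n; exact: Pi_near_Spec.
have : (dist_to l (Spec (tri_op A)) < (e / 2)%:E)%E.
  by apply: (le_lt_trans h); rewrite lte_fin; lra.
move=> /ereal_inf_lt [_ [u su <-]]; rewrite lte_fin => lu.
apply: (dist_to_le su).
have -> : l + w - u = (l - u) + w by ring.
apply: (le_trans (ncD _ _)).
have w2 : nc w <= 2 / n%:R by apply: closed_disc_le hw; rewrite divr_ge0 ?ler0n.
have : 2 / n%:R <= e / 2.
  rewrite ler_pdivrMr// [leRHS]mulrC -ler_pdivrMr//.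
  near: n; exact: nbhs_infty_ger.
by move: w2 lu; move: (nc _) (nc _) (2 / _) => p q r; lra.
Unshelve. all: by end_near. Qed.

End SpectralConvergence.

(** * Gaussian elimination and the smallest singular value *)

Section Elimination.
Variable R : realType.
Implicit Types (Q : nat -> nat -> R) (x : nat -> R).

(** Gaussian elimination without pivoting; the update is applied to every entry, including rows
    above the pivot, which keeps the recursion uniform. *)
Fixpoint elim Q (k i j : nat) : R :=
  if k is k'.+1 then elim Q k' i j - elim Q k' i k' * elim Q k' k' j / elim Q k' k' k'
  else Q i j.

Lemma elim_shift Q m k i j :
  elim Q (m + k) (m + i) (m + j)
  = elim (fun i j => elim Q m (m + i) (m + j)) k i j.
Proof.
by elim: k i j => [|k ih] i j; rewrite ?addn0// addnS /= !ih.
Qed.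

Definition qform N Q x : R := \sum_(i < N) \sum_(j < N) Q i j * x i * x j.

Definition schur Q (i j : nat) : R := elim Q 1 i.+1 j.+1.

Lemma elim_schur Q k i j : elim Q k.+1 i.+1 j.+1 = elim (schur Q) k i j.
Proof. exact: (elim_shift Q 1 k i j). Qed.

Lemma schur_sym Q : (forall i j, Q i j = Q j i) ->
  forall i j, schur Q i j = schur Q j i.
Proof.
by move=> h i j; rewrite /schur /= (h i.+1 j.+1) (h i.+1 0%N) (h 0%N j.+1); ring.
Qed.

(** Completing the square in [x 0]. *)
Lemma qformS N Q x : (forall i j, Q i j = Q j i) -> Q 0%N 0%N != 0 ->
  qform N.+1 Q x = Q 0%N 0%N * (x 0%N + (\sum_(j < N) Q 0%N j.+1 * x j.+1) / Q 0%N 0%N) ^+ 2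
    + qform N (schur Q) (fun i => x i.+1).
Proof.
move=> sQ d0; rewrite /qform big_ord_recl big_ord_recl.
set d := Q 0%N 0%N; set s := \sum_(j < N) Q 0%N j.+1 * x j.+1.
have -> : \sum_(j < N) Q 0%N (lift ord0 j) * x 0%N * x (lift ord0 j) = x 0%N * s.
  by rewrite mulr_sumr; apply: eq_bigr => j _; rewrite lift0; ring.
have -> : \sum_(i < N) \sum_(j < N.+1) Q (lift ord0 i) j * x (lift ord0 i) * x j =
    x 0%N * s + \sum_(i < N) \sum_(j < N) Q i.+1 j.+1 * x i.+1 * x j.+1.
  rewrite mulr_sumr -big_split; apply: eq_bigr => i _.
  rewrite big_ord_recl lift0 (sQ i.+1 0%N); congr (_ + _).
  by rewrite /=; ring.
have -> : \sum_(i < N) \sum_(j < N) schur Q i j * x i.+1 * x j.+1 =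
   \sum_(i < N) \sum_(j < N) Q i.+1 j.+1 * x i.+1 * x j.+1 - s ^+ 2 / d.
  rewrite expr2 mulr_suml mulr_suml -sumrB; apply: eq_bigr => i _.
  rewrite mulr_sumr mulr_suml -sumrB; apply: eq_bigr => j _.
  by rewrite /schur /= (sQ i.+1 0%N) -/d; field.
by field.
Qed.

Lemma geo_arith (a b c : R) : 0 <= a -> 0 <= b -> c ^+ 2 <= a * b ->
  2 * c <= a + b.
Proof.
move=> a0 b0 h; have ab0 : 0 <= a + b by rewrite addr_ge0.
apply: le_trans (ler_norm _) _.
rewrite -(@ler_pXn2r _ 2) ?nnegrE// real_normK ?num_real// -subr_ge0.
rewrite (_ : _ - _ = (a - b) ^+ 2 + 4 * (a * b - c ^+ 2)); last by ring.
by apply: addr_ge0; [exact: sqr_ge0|apply: mulr_ge0 => //; rewrite subr_ge0].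
Qed.

(** The Cauchy-Schwarz inequality. *)
Lemma sum_mul_sqr_le N (u x : nat -> R) :
  (\sum_(j < N) u j * x j) ^+ 2 <= (\sum_(j < N) u j ^+ 2) * \sum_(j < N) x j ^+ 2.
Proof.
elim: N => [|N ih]; first by rewrite !big_ord0 expr0n mul0r.
rewrite !big_ord_recr /=; move: ih.
set s := \sum_(j < N) u j * x j; set p := \sum_(j < N) u j ^+ 2.
set q := \sum_(j < N) x j ^+ 2; move: (u N) (x N) => v y ih.
have p0 : 0 <= p by rewrite sumr_ge0// => i _; exact: sqr_ge0.
have q0 : 0 <= q by rewrite sumr_ge0// => i _; exact: sqr_ge0.
have h : 2 * s * (v * y) <= p * y ^+ 2 + q * v ^+ 2.
  have h1 : (s * (v * y)) ^+ 2 <= (p * y ^+ 2) * (q * v ^+ 2).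
    have -> : (p * y ^+ 2) * (q * v ^+ 2) = (p * q) * (v * y) ^+ 2 by ring.
    by rewrite exprMn ler_wpM2r ?sqr_ge0.
  rewrite -mulrA; apply: geo_arith; last exact: h1.
    by rewrite mulr_ge0 ?sqr_ge0.
  by rewrite mulr_ge0 ?sqr_ge0.
rewrite -subr_ge0 (_ : _ - _ =
  (p * q - s ^+ 2) + (p * y ^+ 2 + q * v ^+ 2 - 2 * s * (v * y))); last by ring.
by apply: addr_ge0; rewrite subr_ge0.
Qed.

(** Coercivity and not mere positivity is wanted: [nu] is an infimum and has to exceed [eps]
    strictly. *)
Lemma pivots_pos_coercive N Q : (forall i j, Q i j = Q j i) ->
  (forall k, (k < N)%N -> 0 < elim Q k k k) ->
  exists2 d, 0 < d & forall x, d * \sum_(i < N) x i ^+ 2 <= qform N Q x.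
Proof.
elim: N Q => [|N ih] Q sQ pos.
  by exists 1 => // x; rewrite /qform !big_ord0 mulr0.
have [|k kN|e e0 he] := ih (schur Q).
- exact: schur_sym.
- by rewrite -elim_schur; exact: pos.
have d0 : 0 < Q 0%N 0%N by exact: (pos 0%N).
set d := Q 0%N 0%N in d0 *.
pose L := (\sum_(j < N) Q 0%N j.+1 ^+ 2) / d ^+ 2.
have L0 : 0 <= L by rewrite divr_ge0 ?sqr_ge0// sumr_ge0// => i _; exact: sqr_ge0.
(* The squares sum to at most [2 (x 0 + l)^2 + (2 L + 1) S]; the form controls [(x 0 + l)^2] through
   [d] and [S] through [e]. *)
pose M := 2 / d + (2 * L + 1) / e.
have M0 : 0 < M.
  by rewrite addr_gt0 ?divr_gt0// ltr_wpDl// mulr_ge0.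
exists M^-1; first by rewrite invr_gt0.
move=> x; rewrite mulrC ler_pdivrMr// mulrC qformS ?gt_eqF// -/d.
rewrite big_ord_recl (eq_bigr (fun i : 'I_N => x i.+1 ^+ 2)); last first.
  by move=> i _; rewrite lift0.
have := he (fun i => x i.+1).
set q := qform _ _ _; set S := \sum_(i < N) _; set l := (\sum_(j < N) _) / d.
move=> hq.
have S0 : 0 <= S by rewrite sumr_ge0// => i _; exact: sqr_ge0.
have lS : l ^+ 2 <= L * S.
  rewrite /l /L expr_div_n [X in _ <= X]mulrAC ler_wpM2r ?invr_ge0 ?sqr_ge0//.
  exact: (sum_mul_sqr_le N (fun j => Q 0%N j.+1) (fun j => x j.+1)).
have hS : S <= q / e by rewrite ler_pdivlMr// mulrC.
have q0 : 0 <= q by apply: le_trans hq; rewrite mulr_ge0// ltW.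
have h1 : x 0%N ^+ 2 <= 2 * (x 0%N + l) ^+ 2 + 2 * l ^+ 2.
  rewrite -subr_ge0 (_ : _ - _ = (x 0%N + l + l) ^+ 2); last by ring.
  exact: sqr_ge0.
apply: (@le_trans _ _ (2 * (x 0%N + l) ^+ 2 + (2 * L + 1) * S)).
  rewrite (_ : (2 * L + 1) * S = 2 * (L * S) + S); last by ring.
  by move: h1 lS; move: (L * S) => LS; lra.
have h2 : (2 * L + 1) * S <= (2 * L + 1) / e * q.
  rewrite -mulrA [e^-1 * q]mulrC ler_wpM2l//.
  by rewrite addr_ge0// mulr_ge0.
have k0 : 0 <= (2 * L + 1) / e.
  by rewrite divr_ge0 ?(ltW e0)// addr_ge0// mulr_ge0.
have h3 : 0 <= (2 * L + 1) / e * (d * (x 0%N + l) ^+ 2).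
  by apply: mulr_ge0 => //; apply: mulr_ge0 (ltW d0) (sqr_ge0 _).
have h4 : 0 <= 2 / d * q by apply: mulr_ge0 => //; rewrite divr_ge0 ?(ltW d0).
rewrite (_ : M * _ = 2 * (x 0%N + l) ^+ 2 + 2 / d * q
  + (2 * L + 1) / e * (d * (x 0%N + l) ^+ 2) + (2 * L + 1) / e * q); last first.
  by rewrite /M; field; rewrite !gt_eqF.
apply: (@le_trans _ _ (2 * (x 0%N + l) ^+ 2 + (2 * L + 1) / e * q)).
  by rewrite lerD2l.
by rewrite lerD2r -addrA lerDl addr_ge0.
Qed.

Lemma pos_pivots_pos N Q : (forall i j, Q i j = Q j i) ->
  (forall x, (exists2 i, (i < N)%N & x i != 0) -> 0 < qform N Q x) ->
  forall k, (k < N)%N -> 0 < elim Q k k k.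
Proof.
elim: N Q => [|N ih] Q sQ pos k kN //.
have d0 : 0 < Q 0%N 0%N.
  have := pos (fun i => (i == 0%N)%:R); rewrite /qform big_ord_recl.
  rewrite big_ord_recl !mulr1 big1; last by move=> i _; rewrite lift0 mulr0.
  rewrite addr0 big1 ?addr0; last first.
    by move=> i _; rewrite big1// => j _; rewrite lift0 mulr0 mul0r.
  by apply; exists 0%N; rewrite // oner_neq0.
case: k kN => [|k] kN //.
rewrite elim_schur; apply: ih => //; first exact: schur_sym.
move=> x [i iN xi].
(* The first coordinate is chosen to annihilate the completed square, leaving the form of the Schur
   complement. *)
pose x' j := if j is j'.+1 then x j'
  else - ((\sum_(j < N) Q 0%N j.+1 * x j) / Q 0%N 0%N).
have := pos x' (ex_intro2 _ _ i.+1 iN xi).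
by rewrite qformS ?gt_eqF//= addNr expr0n /= mulr0 add0r.
Qed.

End Elimination.

(** * Smallest singular values and pivots *)

Section SmallestSingularValue.
Variable R : realType.
Local Notation nc := (@Normc.normc R).
Implicit Types (C : nat -> nat -> R[i]) (f : nat -> R[i]) (x : nat -> R).

(* Real [2n * 2n] form of [C]: index [2 s + c] stands for the real ([c = 0]) or
   imaginary ([c = 1]) part of coordinate [s]. *)
Definition rmat C (p q : nat) : R :=
  if (p %% 2 == q %% 2)%N then complex.Re (C (p %/ 2)%N (q %/ 2)%N)
  else if (p %% 2 < q %% 2)%N then - complex.Im (C (p %/ 2)%N (q %/ 2)%N)
  else complex.Im (C (p %/ 2)%N (q %/ 2)%N).

(* Eliminating the first half of [[-I, C], [C^T, - eps^2]] leaves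
   [C^T C - eps^2]. *)
Definition bordered n (eps : R) C (i j : nat) : R :=
  if (i < 2 * n)%N then
    if (j < 2 * n)%N then - (i == j)%:R else rmat C i (j - 2 * n)%N
  else if (j < 2 * n)%N then rmat C j (i - 2 * n)%N else - eps ^+ 2 * (i == j)%:R.

Definition gram n (eps : R) C (p q : nat) : R :=
  \sum_(r < 2 * n) rmat C r p * rmat C r q - eps ^+ 2 * (p == q)%:R.

(** The leading block is [- I], so the first pivots are all [-1] and each step adds the product of a
    border column and a border row. *)
Lemma elim_bordered_half n eps C k i j : (k <= 2 * n)%N -> (k <= i)%N -> (k <= j)%N ->
  elim (bordered n eps C) k i j = bordered n eps C i j
    + \sum_(r < k) bordered n eps C i r * bordered n eps C r j.
Proof.
elim: k i j => [|k ih] i j kn ki kj; first by rewrite big_ord0 addr0.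
have zk r : (r < k)%N -> bordered n eps C k r = 0 /\ bordered n eps C r k = 0.
  move=> rk; rewrite /bordered kn (ltn_trans rk kn) (gtn_eqF rk) (ltn_eqF rk).
  by rewrite oppr0.
have ek : elim (bordered n eps C) k k k = -1.
  rewrite ih ?(ltnW kn)// big1 ?addr0; last by move=> r _; rewrite (zk r _).1 ?mul0r.
  by rewrite /bordered kn eqxx.
have eik : elim (bordered n eps C) k i k = bordered n eps C i k.
  by rewrite ih ?(ltnW kn) ?(ltnW ki)// big1 ?addr0// => r _; rewrite (zk r _).2 ?mulr0.
have ekj : elim (bordered n eps C) k k j = bordered n eps C k j.
  by rewrite ih ?(ltnW kn) ?(ltnW kj)// big1 ?addr0// => r _; rewrite (zk r _).1 ?mul0r.
rewrite /= ek eik ekj ih ?(ltnW kn) ?(ltnW ki) ?(ltnW kj)// big_ord_recr /=.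
by rewrite invrN1 mulrN1 opprK addrA.
Qed.

(** The sums in [gram] are thus carried out by the elimination itself, and the program only has to
    supply single matrix entries. *)
Lemma elim_bordered n eps C k :
  elim (bordered n eps C) (2 * n + k)%N (2 * n + k)%N (2 * n + k)%N
  = elim (gram n eps C) k k k.
Proof.
rewrite elim_shift; congr elim; apply/funext => p; apply/funext => q.
rewrite elim_bordered_half ?leq_addr// /gram addrC; congr (_ + _).
  apply: eq_bigr => r _; rewrite /bordered ltn_ord !ifF ?addKn//.
    by apply/negbTE; rewrite -leqNgt leq_addr.
  by apply/negbTE; rewrite -leqNgt leq_addr.
rewrite /bordered !ifF ?eqn_add2l ?mulNr//.
  by apply/negbTE; rewrite -leqNgt leq_addr.
by apply/negbTE; rewrite -leqNgt leq_addr.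
Qed.

Lemma gram_sym n eps C p q : gram n eps C p q = gram n eps C q p.
Proof.
by rewrite /gram eq_sym; congr (_ - _); apply: eq_bigr => r _; rewrite mulrC.
Qed.

Lemma qform_gram n eps C x : qform (2 * n) (gram n eps C) x =
  \sum_(r < 2 * n) (\sum_(p < 2 * n) rmat C r p * x p) ^+ 2
  - eps ^+ 2 * \sum_(p < 2 * n) x p ^+ 2.
Proof.
rewrite /qform (eq_bigr (fun i : 'I_(2 * n) =>
   \sum_(r < 2 * n) rmat C r i * x i * (\sum_(p < 2 * n) rmat C r p * x p)
   - eps ^+ 2 * x i ^+ 2)).
  rewrite sumrB -mulr_sumr exchange_big /=; congr (_ - _).
  by apply: eq_bigr => r _; rewrite -mulr_suml expr2.
move=> i _; rewrite /gram.
rewrite (eq_bigr (fun j : 'I_(2 * n) =>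
   \sum_(r < 2 * n) rmat C r i * x i * (rmat C r j * x j)
   - eps ^+ 2 * (nat_of_ord i == j)%:R * x i * x j)).
  rewrite sumrB exchange_big /=; congr (_ - _).
    by apply: eq_bigr => r _; rewrite mulr_sumr.
  rewrite (bigD1 i)//= eqxx big1 ?addr0; first by rewrite mulr1; ring.
  move=> j ji; rewrite (_ : (nat_of_ord i == j) = false) ?mulr0 ?mul0r//.
  by apply/negbTE; rewrite eq_sym.
move=> j _; rewrite mulrBl mulrBl !mulr_suml; congr (_ - _).
by apply: eq_bigr => r _; ring.
Qed.

Lemma sum_double n (G : nat -> R) :
  \sum_(p < 2 * n) G p = \sum_(s < n) (G (2 * s)%N + G (2 * s).+1).
Proof.
elim: n => [|n ih]; first by rewrite !big_ord0.
by rewrite mulnS add2n !big_ord_recr /= ih addrA.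
Qed.

Definition realify f (p : nat) : R :=
  if (p %% 2 == 0)%N then complex.Re (f (p %/ 2)%N) else complex.Im (f (p %/ 2)%N).

Let even_mod s : ((2 * s) %% 2 = 0)%N. Proof. by rewrite modnMr. Qed.
Let odd_mod s : ((2 * s).+1 %% 2 = 1)%N. Proof. by rewrite -addn1 mulnC modnMDl. Qed.
Let even_div s : ((2 * s) %/ 2 = s)%N. Proof. by rewrite mulKn. Qed.
Let odd_div s : ((2 * s).+1 %/ 2 = s)%N.
Proof. by rewrite -addn1 mulnC divnMDl// addn0. Qed.

Lemma realify_norm n f :
  \sum_(p < 2 * n) realify f p ^+ 2 = \sum_(s < n) nc (f s) ^+ 2.
Proof.
rewrite (sum_double n (fun p => realify f p ^+ 2)); apply: eq_bigr => s _.
by rewrite /realify even_mod odd_mod even_div odd_div nc_sqr.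
Qed.

Lemma rmat_realify n C f :
  \sum_(r < 2 * n) (\sum_(p < 2 * n) rmat C r p * realify f p) ^+ 2
  = \sum_(r < n) nc (\sum_(s < n) C r s * f s) ^+ 2.
Proof.
rewrite (sum_double n (fun r => (\sum_(p < 2 * n) rmat C r p * realify f p) ^+ 2)).
apply: eq_bigr => r _; rewrite nc_sqr.
rewrite (big_morph _ (@ReD R) (erefl : complex.Re 0 = 0)).
rewrite (big_morph _ (@ImD R) (erefl : complex.Im 0 = 0)).
congr (_ ^+ 2 + _ ^+ 2).
  rewrite (sum_double n (fun p => rmat C (2 * r)%N p * realify f p)).
  apply: eq_bigr => s _; rewrite /rmat /realify !even_mod !odd_mod !even_div !odd_div.
  by rewrite Re_mul /= mulNr.
rewrite (sum_double n (fun p => rmat C (2 * r).+1 p * realify f p)).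
apply: eq_bigr => s _; rewrite /rmat /realify !even_mod !odd_mod !even_div !odd_div.
by rewrite Im_mul /= addrC.
Qed.

Lemma nu_le_pivot n (eps : R) C (M : 'M[R[i]]_n) : 0 <= eps ->
  (forall r s : 'I_n, M r s = C r s) ->
  (nu M <= eps%:E)%E <-> exists2 k, (k < 2 * n)%N &
    elim (bordered n eps C) (2 * n + k)%N (2 * n + k)%N (2 * n + k)%N <= 0.
Proof.
move=> e0 MC.
have formE f (y : 'cV[R[i]]_n) : (forall s : 'I_n, y s ord0 = f s) ->
    qform (2 * n) (gram n eps C) (realify f)
    = l2norm (M *m y) ^+ 2 - eps ^+ 2 * l2norm y ^+ 2.
  move=> yf; rewrite qform_gram realify_norm rmat_realify !l2norm_sqr.
  congr (_ - _ * _); last by apply: eq_bigr => s _; rewrite yf.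
  apply: eq_bigr => r _; congr (nc _ ^+ 2); rewrite mxE.
  by apply: eq_bigr => s _; rewrite MC yf.
split=> [h|[k kn]].
  apply: contrapT => np.
  have pos k : (k < 2 * n)%N -> 0 < elim (gram n eps C) k k k.
    move=> kn; rewrite -elim_bordered ltNge; apply/negP => le.
    by apply: np; exists k.
  have [d d0 hd] := pivots_pos_coercive (gram_sym n eps C) pos.
  (* The coercivity constant raises the lower bound of [M] from [eps] to this larger value. *)
  pose e := Num.sqrt (eps ^+ 2 + d).
  have ed0 : 0 <= eps ^+ 2 + d by rewrite addr_ge0 ?sqr_ge0// ltW.
  have : bounded_below e M.
    move=> y; pose f (s : nat) := if insub s is Some i then y i ord0 else 0.
    have yf (s : 'I_n) : y s ord0 = f s by rewrite /f valK.
    have := hd (realify f); rewrite (formE f y yf) realify_norm.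
    rewrite (_ : \sum_(s < n) _ = l2norm y ^+ 2); last first.
      by rewrite l2norm_sqr; apply: eq_bigr => s _; rewrite yf.
    move=> hy.
    rewrite -(@ler_pXn2r _ 2) ?nnegrE ?l2norm_ge0 ?mulr_ge0 ?sqrtr_ge0 ?l2norm_ge0//.
    rewrite exprMn sqr_sqrtr// mulrDl; move: hy.
    by move: (l2norm (M *m y) ^+ 2) (d * _) (eps ^+ 2 * _) => u v w; lra.
  move=> /bounded_belowP/le_trans/(_ h); rewrite lee_fin leNgt.
  have : eps < e.
    rewrite -(@ltr_pXn2r _ 2) ?nnegrE ?sqrtr_ge0// sqr_sqrtr//.
    by rewrite ltrDl.
  by move=> ->.
rewrite elim_bordered => hk; rewrite leNgt; apply/negP => hnu.
suff : 0 < elim (gram n eps C) k k k by rewrite ltNge hk.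
move: k kn {hk}; apply: pos_pivots_pos; first exact: gram_sym.
move=> x [i iN xi].
pose f s : R[i] := Complex (x (2 * s)%N) (x (2 * s).+1).
have xf p : x p = realify f p.
  rewrite /realify /f; have [q [c [c2 ->]]] : exists q c, (c < 2)%N /\ p = (q * 2 + c)%N.
    by exists (p %/ 2)%N, (p %% 2)%N; rewrite ltn_pmod// -divn_eq.
  rewrite divnMDl// modnMDl divn_small// modn_small// addn0.
  by case: c c2 => [|[|//]] _ /=; congr x; lia.
pose y : 'cV[R[i]]_n := \col_(s < n) f s.
have yf (s : 'I_n) : y s ord0 = f s by rewrite mxE.
rewrite (_ : x = realify f); last by apply/funext => p; exact: xf.
rewrite (formE f y yf).
have yn : 0 < l2norm y.
  rewrite lt_neqAle l2norm_ge0 andbT eq_sym -sqrf_eq0 l2norm_sqr.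
  rewrite (eq_bigr (fun s : 'I_n => nc (f s) ^+ 2)); last by move=> s _; rewrite yf.
  rewrite -realify_norm psumr_neq0; last by move=> p _; exact: sqr_ge0.
  apply/hasP; exists (Ordinal iN); first exact: mem_index_enum.
  by rewrite /= -xf exprn_even_gt0.
rewrite subr_gt0 -exprMn ltr_pXn2r ?nnegrE ?mulr_ge0 ?l2norm_ge0//.
pose k : R[i] := ((l2norm y)^-1)%:C%C.
have nk : nc k = (l2norm y)^-1 by rewrite nc_real ger0_norm// invr_ge0 ltW.
have : (eps%:E < (l2norm (M *m (k *: y)))%:E)%E.
  apply: (lt_le_trans hnu); apply: ereal_inf_lbound; exists (k *: y) => //=.
  by rewrite l2normZ nk mulVf// gt_eqF.
rewrite -scalemxAr l2normZ nk lte_fin.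
by rewrite mulrC ltr_pdivlMr.
Qed.

End SmallestSingularValue.

(** * The real random-access machine *)

Lemma mixed_radix_lt (b B r D : nat) :
  (b < B)%N -> (r < D)%N -> (b * D + r < B * D)%N.
Proof.
move=> bB rD; apply: (@leq_trans (b.+1 * D)); last by rewrite leq_mul2r bB orbT.
by rewrite mulSnr ltn_add2l.
Qed.

(** * Enumeration of the periodised matrices *)

Section Codes.
Variables (R : realType) (n : nat) (t : R[i]) (sa sb sg : seq R[i]).
Local Notation nc := (@Normc.normc R).
Hypothesis n0 : (0 < n)%N.

Let la := size sa.
Let lb := size sb.
Let lg := size sg.
Definition base_size : nat := (la * lb * lg)%N.
Let c := base_size.

(* A code [m < c ^ n] lists, in base [c], the triples of indices of the
   entries of the [n] columns of a periodised matrix. *)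
Definition digit (m j : nat) : nat := ((m %/ c ^ j) %% c)%N.
Definition code_al (m j : nat) : R[i] := nth 0 sa (digit m j %% la).
Definition code_be (m j : nat) : R[i] := nth 0 sb (digit m j %/ la %% lb).
Definition code_ga (m j : nat) : R[i] := nth 0 sg (digit m j %/ la %/ lb).

Lemma digitS m j : digit m j.+1 = digit (m %/ c) j.
Proof. by rewrite /digit expnS divnMA. Qed.

Lemma digit0 m : digit m 0 = (m %% c)%N.
Proof. by rewrite /digit expn0 divn1. Qed.

Lemma code_exists (d : nat -> nat) (k : nat) : (forall j, (j < k)%N -> (d j < c)%N) ->
  exists2 m, (m < c ^ k)%N & forall j, (j < k)%N -> digit m j = d j.
Proof.
elim: k d => [|k ih] d hd; first by exists 0%N => //; rewrite expn0.
have [j jk|m mk hm] := ih (fun j => d j.+1); first exact: hd.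
have d0 : (d 0 < c)%N by exact: hd.
have c0 : (0 < c)%N by exact: leq_ltn_trans d0.
exists (m * c + d 0)%N.
  rewrite expnS; apply: (@leq_trans (m * c + c)%N); first by rewrite ltn_add2l.
  by rewrite -mulSnr mulnC leq_mul2l mk orbT.
case=> [|j] jk; first by rewrite digit0 modnMDl modn_small.
by rewrite digitS divnMDl// divn_small// addn0 hm.
Qed.

Lemma per_mx_ext al be ga al' be' ga' :
  (forall j, (j < n)%N -> [/\ al j = al' j, be j = be' j & ga j = ga' j]) ->
  per_mx n t al be ga = per_mx n t al' be' ga'.
Proof.
move=> h; apply/matrixP => r s; rewrite !mxE.
have [-> -> ->] := h s (ltn_ord s).
have [|-> _ _] := h n.-1; first by rewrite prednK.
by have [_ _ ->] := h 0%N n0.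
Qed.

(** Several codes may give the same matrix, since the lists may have repetitions; only surjectivity
    matters. *)
Lemma periodised_code (B : 'M[R[i]]_n) :
  periodised_mxs t [set` sa] [set` sb] [set` sg] B <->
  (0 < c)%N /\ exists2 m, (m < c ^ n)%N &
    B = per_mx n t (code_al m) (code_be m) (code_ga m).
Proof.
split.
  move=> /per_mxP-/(_ n0)[al [be [ga [h ->]]]].
  have [ha0 hb0 hg0] := h 0%N n0.
  have la0 : (0 < la)%N by rewrite /la; case: (sa) ha0.
  have lb0 : (0 < lb)%N by rewrite /lb; case: (sb) hb0.
  have lg0 : (0 < lg)%N by rewrite /lg; case: (sg) hg0.
  split; first by rewrite /c /base_size !muln_gt0 la0 lb0 lg0.
  pose d j := (index (al j) sa + la * (index (be j) sb + lb * index (ga j) sg))%N.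
  have [j jn|m mn hm] := @code_exists d n.
    have [ha hb hg] := h j jn.
    have : (index (al j) sa < la)%N by rewrite index_mem.
    have : (index (be j) sb < lb)%N by rewrite index_mem.
    have : (index (ga j) sg < lg)%N by rewrite index_mem.
    rewrite /d /c /base_size -mulnA.
    move: (index _ _) (index _ _) (index _ _) => i1 i2 i3 h3 h2 h1.
    have : (i2 + lb * i3 < lb * lg)%N by nia.
    by move: (i2 + lb * i3)%N (lb * lg)%N => u v; nia.
  exists m => //; apply: per_mx_ext => j jn.
  have [ha hb hg] := h j jn.
  rewrite /code_al /code_be /code_ga hm// /d mulnC.
  have dv : ((index (al j) sa + (index (be j) sb + lb * index (ga j) sg) * la) %/ la
      = index (be j) sb + lb * index (ga j) sg)%N.
    by rewrite addnC divnMDl// divn_small ?addn0// index_mem.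
  rewrite dv addnC modnMDl modn_small ?index_mem// nth_index//.
  rewrite addnC mulnC modnMDl modn_small ?index_mem// nth_index//.
  by rewrite divnMDl// divn_small ?index_mem// addn0 nth_index.
move=> [c0 [m mn ->]]; apply/per_mxP => //.
exists (code_al m), (code_be m), (code_ga m); split=> // j jn.
have [la0 lb0 lg0] : [/\ (0 < la)%N, (0 < lb)%N & (0 < lg)%N].
  by move: c0; rewrite /c /base_size !muln_gt0 => /andP[/andP[]].
have dc : (digit m j < c)%N by rewrite ltn_pmod.
split; rewrite /mkset /=; apply: mem_nth; rewrite ?ltn_pmod//.
by rewrite !ltn_divLR// -/la -/lb -/lg mulnC (mulnC lg) mulnA.
Qed.

Lemma Delta_code (eps : R) (l : R[i]) : 0 <= eps ->
  @Delta_fin_per R n t [set` sa] [set` sb] [set` sg] eps l <->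
  (0 < c)%N /\ exists2 m, (m < c ^ n)%N &
    (nu (per_mx n t (code_al m) (code_be m) (code_ga m) - l%:M) <= eps%:E)%E.
Proof.
move=> e0; split; last first.
  move=> [c0 [m mn h]]; apply: le_trans h; apply: ereal_inf_lbound.
  exists (per_mx n t (code_al m) (code_be m) (code_ga m)) => //.
  by apply/periodised_code; split=> //; exists m.
move=> h; pose F m := nu (per_mx n t (code_al m) (code_be m) (code_ga m) - l%:M).
have [[m mn Fm]|np] := pselect (exists2 m, (m < c ^ n)%N & (F m <= eps%:E)%E).
  split; last by exists m.
  by move: mn; case: (posnP c) => // ->; rewrite exp0n.
exfalso.
(* Finitely many values above [eps] have a common lower bound above [eps], which the infimum
   inherits. *)
have [e' ee' he'] : exists2 e', eps < e' & forall m, (m < c ^ n)%N -> (e'%:E <= F m)%E.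
  have {np} : forall m, (m < c ^ n)%N -> (eps%:E < F m)%E.
    by move=> m mn; rewrite ltNge; apply/negP => Fm; apply: np; exists m.
  elim: (c ^ n)%N => [|k ih] hk.
    by exists (eps + 1) => //; rewrite ltrDl.
  have [m mk|e' ee' he'] := ih; first by apply: hk; exact: leqW.
  have [r er rF] : exists2 r, eps < r & (r%:E <= F k)%E.
    have := hk k (ltnSn k); case: (F k) => [r||]//; first by rewrite lte_fin; exists r.
    by exists (eps + 1); rewrite ?ltrDl// leey.
  exists (Num.min e' r); first by rewrite lt_min ee'.
  move=> m; rewrite ltnS leq_eqVlt => /predU1P[->|mk].
    by apply: le_trans rF; rewrite lee_fin ge_min lexx orbT.
  by apply: le_trans (he' m mk); rewrite lee_fin ge_min lexx.
have : (e'%:E <= eps%:E)%E.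
  apply: le_trans h; apply: le_ereal_inf_tmp => _ [B /periodised_code[c0 [m mn ->]] <-].
  exact: he'.
by rewrite lee_fin leNgt ee'.
Qed.

Definition per_entry (m : nat) (l : R[i]) (r s : nat) : R[i] :=
  (r == s)%:R * (code_be m s - l) + (r == s.+1)%:R * code_al m s
   + (s == r.+1)%:R * code_ga m s
   + ((r == 0%N) && (s == n.-1))%:R * (t * code_al m n.-1)
   + ((r == n.-1) && (s == 0%N))%:R * (t^* * code_ga m 0).

Lemma nu_code_le m (eps : R) l : 0 <= eps ->
  (nu (per_mx n t (code_al m) (code_be m) (code_ga m) - l%:M) <= eps%:E)%E <->
  exists2 k, (k < 2 * n)%N &
    elim (bordered n eps (per_entry m l)) (2 * n + k)%N (2 * n + k)%N (2 * n + k)%N <= 0.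
Proof.
move=> e0; apply: nu_le_pivot => // r s; rewrite !mxE /per_entry.
rewrite (_ : (r == s) = (nat_of_ord r == s))// mulrBr -mulr_natl; ring.
Qed.

End Codes.

(** * A single index for all elimination tables *)

Section FlatIndex.
Variables (R : realType) (n : nat) (t : R[i]) (sa sb sg : seq R[i]).
Variables (bd : R * R * R) (L : nat).
Hypothesis n0 : (0 < n)%N.
Let c := base_size sa sb sg.
Let K := (c ^ n)%N.
(** The size of the bordered matrix, which has two blocks of size [2 * n]. *)
Let D := (4 * n)%N.
Let G := (2 * L + 1)%N.
Let rad : R := bd.1.1 + bd.1.2 + bd.2.
Definition radius_eps : R := eps_dagger n bd + 3 / n%:R.

(* One index enumerates a grid point, a matrix code, an elimination step [k] and
   an entry [(i, j)]. *)
Definition flat_j (i : nat) : nat := (i %% D)%N.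
Definition flat_i (i : nat) : nat := (i %/ D %% D)%N.
Definition flat_k (i : nat) : nat := (i %/ D %/ D %% D)%N.
Definition flat_block (i : nat) : nat := (i %/ D %/ D %/ D)%N.
Definition flat_code (i : nat) : nat := (flat_block i %% K)%N.
Definition flat_grid (i : nat) : nat := (flat_block i %/ K)%N.
Definition flat_point (i : nat) : R[i] :=
  Complex (((flat_grid i %/ G)%N%:R - L%:R) / n%:R)
          (((flat_grid i %% G)%N%:R - L%:R) / n%:R).
Definition flat_size : nat := (G * G * K * D * D * D)%N.

Definition flat_elim (i : nat) : R :=
  elim (bordered n radius_eps (per_entry n t sa sb sg (flat_code i) (flat_point i)))
    (flat_k i) (flat_i i) (flat_j i).

Definition flat_cell (blk k i j : nat) : nat := (((blk * D + k) * D + i) * D + j)%N.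

Let D0 : (0 < D)%N. Proof. by rewrite muln_gt0. Qed.

Lemma flat_cellE blk k i j : (k < D)%N -> (i < D)%N -> (j < D)%N ->
  [/\ flat_j (flat_cell blk k i j) = j, flat_i (flat_cell blk k i j) = i,
      flat_k (flat_cell blk k i j) = k & flat_block (flat_cell blk k i j) = blk].
Proof.
move=> kD iD jD; rewrite /flat_j /flat_i /flat_k /flat_block /flat_cell.
by do ! rewrite ?divnMDl ?(divn_small jD) ?(divn_small iD) ?(divn_small kD)
  ?addn0 ?modnMDl ?(modn_small jD) ?(modn_small iD) ?(modn_small kD)//.
Qed.

Lemma flat_cell_id i : flat_cell (flat_block i) (flat_k i) (flat_i i) (flat_j i) = i.
Proof.
by rewrite /flat_cell /flat_block /flat_k /flat_i /flat_j -!divn_eq.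
Qed.

(** Earlier elimination steps have smaller indices, so their values are already in the table when
    needed. *)
Lemma flat_cell_prev blk k k' i i' j j' : (k' < k)%N -> (i' < D)%N -> (j' < D)%N ->
  (flat_cell blk k' i' j' < flat_cell blk k i j)%N.
Proof.
move=> kk iD jD; rewrite /flat_cell.
apply: (leq_trans _ (leq_addr _ _)); apply: mixed_radix_lt => //.
apply: (leq_trans _ (leq_addr _ _)); apply: mixed_radix_lt => //.
by rewrite ltn_add2l.
Qed.

(** Squared moduli avoid a root; the second test admits [z = 0], which belongs to the disc even for
    radius 0. *)
Definition in_grid_disc (z : R[i]) : bool :=
  ~~ ((rad * rad <= complex.Re z * complex.Re z + complex.Im z * complex.Im z)
      && ~~ (complex.Re z * complex.Re z + complex.Im z * complex.Im z <= 0)).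

(* After a nonpositive pivot the later ones are meaningless, and may involve a
   division by zero, but they can only repeat a point already found. *)
Definition flat_hit (i : nat) : bool :=
  [&& flat_i i == flat_k i, flat_j i == flat_k i, (2 * n <= flat_k i)%N,
      flat_elim i <= 0 & in_grid_disc (flat_point i)].

Hypothesis bd0 : [/\ 0 <= bd.1.1, 0 <= bd.1.2 & 0 <= bd.2].
Hypothesis hL : n%:R * rad <= L%:R.

Lemma in_grid_discP z : reflect (open_disc rad z) (in_grid_disc z).
Proof.
have [b0 b1 b2] := bd0; have r0 : 0 <= rad by rewrite !addr_ge0.
have E : complex.Re z * complex.Re z + complex.Im z * complex.Im z
    = Normc.normc z ^+ 2 by rewrite nc_sqr !expr2.
rewrite /in_grid_disc E -expr2.
apply: (iffP idP) => [|[w /= w1 <-]].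
  move=> h; have [z0|z0] := eqVneq z 0.
    by exists 0; [rewrite /mkset nc0 ltr01|rewrite mulr0 z0].
  have zp : 0 < Normc.normc z.
    by rewrite lt_neqAle nc_ge0 andbT eq_sym; apply: contra z0 => /eqP/nc0_eq0 ->.
  move: h; rewrite -ltNge exprn_gt0// andbT -ltNge.
  rewrite ltr_pXn2r ?nnegrE ?nc_ge0// => zr.
  have rp : 0 < rad by exact: lt_trans zr.
  exists (rad^-1%:C%C * z); last by rewrite mulrA -rmorphM mulfV ?gt_eqF// rmorph1 mul1r.
  by rewrite /mkset ncM nc_real gtr0_norm ?invr_gt0// mulrC ltr_pdivrMr// mul1r.
rewrite negb_and negbK; rewrite -ltNge ncM nc_real ger0_norm//.
move: r0; rewrite le_eqVlt => /predU1P[<-|rp].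
  by rewrite mul0r expr0n/= lexx orbT.
by rewrite ltr_pXn2r ?nnegrE ?mulr_ge0 ?nc_ge0 ?(ltW rp)// gtr_pMr ?w1.
Qed.

(** Any [L] with [n * rad <= L] will do, as surplus points fail the disc test. *)
Lemma Pi_fin_flat :
  Pi_fin n t bd ([set` sa], [set` sb], [set` sg])
  = [set z | exists2 i, (i < flat_size)%N & flat_hit i /\ z = flat_point i].
Proof.
have [b0 b1 b2] := bd0; have r0 : 0 <= rad by rewrite !addr_ge0.
have np : 0 < n%:R :> R by rewrite ltr0n.
have e0 : 0 <= radius_eps.
  by rewrite /radius_eps addr_ge0 ?divr_ge0// /eps_dagger mulr_ge0 ?addr_ge0
    ?divr_ge0 ?mulr_ge0.
apply/seteqP; split=> z.
  move=> [/= /(@Delta_code R n t sa sb sg n0 radius_eps z e0)[c0 [m mK hnu]] [[a [b zE]] zd]].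
  have [k kn hk] := (@nu_code_le R n t sa sb sg m radius_eps z e0).1 hnu.
  have zr : Normc.normc z <= rad by exact: open_disc_le.
  have Rez : complex.Re z = a%:~R / n%:R.
    by rewrite zE -(rmorph_nat (real_complex R)) -fmorphV Re_mul /=; ring.
  have Imz : complex.Im z = b%:~R / n%:R.
    by rewrite zE -(rmorph_nat (real_complex R)) -fmorphV Im_mul /=; ring.
  have bound (x : int) : `|x%:~R / n%:R : R| <= Normc.normc z ->
      exists2 u, (u < G)%N & x%:~R / n%:R = (u%:R - L%:R) / n%:R :> R.
    move=> h; have : `|x%:~R : R| <= L%:R.
      apply: le_trans hL; rewrite mulrC -ler_pdivrMr//.
      by apply: le_trans zr; rewrite normrM normfV (ger0_norm (ltW np)) in h.
    rewrite -intr_norm -[L%:R]/(L%:Z%:~R) ler_int => xL.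
    exists (absz (x + L%:Z)).
      by rewrite /G; move: xL; clear; lia.
    congr (_ / _); rewrite -[_%:R]/(Posz _)%:~R gez0_abs; last by move: xL; clear; lia.
    by rewrite intrD addrK.
  have [|u uG uE] := bound a; first by rewrite -Rez; exact: Re_le_nc.
  have [|v vG vE] := bound b; first by rewrite -Imz; exact: Im_le_nc.
  pose blk := ((u * G + v) * K + m)%N.
  have kD : (2 * n + k < D)%N by rewrite /D; move: kn; clear; lia.
  have [fj fi fk fb] := flat_cellE blk kD kD kD.
  set idx := flat_cell _ _ _ _ in fj fi fk fb.
  have fc : flat_code idx = m by rewrite /flat_code fb modnMDl modn_small.
  have fg : flat_grid idx = (u * G + v)%N.
    by rewrite /flat_grid fb divnMDl ?divn_small ?addn0//; apply: leq_ltn_trans mK.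
  have fp : flat_point idx = z.
    rewrite /flat_point fg divnMDl ?(leq_ltn_trans _ uG)// (divn_small vG) addn0.
    by rewrite modnMDl modn_small// -uE -vE -Rez -Imz; case: (z).
  exists idx; last first.
    split; last by rewrite fp.
    rewrite /flat_hit /flat_elim fi fj fk fc fp !eqxx leq_addr hk /=.
    exact/in_grid_discP.
  by rewrite /idx /flat_cell /flat_size; do 5 (apply: mixed_radix_lt => //).
move=> [i iT [/and5P[/eqP hi /eqP hj hk he /in_grid_discP hd] ->]].
have T0 : (0 < flat_size)%N by exact: leq_ltn_trans iT.
have K0 : (0 < K)%N by move: T0; rewrite /flat_size !muln_gt0 => /andP[/andP[/andP[/andP[]]]].
have c0 : (0 < c)%N.
  by move: K0; rewrite /K; case: (posnP c) => // ->; rewrite exp0n.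
split.
  rewrite /mkset; apply/(@Delta_code R n t sa sb sg n0 radius_eps _ e0); split=> //.
  exists (flat_code i); first by rewrite ltn_pmod.
  apply/(@nu_code_le R n t sa sb sg _ radius_eps _ e0); exists (flat_k i - 2 * n)%N.
    have : (flat_k i < D)%N by rewrite ltn_pmod.
    by rewrite /D; move: (flat_k i) hk; clear; lia.
  by rewrite subnKC//; move: he; rewrite /flat_elim hi hj.
split; last exact: hd.
exists (Posz (flat_grid i %/ G)%N - L%:Z), (Posz (flat_grid i %% G)%N - L%:Z).
rewrite -(rmorph_nat (real_complex R)) -fmorphV /flat_point.
by apply: complex_ext; rewrite ?Re_mul ?Im_mul /= !intrB; ring.
Qed.

End FlatIndex.

(** * Total correctness rules for the machine *)

Section HoareRules.
Variable R : realType.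
Implicit Types (s : state R) (Q : state R -> Prop).

Definition runs (p : prog) s Q : Prop := exists2 s', exec p s s' & Q s'.

Lemma runs_seq p q s Q : runs p s (fun s' => runs q s' Q) -> runs (PSeq p q) s Q.
Proof. by move=> [s1 h1 [s2 h2 hQ]]; exists s2 => //; exact: exec_seq h1 h2. Qed.

Lemma runs_skip s Q : Q s -> runs PSkip s Q.
Proof. by exists s => //; exact: exec_skip. Qed.

Lemma runs_iset v e s Q : Q (iset s v (ieval s e)) -> runs (PISet v e) s Q.
Proof. by move=> h; eexists; first exact: exec_iset. Qed.

Lemma runs_rset a k e s Q :
  Q (rset s a (ieval s k) (reval s e)) -> runs (PRSet a k e) s Q.
Proof. by move=> h; eexists; first exact: exec_rset. Qed.

Lemma runs_if b p q s Q : runs (if beval s b then p else q) s Q -> runs (PIf b p q) s Q.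
Proof. by move=> [s' h hQ]; exists s' => //; exact: exec_if. Qed.

Lemma runs_le p s Q Q' : (forall s, Q s -> Q' s) -> runs p s Q -> runs p s Q'.
Proof. by move=> h [s' e q]; exists s'; auto. Qed.

Lemma runs_while (b : bexp) (p : prog) (Inv : nat -> state R -> Prop) N s Q :
  Inv N s ->
  (forall n s, Inv n s -> beval s b -> exists2 n', (n' < n)%N & runs p s (Inv n')) ->
  (forall n s, Inv n s -> beval s b = false -> Q s) ->
  runs (PWhile b p) s Q.
Proof.
move=> I0 step stop; elim/ltn_ind: N s I0 => N ih s IN.
case hb : (beval s b); last first.
  by exists s; [exact: exec_while_false|exact: stop IN hb].
have [n' n'N [s1 e1 I1]] := step _ _ IN hb.
have [s2 e2 Q2] := ih _ n'N _ I1.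
by exists s2 => //; exact: exec_while_true hb e1 e2.
Qed.

Definition for_loop (v : nat) (e : iexp) (body : prog) : prog :=
  PSeq (PISet v (IConst 0))
    (PWhile (BIle (IAdd (IReg v) (IConst 1)) e)
      (PSeq body (PISet v (IAdd (IReg v) (IConst 1))))).

(** The bound [e] is evaluated afresh before every iteration, so the invariant has to fix its
    value. *)
Lemma runs_for (v : nat) (e : iexp) (body : prog) (N : nat)
    (Inv : nat -> state R -> Prop) s Q :
  Inv 0%N (iset s v 0) ->
  (forall i s, (i <= N)%N -> ireg s v = i -> Inv i s -> ieval s e = N) ->
  (forall i s, (i < N)%N -> ireg s v = i -> Inv i s ->
     runs body s (fun s' => ireg s' v = i /\ Inv i.+1 (iset s' v i.+1))) ->
  (forall s, Inv N s -> Q s) -> runs (for_loop v e body) s Q.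
Proof.
move=> I0 hN step stop; apply/runs_seq/runs_iset.
pose J k s := exists i, [/\ (i <= N)%N, k = (N - i)%N, ireg s v = i & Inv i s].
apply: (@runs_while _ _ J (N - 0)).
- by exists 0%N; split=> //=; rewrite eqxx.
- move=> _ s1 [i [iN -> si Ii]] /=; rewrite (hN i)// si addn1 => lt.
  exists (N - i.+1)%N; first by lia.
  apply: runs_seq; apply: runs_le (step i s1 lt si Ii) => s2 [s2i I2].
  apply: runs_iset; rewrite /= s2i addn1; exists i.+1.
  by split=> //=; rewrite eqxx.
- move=> k s1 [i [iN _ si Ii]] /=; rewrite (hN i)// si addn1 => /negbT.
  by rewrite -leqNgt => Ni; apply: stop; rewrite (_ : N = i)//; apply/eqP; rewrite eqn_leq Ni iN.
Qed.

End HoareRules.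

(* Truncated subtraction makes these expressions 0 or 1. *)
Definition ind_eq (x y : iexp) : iexp :=
  ISub (IConst 1) (IAdd (ISub x y) (ISub y x)).
Definition ind_lt (x y : iexp) : iexp :=
  ISub (IConst 1) (ISub (IAdd x (IConst 1)) y).
Definition ind_not (b : iexp) : iexp := ISub (IConst 1) b.
Definition ind_and (b c : iexp) : iexp := IMul b c.
Definition RWhen (b : iexp) (e : rexp) : rexp := RMul (RNat b) e.
Definition RNeg (e : rexp) : rexp := RSub (RNat (IConst 0)) e.

Section ExpressionSemantics.
Variables (R : realType) (s : state R).

Lemma ieval_eq x y : ieval s (ind_eq x y) = (ieval s x == ieval s y).
Proof. by rewrite /=; case: eqP => /= ?; lia. Qed.

Lemma ieval_lt x y : ieval s (ind_lt x y) = (ieval s x < ieval s y)%N.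
Proof. by rewrite /=; case: ltnP => /= ?; lia. Qed.

Lemma ieval_not b (c : bool) : ieval s b = c -> ieval s (ind_not b) = ~~ c.
Proof. by move=> h; rewrite /= h; case: c h. Qed.

Lemma ieval_and b b' (c c' : bool) : ieval s b = c -> ieval s b' = c' ->
  ieval s (ind_and b b') = c && c'.
Proof. by move=> h h'; rewrite /= h h'; case: c h; case: c' h'. Qed.

(** A guarded expression is evaluated even when the guard is 0, possibly at meaningless indices; its
    value therefore matters only under [c]. *)
Lemma reval_when b e (c : bool) x : ieval s b = c ->
  (c -> reval s e = x) -> reval s (RWhen b e) = if c then x else 0.
Proof.
by move=> h e1; rewrite /= h; case: c h e1 => _ e1; rewrite ?mul1r ?mul0r ?e1.
Qed.

Lemma reval_add e e' : reval s (RAdd e e') = reval s e + reval s e'.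
Proof. by []. Qed.
Lemma reval_sub e e' : reval s (RSub e e') = reval s e - reval s e'.
Proof. by []. Qed.
Lemma reval_mul e e' : reval s (RMul e e') = reval s e * reval s e'.
Proof. by []. Qed.
Lemma reval_div e e' : reval s (RDiv e e') = reval s e / reval s e'.
Proof. by []. Qed.

Lemma reval_neg e : reval s (RNeg e) = - reval s e.
Proof. by rewrite /= sub0r. Qed.

End ExpressionSemantics.

(* Registers: 0 output size, 1-3 lengths of the input lists, 4 the dimension,
   5 the base of the codes, 6 the number of codes, 7 the grid bound, 8 the loop
   counter.  Arrays: 4 the scalar inputs, 5 the elimination table, 6 the real
   and imaginary parts of the matrix entries given by the codes. *)
Definition eN := IReg 4.
Definition eC := IReg 5.
Definition eK := IReg 6.
Definition eL := IReg 7.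
Definition eI := IReg 8.
Definition eD := IMul (IConst 4) eN.
Definition eG := IAdd (IMul (IConst 2) eL) (IConst 1).

(** Register 0 and array 0 receive the output, so the inputs stored there are moved away; the power
    [c ^ n] takes a loop of multiplications. *)
Definition prog_setup : prog :=
  PSeq (PISet 4 (IReg 0))
  (PSeq (PISet 0 (IConst 0))
  (PSeq (PISet 5 (IMul (IMul (IReg 1) (IReg 2)) (IReg 3)))
  (PSeq (for_loop 8 (IConst 5) (PRSet 4 eI (RGet 0 eI)))
  (PSeq (PISet 6 (IConst 1))
        (for_loop 8 eN (PISet 6 (IMul eK eC))))))).

Definition eRad : rexp :=
  RAdd (RAdd (RGet 4 (IConst 0)) (RGet 4 (IConst 1))) (RGet 4 (IConst 2)).

(** Counting upwards replaces the missing floor operation. *)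
Definition prog_bound : prog :=
  PSeq (PISet 7 (IConst 0))
    (PWhile (BNot (BRle (RMul (RNat eN) eRad) (RNat eL)))
      (PISet 7 (IAdd eL (IConst 1)))).

(** Cell [(m * n + j) * 6 + q] of array 6 belongs to column [j] of code [m]; [q %/ 2] selects the
    diagonal and [q %% 2] the real or imaginary part. *)
Definition eVq := IMod eI (IConst 6).
Definition eVj := IMod (IDiv eI (IConst 6)) eN.
Definition eVm := IDiv (IDiv eI (IConst 6)) eN.
Definition eVd := IMod eVm eC.
Definition eVget (a : nat) (i : iexp) : rexp :=
  RGet a (IAdd (IMul (IConst 2) i) (IMod eVq (IConst 2))).
Definition eVfirst : rexp :=
  RAdd (RAdd (RWhen (ind_eq (IDiv eVq (IConst 2)) (IConst 0))
               (eVget 1 (IMod eVd (IReg 1))))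
             (RWhen (ind_eq (IDiv eVq (IConst 2)) (IConst 1))
               (eVget 2 (IMod (IDiv eVd (IReg 1)) (IReg 2)))))
       (RWhen (ind_eq (IDiv eVq (IConst 2)) (IConst 2))
               (eVget 3 (IDiv (IDiv eVd (IReg 1)) (IReg 2)))).
Definition eVcell (m j q : iexp) : iexp :=
  IAdd (IMul (IAdd (IMul m eN) j) (IConst 6)) q.
(** Digit [j] of [m] is digit [j - 1] of [m %/ c], so a cell written earlier is copied and no power
    of [c] is computed. *)
Definition eV : rexp :=
  RAdd (RWhen (ind_eq eVj (IConst 0)) eVfirst)
       (RWhen (ind_not (ind_eq eVj (IConst 0)))
          (RGet 6 (eVcell (IDiv eVm eC) (ISub eVj (IConst 1)) eVq))).

Definition prog_table : prog :=
  for_loop 8 (IMul (IMul eK eN) (IConst 6)) (PRSet 6 eI eV).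

Definition ej := IMod eI eD.
Definition ei := IMod (IDiv eI eD) eD.
Definition ek := IMod (IDiv (IDiv eI eD) eD) eD.
Definition eblk := IDiv (IDiv (IDiv eI eD) eD) eD.
Definition em := IMod eblk eK.
Definition eg := IDiv eblk eK.
Definition eX : rexp := RDiv (RSub (RNat (IDiv eg eG)) (RNat eL)) (RNat eN).
Definition eY : rexp := RDiv (RSub (RNat (IMod eg eG)) (RNat eL)) (RNat eN).

Definition eT (c : nat) (j : iexp) (b : nat) : rexp :=
  RGet 6 (eVcell em j (IConst (2 * c + b))).
Definition eTre := RGet 4 (IConst 3).
Definition eTim := RGet 4 (IConst 4).
Definition eN1 := ISub eN (IConst 1).

Definition eRe (r c : iexp) : rexp :=
  RAdd (RAdd (RAdd (RAdd
    (RWhen (ind_eq r c) (RSub (eT 1 c 0) eX))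
    (RWhen (ind_eq r (IAdd c (IConst 1))) (eT 0 c 0)))
    (RWhen (ind_eq c (IAdd r (IConst 1))) (eT 2 c 0)))
    (RWhen (ind_and (ind_eq r (IConst 0)) (ind_eq c eN1))
       (RSub (RMul eTre (eT 0 eN1 0)) (RMul eTim (eT 0 eN1 1)))))
    (RWhen (ind_and (ind_eq r eN1) (ind_eq c (IConst 0)))
       (RAdd (RMul eTre (eT 2 (IConst 0) 0)) (RMul eTim (eT 2 (IConst 0) 1)))).

Definition eIm (r c : iexp) : rexp :=
  RAdd (RAdd (RAdd (RAdd
    (RWhen (ind_eq r c) (RSub (eT 1 c 1) eY))
    (RWhen (ind_eq r (IAdd c (IConst 1))) (eT 0 c 1)))
    (RWhen (ind_eq c (IAdd r (IConst 1))) (eT 2 c 1)))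
    (RWhen (ind_and (ind_eq r (IConst 0)) (ind_eq c eN1))
       (RAdd (RMul eTre (eT 0 eN1 1)) (RMul eTim (eT 0 eN1 0)))))
    (RWhen (ind_and (ind_eq r eN1) (ind_eq c (IConst 0)))
       (RSub (RMul eTre (eT 2 (IConst 0) 1)) (RMul eTim (eT 2 (IConst 0) 0)))).

Definition eRmat (p q : iexp) : rexp :=
  let p2 := IMod p (IConst 2) in let q2 := IMod q (IConst 2) in
  let r := IDiv p (IConst 2) in let c := IDiv q (IConst 2) in
  RAdd (RAdd (RWhen (ind_eq p2 q2) (eRe r c))
             (RWhen (ind_lt p2 q2) (RNeg (eIm r c))))
       (RWhen (ind_lt q2 p2) (eIm r c)).

Definition eEps : rexp :=
  RAdd (RMul (RAdd (RGet 4 (IConst 0)) (RGet 4 (IConst 2)))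
             (RDiv (RNat (IConst 22)) (RMul (RNat (IConst 7)) (RNat eN))))
       (RDiv (RNat (IConst 3)) (RNat eN)).

Definition eH := IMul (IConst 2) eN.
Definition eBordered : rexp :=
  let li := ind_lt ei eH in let lj := ind_lt ej eH in
  RAdd (RAdd (RWhen (ind_and li lj) (RNeg (RNat (ind_eq ei ej))))
             (RWhen (ind_and li (ind_not lj)) (eRmat ei (ISub ej eH))))
       (RAdd (RWhen (ind_and (ind_not li) lj) (eRmat ej (ISub ei eH)))
             (RWhen (ind_and (ind_not li) (ind_not lj))
                (RMul (RNeg (RMul eEps eEps)) (RNat (ind_eq ei ej))))).

Definition eCell (k i j : iexp) : iexp :=
  IAdd (IMul (IAdd (IMul (IAdd (IMul eblk eD) k) eD) i) eD) j.
Definition ek1 := ISub ek (IConst 1).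
Definition eElim : rexp :=
  RAdd (RWhen (ind_eq ek (IConst 0)) eBordered)
       (RWhen (ind_not (ind_eq ek (IConst 0)))
         (RSub (RGet 5 (eCell ek1 ei ej))
            (RDiv (RMul (RGet 5 (eCell ek1 ei ek1)) (RGet 5 (eCell ek1 ek1 ej)))
                  (RGet 5 (eCell ek1 ek1 ek1))))).

Definition eNorm2 : rexp := RAdd (RMul eX eX) (RMul eY eY).
Definition bEq (x y : iexp) : bexp := BAnd (BIle x y) (BIle y x).
Definition eHit : bexp :=
  BAnd (bEq ei ek) (BAnd (bEq ej ek) (BAnd (BIle eH ek)
    (BAnd (BRle (RGet 5 eI) (RNat (IConst 0)))
      (BNot (BAnd (BRle (RMul eRad eRad) eNorm2)
                  (BNot (BRle eNorm2 (RNat (IConst 0))))))))).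

Definition prog_main : prog :=
  for_loop 8 (IMul (IMul (IMul (IMul (IMul eG eG) eK) eD) eD) eD)
    (PSeq (PRSet 5 eI eElim)
      (PIf eHit
        (PSeq (PRSet 0 (IMul (IConst 2) (IReg 0)) eX)
        (PSeq (PRSet 0 (IAdd (IMul (IConst 2) (IReg 0)) (IConst 1)) eY)
              (PISet 0 (IAdd (IReg 0) (IConst 1)))))
        PSkip)).

Definition pi_program : prog :=
  PSeq prog_setup (PSeq prog_bound (PSeq prog_table prog_main)).

(** * Correctness of the program *)

Section ProgramCorrectness.
Variables (R : realType) (n : nat) (t : R[i]) (bd : R * R * R).
Variables (sa sb sg : seq R[i]).
Hypothesis n0 : (0 < n)%N.
Hypothesis bd0 : [/\ 0 <= bd.1.1, 0 <= bd.1.2 & 0 <= bd.2].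
Implicit Types (s : state R).

Let c := base_size sa sb sg.
Let K := (c ^ n)%N.
Let D := (4 * n)%N.
Let rad : R := bd.1.1 + bd.1.2 + bd.2.
Let scalars : seq R := [:: bd.1.1; bd.1.2; bd.2; complex.Re t; complex.Im t].

Let regs s := [/\ ireg s 1 = size sa, ireg s 2 = size sb, ireg s 3 = size sg,
  ireg s 4 = n & ireg s 5 = c].
Let lists s := [/\ rarr s 1 = nth 0 (encode sa), rarr s 2 = nth 0 (encode sb)
  & rarr s 3 = nth 0 (encode sg)].
Let consts s := forall i, (i < 5)%N -> rarr s 4 i = nth 0 scalars i.
Let ctx s := [/\ regs s, lists s, consts s & ireg s 6 = K /\ ireg s 0 = 0%N].

Definition cpart (b : nat) (z : R[i]) : R :=
  if b == 0%N then complex.Re z else complex.Im z.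

Lemma nth_encode (l : seq R[i]) (i b : nat) : (i < size l)%N -> (b < 2)%N ->
  nth 0 (encode l) (2 * i + b)%N = cpart b (nth 0 l i).
Proof.
elim: l i => [|z l ih] [|i] // il b2.
  by rewrite muln0 add0n; case: b b2 {ih} => [|[|//]].
by rewrite mulnS -addnA add2n -[LHS]/(nth 0 (encode l) _) ih.
Qed.

Lemma runs_setup : runs prog_setup (input_state n t bd sa sb sg) ctx.
Proof.
apply/runs_seq/runs_iset/runs_seq/runs_iset/runs_seq/runs_iset/runs_seq.
apply: (@runs_for _ _ _ _ 5 (fun i s => [/\ regs s, lists s,
    (forall k, rarr s 0 k = nth 0 scalars k), ireg s 0 = 0%N &
    forall k, (k < i)%N -> rarr s 4 k = nth 0 scalars k])).
- by split.
- by [].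
- move=> i s i5 si [hr hl h0 z0 h4]; apply: runs_rset; rewrite /= si.
  split=> //; split=> // k; rewrite ltnS leq_eqVlt => /predU1P[->|ki] /=.
    by rewrite eqxx h0.
  by rewrite ltn_eqF// h4.
- move=> s [hr hl h0 z0 h4]; apply/runs_seq/runs_iset.
  apply: (@runs_for _ _ _ _ n (fun i s => [/\ regs s, lists s, consts s &
    ireg s 6 = (c ^ i)%N /\ ireg s 0 = 0%N])).
  + by split.
  + by move=> i s1 _ _ [[]].
  + move=> i s1 iN si [hr1 hl1 hc1 [h61 h01]]; apply: runs_iset; split => //=.
    split=> //=; split=> //=; have [_ _ _ _ h5] := hr1.
    by rewrite h61 h5 expnS mulnC.
  + by move=> s1 [? ? ? [? ?]].
Qed.

Let bounded L s := [/\ ctx s, ireg s 7 = L & n%:R * rad <= L%:R].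

Lemma reval_rad s : consts s -> reval s eRad = rad.
Proof. by move=> h; rewrite /= !h. Qed.

Lemma runs_bound s : ctx s -> runs prog_bound s (fun s' => exists L, bounded L s').
Proof.
move=> hs; apply/runs_seq/runs_iset.
pose L0 := (Num.truncn (n%:R * rad)).+1.
have hL0 : n%:R * rad <= L0%:R by apply/ltW; exact: truncnS_gt.
apply: (@runs_while _ _ _ (fun m s => ctx s /\ (ireg s 7 + m = L0)%N) L0).
- by split.
- move=> m s1 [hc hm] /=; have [[_ _ _ h4 _] _ hcon _] := hc.
  have hr := reval_rad hcon; rewrite /= in hr; rewrite h4 hr -ltNge => lt.
  case: m hm => [|m] hm.
    by move: lt; rewrite ltNge -(addn0 (ireg s1 7)) hm hL0.
  exists m => //; apply: runs_iset; split=> //=.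
  by rewrite addn1 addSn -addnS.
- move=> m s1 [hc hm] /=; have [[_ _ _ h4 _] _ hcon _] := hc.
  have hr := reval_rad hcon; rewrite /= in hr; rewrite h4 hr => /negbFE le.
  by exists (ireg s1 7).
Qed.

Definition table_value (m j q : nat) : R := cpart (q %% 2)
  (if (q %/ 2 == 0)%N then code_al sa sb sg m j
   else if (q %/ 2 == 1)%N then code_be sa sb sg m j else code_ga sa sb sg m j).

Let table (N : nat) s := forall m j q, (j < n)%N -> (q < 6)%N ->
  ((m * n + j) * 6 + q < N)%N -> rarr s 6 ((m * n + j) * 6 + q)%N = table_value m j q.

Lemma c_gt0 i (N : nat) : (i < K * N)%N -> (0 < c)%N.
Proof.
by rewrite /K; case: (posnP c) => // ->; rewrite exp0n.
Qed.

Lemma reval_table_entry s m j q : regs s -> lists s -> (0 < c)%N ->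
  ireg s 8 = ((m * n + j) * 6 + q)%N -> (j < n)%N -> (q < 6)%N ->
  table ((m * n + j) * 6 + q)%N s -> reval s eV = table_value m j q.
Proof.
move=> [h1 h2 h3 h4 h5] [l1 l2 l3] c0 h8 jn q6 ht.
have [a0 b0 g0] : [/\ (0 < size sa)%N, (0 < size sb)%N & (0 < size sg)%N].
  by move: c0; rewrite /c /base_size !muln_gt0 => /andP[/andP[]].
have vq : ieval s eVq = q by rewrite /= h8 modnMDl modn_small.
have vj : ieval s eVj = j.
  by rewrite /= h8 h4 divnMDl// (divn_small q6) addn0 modnMDl modn_small.
have vm : ieval s eVm = m.
  by rewrite /= h8 h4 divnMDl// (divn_small q6) addn0 divnMDl// divn_small ?addn0.
have vd : ieval s eVd = (m %% c)%N by rewrite -[LHS]/(ieval s eVm %% ireg s 5)%N vm h5.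
have q2 : (q %% 2 < 2)%N by rewrite ltn_pmod.
have [j0|j0] := eqVneq j 0%N.
  rewrite j0 in vj *.
  have first : reval s eVfirst = table_value m 0 q.
    have dc : (m %% c < c)%N by rewrite ltn_pmod.
    have i1 : (m %% c %% size sa < size sa)%N by rewrite ltn_pmod.
    have i2 : (m %% c %/ size sa %% size sb < size sb)%N by rewrite ltn_pmod.
    have i3 : (m %% c %/ size sa %/ size sb < size sg)%N.
      by rewrite !ltn_divLR// mulnC (mulnC (size sg)) mulnA.
    have g1 : reval s (eVget 1 (IMod eVd (IReg 1))) = cpart (q %% 2) (code_al sa sb sg m 0).
      rewrite /eVget; move: vd vq => /= -> ->; rewrite h1 l1 nth_encode//.
      by rewrite /code_al digit0.
    have g2 : reval s (eVget 2 (IMod (IDiv eVd (IReg 1)) (IReg 2)))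
        = cpart (q %% 2) (code_be sa sb sg m 0).
      rewrite /eVget; move: vd vq => /= -> ->; rewrite h1 h2 l2 nth_encode//.
      by rewrite /code_be digit0.
    have g3 : reval s (eVget 3 (IDiv (IDiv eVd (IReg 1)) (IReg 2)))
        = cpart (q %% 2) (code_ga sa sb sg m 0).
      rewrite /eVget; move: vd vq => /= -> ->; rewrite h1 h2 l3 nth_encode//.
      by rewrite /code_ga digit0.
    have e2 k : ieval s (ind_eq (IDiv eVq (IConst 2)) (IConst k)) = (q %/ 2 == k)%N.
      by rewrite ieval_eq; congr (nat_of_bool (_ == _)); rewrite -[in RHS]vq.
    rewrite /eVfirst !reval_add.
    rewrite (reval_when (e2 0%N) (fun _ => g1)) (reval_when (e2 1%N) (fun _ => g2)).
    rewrite (reval_when (e2 2%N) (fun _ => g3)) /table_value.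
    have : (q %/ 2 < 3)%N by rewrite ltn_divLR.
    by case: (q %/ 2)%N => [|[|[|//]]] _ /=; rewrite ?addr0 ?add0r.
  have e0 : ieval s (ind_eq eVj (IConst 0)) = true by rewrite ieval_eq vj.
  rewrite /eV reval_add.
  rewrite (reval_when e0 (fun _ => first)) (reval_when (ieval_not e0) (x := 0))//.
  by rewrite addr0.
have e0 : ieval s (ind_eq eVj (IConst 0)) = false.
  by rewrite ieval_eq vj /= (negbTE j0).
rewrite /eV reval_add.
rewrite (reval_when e0 (x := 0))// (reval_when (ieval_not e0) (x := table_value m j q)) ?add0r//.
move=> _; rewrite -[LHS]/(rarr s 6 (((ieval s eVm %/ ireg s 5) * ireg s 4
  + (ieval s eVj - 1)) * 6 + ieval s eVq)%N) vm vj vq h4 h5 ht; last 3 first.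
- by rewrite (leq_ltn_trans _ jn)// leq_subr.
- by [].
- rewrite ltn_add2r ltn_pmul2r//; apply: (@leq_ltn_trans (m * n + (j - 1))%N).
    by rewrite leq_add2r leq_mul2r leq_div orbT.
  by rewrite ltn_add2l; lia.
rewrite /table_value /code_al /code_be /code_ga -/c.
by have -> : digit sa sb sg m j = digit sa sb sg (m %/ c) (j - 1);
  rewrite -?digitS ?subn1 ?prednK ?lt0n.
Qed.

Lemma runs_table L s : bounded L s ->
  runs prog_table s (fun s' => bounded L s' /\ table (K * n * 6) s').
Proof.
move=> hs; apply: (@runs_for _ _ _ _ (K * n * 6)%N
  (fun i s => bounded L s /\ table i s)).
- by split=> // m j q _ _.
- by move=> i s1 _ _ [[[[_ _ _ h4 _] _ _ [h6 _]] _ _] _]; rewrite /= h6 h4.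
- move=> i s1 iN si [hb ht]; have [[hr hl hc h60] h7 hL] := hb.
  have c0 : (0 < c)%N by apply: (@c_gt0 i (n * 6)); rewrite mulnA.
  pose q := (i %% 6)%N; pose j := (i %/ 6 %% n)%N; pose m := (i %/ 6 %/ n)%N.
  have iE : i = ((m * n + j) * 6 + q)%N by rewrite -!divn_eq.
  have jn : (j < n)%N by rewrite ltn_pmod.
  have q6 : (q < 6)%N by rewrite ltn_pmod.
  have hV : reval s1 eV = table_value m j q.
    by apply: reval_table_entry => //; rewrite -?iE.
  apply: runs_rset; rewrite hV -[ieval s1 eI]/(ireg s1 8) si.
  split=> //; split; first by split.
  move=> m' j' q' jn' q6'; rewrite ltnS leq_eqVlt => /predU1P[e|lt] /=.
    rewrite e eqxx.
    have -> : q = q' by rewrite /q -e modnMDl modn_small.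
    have -> : j = j'.
      by rewrite /j -e divnMDl// (divn_small q6') addn0 modnMDl modn_small.
    by rewrite /m -e divnMDl// (divn_small q6') addn0 divnMDl// divn_small ?addn0.
  by rewrite ltn_eqF// ht.
- by move=> s1 [].
Qed.

Section MainLoop.
Variable L : nat.

Let hit i := flat_hit n t sa sb sg bd L i.
Let point i := flat_point n sa sb sg L i : R[i].
Let ent i := per_entry n t sa sb sg (flat_code n sa sb sg i) (point i).
Let pivot i := flat_elim n t sa sb sg bd L i.

Section OneStep.
Variables (s : state R) (i : nat).
Hypothesis hr : regs s.
Hypothesis hc : consts s.
Hypothesis h6 : ireg s 6 = K.
Hypothesis h7 : ireg s 7 = L.
Hypothesis h8 : ireg s 8 = i.
Hypothesis ht : table (K * n * 6) s.
Hypothesis c0 : (0 < c)%N.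

Let h4 : ireg s 4 = n. Proof. by have [] := hr. Qed.

Lemma ieval_j : ieval s ej = flat_j n i.
Proof. by rewrite /= h8 h4. Qed.
Lemma ieval_i : ieval s ei = flat_i n i.
Proof. by rewrite /= h8 h4. Qed.
Lemma ieval_k : ieval s ek = flat_k n i.
Proof. by rewrite /= h8 h4. Qed.
Lemma ieval_m : ieval s em = flat_code n sa sb sg i.
Proof. by rewrite /= h8 h4 h6. Qed.

Lemma reval_X : reval s eX = complex.Re (point i).
Proof. by rewrite /= h4 h6 h7 h8. Qed.
Lemma reval_Y : reval s eY = complex.Im (point i).
Proof. by rewrite /= h4 h6 h7 h8. Qed.

Lemma reval_T k e (j b : nat) : ieval s e = j -> (j < n)%N -> (k < 3)%N -> (b < 2)%N ->
  reval s (eT k e b) = table_value (flat_code n sa sb sg i) j (2 * k + b).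
Proof.
move=> ej jn k3 b2.
rewrite -[LHS]/(rarr s 6 ((ieval s em * ireg s 4 + ieval s e) * 6 + (2 * k + b))%N).
rewrite ieval_m ej h4 ht//; first by lia.
apply: mixed_radix_lt; last by lia.
by apply: mixed_radix_lt => //; rewrite ltn_pmod// expn_gt0 c0.
Qed.

Lemma table_valueE m j k b : (b < 2)%N ->
  table_value m j (2 * k + b) = cpart b
    (if k == 0%N then code_al sa sb sg m j
     else if k == 1%N then code_be sa sb sg m j else code_ga sa sb sg m j).
Proof.
move=> b2; rewrite /table_value mulnC modnMDl modn_small// divnMDl//.
by rewrite divn_small// addn0.
Qed.

Lemma Re_when (b : bool) (z : R[i]) :
  complex.Re (b%:R * z) = if b then complex.Re z else 0.
Proof. by case: b; rewrite ?mul1r ?mul0r. Qed.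
Lemma Im_when (b : bool) (z : R[i]) :
  complex.Im (b%:R * z) = if b then complex.Im z else 0.
Proof. by case: b; rewrite ?mul1r ?mul0r. Qed.

Lemma reval_entry (er es : iexp) (r q : nat) : ieval s er = r -> ieval s es = q ->
  (r < n)%N -> (q < n)%N ->
  reval s (eRe er es) = complex.Re (ent i r q) /\
  reval s (eIm er es) = complex.Im (ent i r q).
Proof.
move=> hr' hq rn qn; pose m := flat_code n sa sb sg i.
have e1 : ieval s (ind_eq er es) = (r == q) by rewrite ieval_eq hr' hq.
have e2 : ieval s (ind_eq er (IAdd es (IConst 1))) = (r == q.+1).
  by rewrite ieval_eq hr' /= hq addn1.
have e3 : ieval s (ind_eq es (IAdd er (IConst 1))) = (q == r.+1).
  by rewrite ieval_eq hq /= hr' addn1.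
have hn1 : ieval s eN1 = n.-1 by rewrite /= h4 subn1.
have e4 : ieval s (ind_and (ind_eq er (IConst 0)) (ind_eq es eN1))
    = (r == 0%N) && (q == n.-1).
  by apply: ieval_and; rewrite ieval_eq ?hr' ?hq ?hn1.
have e5 : ieval s (ind_and (ind_eq er eN1) (ind_eq es (IConst 0)))
    = (r == n.-1) && (q == 0%N).
  by apply: ieval_and; rewrite ieval_eq ?hr' ?hq ?hn1.
have n1 : (n.-1 < n)%N by rewrite prednK.
have T k e j b := @reval_T k e j b.
have t3 : reval s eTre = complex.Re t by exact: hc.
have t4 : reval s eTim = complex.Im t by exact: hc.
split.
  rewrite /eRe !reval_add.
  rewrite (reval_when e1 (x := complex.Re (code_be sa sb sg m q - point i))); last first.
    by move=> _; rewrite reval_sub (T _ _ q)// reval_X table_valueE// ReD ReN.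
  rewrite (reval_when e2 (x := complex.Re (code_al sa sb sg m q))); last first.
    by move=> _; rewrite (T _ _ q)// table_valueE.
  rewrite (reval_when e3 (x := complex.Re (code_ga sa sb sg m q))); last first.
    by move=> _; rewrite (T _ _ q)// table_valueE.
  rewrite (reval_when e4 (x := complex.Re (t * code_al sa sb sg m n.-1))); last first.
    move=> _; rewrite reval_sub !reval_mul t3 t4 (T _ _ n.-1)// (T _ _ n.-1)//.
    by rewrite !table_valueE// Re_mul.
  rewrite (reval_when e5 (x := complex.Re (t^* * code_ga sa sb sg m 0))); last first.
    move=> _; rewrite reval_add !reval_mul t3 t4 (T _ _ 0%N)// (T _ _ 0%N)//.
    by rewrite !table_valueE// Re_mul conj_def /= mulNr opprK.
  by rewrite /ent /per_entry !ReD !Re_when ?ReD.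
rewrite /eIm !reval_add.
rewrite (reval_when e1 (x := complex.Im (code_be sa sb sg m q - point i))); last first.
  by move=> _; rewrite reval_sub (T _ _ q)// reval_Y table_valueE// ImD ImN.
rewrite (reval_when e2 (x := complex.Im (code_al sa sb sg m q))); last first.
  by move=> _; rewrite (T _ _ q)// table_valueE.
rewrite (reval_when e3 (x := complex.Im (code_ga sa sb sg m q))); last first.
  by move=> _; rewrite (T _ _ q)// table_valueE.
rewrite (reval_when e4 (x := complex.Im (t * code_al sa sb sg m n.-1))); last first.
  move=> _; rewrite reval_add !reval_mul t3 t4 (T _ _ n.-1)// (T _ _ n.-1)//.
  by rewrite !table_valueE// Im_mul.
rewrite (reval_when e5 (x := complex.Im (t^* * code_ga sa sb sg m 0))); last first.
  move=> _; rewrite reval_sub !reval_mul t3 t4 (T _ _ 0%N)// (T _ _ 0%N)//.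
  by rewrite !table_valueE// Im_mul conj_def /= mulNr.
by rewrite /ent /per_entry !ImD !Im_when ?ImD.
Qed.

Lemma reval_rmat (ep eq : iexp) (p q : nat) : ieval s ep = p -> ieval s eq = q ->
  (p < 2 * n)%N -> (q < 2 * n)%N -> reval s (eRmat ep eq) = rmat (ent i) p q.
Proof.
move=> hp hq pn qn.
have p2 : (p %/ 2 < n)%N by rewrite ltn_divLR// mulnC.
have q2 : (q %/ 2 < n)%N by rewrite ltn_divLR// mulnC.
have dp : ieval s (IDiv ep (IConst 2)) = (p %/ 2)%N by rewrite /= hp.
have dq : ieval s (IDiv eq (IConst 2)) = (q %/ 2)%N by rewrite /= hq.
have mp : ieval s (IMod ep (IConst 2)) = (p %% 2)%N by rewrite /= hp.
have mq : ieval s (IMod eq (IConst 2)) = (q %% 2)%N by rewrite /= hq.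
have [hRe hIm] := reval_entry dp dq p2 q2.
rewrite /eRmat !reval_add.
have e1 := ieval_eq s (IMod ep (IConst 2)) (IMod eq (IConst 2)).
have e2 := ieval_lt s (IMod ep (IConst 2)) (IMod eq (IConst 2)).
have e3 := ieval_lt s (IMod eq (IConst 2)) (IMod ep (IConst 2)).
rewrite mp mq in e1 e2 e3.
rewrite (reval_when e1 (fun _ => hRe)).
rewrite (reval_when e2 (x := - complex.Im (ent i (p %/ 2)%N (q %/ 2)%N))); last first.
  by move=> _; rewrite reval_neg hIm.
rewrite (reval_when e3 (fun _ => hIm)) /rmat.
by case: ltngtP => _; rewrite ?addr0 ?add0r.
Qed.

Lemma reval_eps : reval s eEps = radius_eps n bd.
Proof. by rewrite /= !hc// h4. Qed.

Lemma reval_bordered :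
  reval s eBordered = bordered n (radius_eps n bd) (ent i) (flat_i n i) (flat_j n i).
Proof.
have D0 : (0 < D)%N by rewrite muln_gt0.
have iD : (flat_i n i < D)%N by rewrite ltn_pmod.
have jD : (flat_j n i < D)%N by rewrite ltn_pmod.
have hH : ieval s eH = (2 * n)%N by rewrite /= h4.
have li : ieval s (ind_lt ei eH) = (flat_i n i < 2 * n)%N by rewrite ieval_lt ieval_i hH.
have lj : ieval s (ind_lt ej eH) = (flat_j n i < 2 * n)%N by rewrite ieval_lt ieval_j hH.
have hid : reval s (RNat (ind_eq ei ej)) = (flat_i n i == flat_j n i)%:R.
  by rewrite -[LHS]/((ieval s (ind_eq ei ej))%:R) ieval_eq ieval_i ieval_j.
have ji : ieval s (ISub ej eH) = (flat_j n i - 2 * n)%N.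
  by rewrite -[LHS]/(ieval s ej - ieval s eH)%N ieval_j hH.
have ii : ieval s (ISub ei eH) = (flat_i n i - 2 * n)%N.
  by rewrite -[LHS]/(ieval s ei - ieval s eH)%N ieval_i hH.
rewrite /eBordered !reval_add.
rewrite (reval_when (ieval_and li lj) (x := - (flat_i n i == flat_j n i)%:R)); last first.
  by move=> _; rewrite reval_neg hid.
rewrite (reval_when (ieval_and li (ieval_not lj))
    (x := rmat (ent i) (flat_i n i) (flat_j n i - 2 * n))); last first.
  move=> /andP[l1 l2]; apply: (reval_rmat ieval_i ji l1).
  by move: jD l2; rewrite /D -leqNgt; move: (flat_j n i); clear; lia.
rewrite (reval_when (ieval_and (ieval_not li) lj)
    (x := rmat (ent i) (flat_j n i) (flat_i n i - 2 * n))); last first.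
  move=> /andP[l2 l1]; apply: (reval_rmat ieval_j ii l1).
  by move: iD l2; rewrite /D -leqNgt; move: (flat_i n i); clear; lia.
rewrite (reval_when (ieval_and (ieval_not li) (ieval_not lj))
    (x := - radius_eps n bd ^+ 2 * (flat_i n i == flat_j n i)%:R)); last first.
  by move=> _; rewrite reval_mul hid reval_neg reval_mul reval_eps -expr2.
by rewrite /bordered; case: (flat_i n i < 2 * n)%N; case: (flat_j n i < 2 * n)%N;
  rewrite /= ?addr0 ?add0r.
Qed.

Hypothesis h5 : forall j, (j < i)%N -> rarr s 5 j = pivot j.

Lemma reval_elim : reval s eElim = pivot i.
Proof.
have D0 : (0 < D)%N by rewrite muln_gt0.
have iD : (flat_i n i < D)%N by rewrite ltn_pmod.
have jD : (flat_j n i < D)%N by rewrite ltn_pmod.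
have kD : (flat_k n i < D)%N by rewrite ltn_pmod.
have ek0 : ieval s (ind_eq ek (IConst 0)) = (flat_k n i == 0%N).
  by rewrite ieval_eq ieval_k.
rewrite /eElim reval_add (reval_when ek0 (fun _ => reval_bordered)).
pose E := elim (bordered n (radius_eps n bd) (ent i)).
pose k' := (flat_k n i - 1)%N.
(* All cells read by the update lie in the block of [i], hence belong to the same matrix and grid
   point. *)
have cell (a b : iexp) (a' b' : nat) : (flat_k n i != 0)%N -> ieval s a = a' ->
    ieval s b = b' -> (a' < D)%N -> (b' < D)%N ->
    reval s (RGet 5 (eCell ek1 a b)) = E k' a' b'.
  move=> k0 ha hb aD bD; have kk : (k' < flat_k n i)%N by rewrite /k'; lia.
  have k'D : (k' < D)%N by exact: ltn_trans kD.
  rewrite -[LHS]/(rarr s 5 ((((ieval s eblk * (4 * ireg s 4) + ieval s ek1)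
    * (4 * ireg s 4) + ieval s a) * (4 * ireg s 4) + ieval s b))%N).
  have -> : ieval s eblk = flat_block n i by rewrite /= h8 h4.
  have -> : ieval s ek1 = k' by rewrite -[LHS]/(ieval s ek - 1)%N ieval_k.
  rewrite ha hb h4 -/(flat_cell n (flat_block n i) k' a' b').
  rewrite h5; last first.
    by rewrite -[ltnRHS](flat_cell_id n i); exact: flat_cell_prev.
  have [fj fi fk fb] := flat_cellE n0 (flat_block n i) k'D aD bD.
  rewrite /pivot /flat_elim fj fi fk.
  have fc : flat_code n sa sb sg (flat_cell n (flat_block n i) k' a' b')
     = flat_code n sa sb sg i by rewrite /flat_code fb.
  have fp : flat_point n sa sb sg L (flat_cell n (flat_block n i) k' a' b') = point i.
    by rewrite /point /flat_point /flat_grid fb.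
  by rewrite fc fp.
have k1E : (flat_k n i != 0)%N -> ieval s ek1 = k' /\ (k' < D)%N.
  move=> _; split; first by rewrite -[LHS]/(ieval s ek - 1)%N ieval_k.
  exact: leq_ltn_trans (leq_subr _ _) kD.
rewrite (reval_when (ieval_not ek0) (x := E (flat_k n i) (flat_i n i) (flat_j n i))).
  rewrite /pivot /flat_elim -/(point i) -/(ent i) -/E.
  by have [e|_] := eqVneq (flat_k n i) 0%N; rewrite /= ?addr0 ?add0r// e.
move=> k0; have [k1e k1D] := k1E k0.
rewrite reval_sub reval_div reval_mul (cell _ _ (flat_i n i) (flat_j n i) k0 ieval_i ieval_j)//.
rewrite (cell _ _ (flat_i n i) k' k0 ieval_i k1e)// (cell _ _ k' (flat_j n i) k0 k1e ieval_j)//.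
rewrite (cell _ _ k' k' k0 k1e k1e)//.
by rewrite (_ : flat_k n i = k'.+1)// /k'; lia.
Qed.

End OneStep.

Lemma beval_hit s i : regs s -> consts s -> ireg s 6 = K -> ireg s 7 = L ->
  ireg s 8 = i -> rarr s 5 i = pivot i -> beval s eHit = hit i.
Proof.
move=> hr hc h6 h7 h8 h5; have [_ _ _ h4 _] := hr.
have vi := ieval_i hr h8; have vj := ieval_j hr h8; have vk := ieval_k hr h8.
have vX := reval_X hr h6 h7 h8; have vY := reval_Y hr h6 h7 h8.
have bE x y : beval s (bEq x y) = (ieval s x == ieval s y) by rewrite eqn_leq.
have nE : reval s eNorm2 = complex.Re (point i) * complex.Re (point i)
    + complex.Im (point i) * complex.Im (point i).
  by rewrite /eNorm2 reval_add !reval_mul vX vY.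
rewrite -[LHS]/[&& beval s (bEq ei ek), beval s (bEq ej ek), (2 * ireg s 4 <= ieval s ek)%N,
  (rarr s 5 (ireg s 8) <= 0) & ~~ ((reval s (RMul eRad eRad) <= reval s eNorm2)
     && ~~ (reval s eNorm2 <= 0))].
by rewrite !bE vi vj vk h4 h8 h5 nE reval_mul !reval_rad.
Qed.

Lemma output_set_append s (z : R[i]) :
  output_set (iset (rset (rset s 0 (2 * ireg s 0) (complex.Re z)) 0
    (2 * ireg s 0 + 1) (complex.Im z)) 0 (ireg s 0 + 1)) = output_set s `|` [set z].
Proof.
set s' := iset _ _ _.
have rE l : rarr s' 0 l = if l == (2 * ireg s 0).+1 then complex.Im z
    else if l == (2 * ireg s 0)%N then complex.Re z else rarr s 0 l.
  by rewrite /= addn1.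
have lt k : (k < ireg s 0)%N -> Complex (rarr s' 0 k.*2) (rarr s' 0 k.*2.+1)
    = Complex (rarr s 0 k.*2) (rarr s 0 k.*2.+1).
  move=> kk; rewrite !rE eqSS -mul2n.
  have /negbTE -> : (2 * k != (2 * ireg s 0).+1)%N by lia.
  have /negbTE -> : (2 * k != 2 * ireg s 0)%N by lia.
  by have /negbTE -> : ((2 * k).+1 != 2 * ireg s 0)%N by lia.
have eq : Complex (rarr s' 0 (ireg s 0).*2) (rarr s' 0 (ireg s 0).*2.+1) = z.
  rewrite !rE eqSS -mul2n eqxx.
  have /negbTE -> : (2 * ireg s 0 != (2 * ireg s 0).+1)%N by lia.
  by case: (z).
apply/seteqP; split=> w.
  move=> [k]; rewrite {1}/s' /= addn1 ltnS leq_eqVlt => /predU1P[->|kk] ->.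
    by right; exact: eq.
  by left; exists k => //; exact: lt.
move=> [[k kk ->]|->].
  by exists k; [rewrite /= addn1 ltnS ltnW|rewrite lt].
by exists (ireg s 0); rewrite ?eq//= addn1.
Qed.

Let outputs (i : nat) s := output_set s =
  [set z | exists2 j, (j < i)%N & hit j /\ z = point j].

Lemma runs_main s : bounded L s -> table (K * n * 6) s ->
  runs prog_main s (fun s' => outputs (flat_size n sa sb sg L) s').
Proof.
move=> hb ht.
pose Inv i s := [/\ [/\ regs s, consts s, ireg s 6 = K & ireg s 7 = L],
  table (K * n * 6) s, (forall j, (j < i)%N -> rarr s 5 j = pivot j) & outputs i s].
apply: (@runs_for _ _ _ _ (flat_size n sa sb sg L) Inv).
- have [[hr hl hc [h6 h0]] h7 hL] := hb; split=> //.
  apply/seteqP; split=> z; last by case.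
  by move=> [k]; rewrite /= h0.
- by move=> i s1 _ _ [[[_ _ _ h4 _] hc h6 h7] _ _ _]; rewrite /= h4 h6 h7.
- move=> i s1 iN si [[hr hc h6 h7] ht1 h5 ho].
  have c0 : (0 < c)%N.
    have T0 : (0 < flat_size n sa sb sg L)%N by exact: leq_ltn_trans iN.
    have K0 : (0 < K)%N by move: T0; rewrite /flat_size !muln_gt0 => /andP[/andP[/andP[/andP[]]]].
    by move: K0; rewrite /K; case: (posnP c) => // ->; rewrite exp0n.
  have he := reval_elim hr hc h6 h7 si ht1 c0 h5.
  apply/runs_seq/runs_rset; rewrite he -[ieval s1 eI]/(ireg s1 8) si.
  set s2 := rset s1 5 i (pivot i).
  have h5' j : (j < i.+1)%N -> rarr s2 5 j = pivot j.
    rewrite ltnS leq_eqVlt => /predU1P[->|ji] /=; first by rewrite eqxx.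
    by rewrite ltn_eqF// h5.
  have hr2 : regs s2 by [].
  have hc2 : consts s2 by [].
  have h6' : ireg s2 6 = K by [].
  have h7' : ireg s2 7 = L by [].
  have h8' : ireg s2 8 = i by [].
  have ht2 : table (K * n * 6) s2 by [].
  have ho2 : outputs i s2 by [].
  have hX := reval_X hr2 h6' h7' h8'; have hY := reval_Y hr2 h6' h7' h8'.
  have hh := beval_hit hr2 hc2 h6' h7' h8' (h5' _ (ltnSn i)).
  move: s2 h5' hr2 hc2 h6' h7' h8' ht2 ho2 hX hY hh => s2 h5' hr2 hc2 h6' h7' h8' ht2 ho2 hX hY hh.
  apply: runs_if; rewrite hh; case hi : (hit i); last first.
    apply: runs_skip; split=> //; split=> //.
    rewrite /outputs -[LHS]/(output_set s2) ho2; apply/seteqP; split=> z [j ji [hj ->]].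
      by exists j; first exact: leqW.
    move: ji; rewrite ltnS leq_eqVlt => /predU1P[e|ji]; last by exists j.
    by rewrite e hi in hj.
  apply/runs_seq/runs_rset/runs_seq/runs_rset/runs_iset.
  rewrite hX (_ : reval _ eY = complex.Im (point i)); last exact: hY.
  split=> //; split=> //.
  rewrite /outputs -[LHS]/(output_set (iset (rset (rset s2 0 (2 * ireg s2 0)
    (complex.Re (point i))) 0 (2 * ireg s2 0 + 1) (complex.Im (point i))) 0 (ireg s2 0 + 1))).
  rewrite output_set_append ho2; apply/seteqP; split=> z.
    move=> [[j ji hj]|->]; first by exists j => //; exact: leqW.
    by exists i.
  move=> [j ji [hj ->]]; move: ji; rewrite ltnS leq_eqVlt => /predU1P[->|ji].
    by right.
  by left; exists j.
- by move=> s1 [].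
Qed.

End MainLoop.

End ProgramCorrectness.

Lemma pi_program_computes (R : realType) (n : nat) (t : R[i]) (bd : R * R * R)
    (S : set R[i] * set R[i] * set R[i]) : (0 < n)%N ->
  [/\ 0 <= bd.1.1, 0 <= bd.1.2 & 0 <= bd.2] ->
  computes pi_program n t bd S (Pi_fin n t bd S).
Proof.
move=> n0 bd0 sa sb sg Ea Eb Eg.
apply/runs_seq; apply: runs_le (runs_setup n t bd sa sb sg) => s1 h1.
apply/runs_seq; apply: runs_le (runs_bound h1) => s2 [L h2].
apply/runs_seq; apply: runs_le (runs_table n0 h2) => s3 [h3 ht].
apply: runs_le (runs_main n0 h3 ht) => s4 ->.
have [_ _ hL] := h3; rewrite -(Pi_fin_flat t sa sb sg n0 bd0 hL) Ea Eb Eg.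
by case: S {Ea Eb Eg} => -[].
Qed.

Lemma linf_norm_le (R : realType) (x : int -> R[i]) (c : R) :
  (linf_norm x <= c%:E)%E -> forall j, Normc.normc (x j) <= c.
Proof.
move=> h j; rewrite -lee_fin; apply: le_trans h.
by apply: ereal_sup_ubound; exists j.
Qed.

Theorem proposition8p8 (R : realType) (t : R[i]) (ht : `|t| = 1)
    (B : tridiag R -> R * R * R) (hB : bound_map B)
    (E : tridiag R -> nat -> set R[i] * set R[i] * set R[i])
    (hE : entry_set_map E) :
  (exists p : prog, forall (A : tridiag R) (n : nat),
     Omega_Psi A -> (0 < n)%N ->
     computes p n t (B A) (E A n) (Pi_fin n t (B A) (E A n)))
  /\
  (forall A : tridiag R, Omega_Psi A ->
     [/\ hausdorff (Pi_fin n t (B A) (E A n)) (Spec (tri_op A))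
           @[n --> \oo] --> (0 : \bar R)%E,
         hausdorff (hatPi_fin n t (B A) (E A n)) (Spec (tri_op A))
           @[n --> \oo] --> (0 : \bar R)%E
       & forall n : nat, (0 < n)%N ->
           Spec (tri_op A) `<=` hatPi_fin n t (B A) (E A n) /\
           hatPi_fin n t (B A) (E A n) `<=`
             mink (Spec_eps (eps_dagger n (B A) + 3 / n%:R) (tri_op A))
                  (closed_disc (2 / n%:R))]).
Proof.
have bounds A : Omega_Psi A -> entry_bounds A (B A).1.1 (B A).1.2 (B A).2.
  by move=> hA; have [h1 h2 h3] := hB A hA; split; exact: linf_norm_le.
split.
  exists pi_program => A n hA n0; apply: pi_program_computes => //.
  exact: entry_bounds_ge0 (bounds A hA).
move=> A hA; have bA := bounds A hA.
have t1 : Normc.normc t = 1 by move: ht; rewrite nc_norm => -[].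
have [_ _ _ [Sa [Sb [Sg [[_ ca] [_ cb] [_ cg] psi]]]]] := hA.
have hS n : (0 < n)%N -> _ := hE A n hA.
split.
- exact: (Pi_cvg t1 ca cb cg psi bA hS).
- exact: (hatPi_cvg t1 ca cb cg psi bA hS).
- move=> n n0; split; first exact: (Spec_sub_hatPi t1 bA hS).
  move=> _ [l Pl [w hw <-]]; exists l; last by exists w.
  exact: (Pi_sub_Spec_eps t1 ca cb cg psi bA hS n0 Pl).
Qed.
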